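(* Let $\{A_n\}_{n\ge1}$ be a sequence of matrices satisfying $A_n\in\mathbf{M}_n(\mathbb{C})$, $\mathrm{Tr}(A_n)=0$, and $(\log n)\|A_n\|/n^{1/2}\to0$ as $n\to\infty$. Assume that $$\frac1n\,\mathrm{Tr}(A_n^*A_n)\xrightarrow[n\to\infty]{}a>0,\qquad\frac1n\,\mathrm{Tr}(A_n^2)\xrightarrow[n\to\infty]{}b\in[0,a).$$ Then the rescaled numerical measure $\mu_{\sqrt nA_n}$ converges weakly to the Gaussian measure $f_\infty(z)\,\mathrm{d}z$ on $\mathbb{C}$ as $n\to\infty$, where $$f_\infty(x+iy)=\frac{1}{\pi\sqrt{a^2-b^2}}\;e^{-\frac{x^2}{a+b}-\frac{y^2}{a-b}} .$$
   Context: $\|A\|=\sup\{\|Ax\|:x\in\mathbb{C}^n,\|x\|=1\}$ is the operator norm. The numerical measure $\mu_A$ of $A\in\mathbf{M}_n(\mathbb{C})$ is the Borel probability measure on $\mathbb{C}$ which is the image, under $x\mapsto\langle Ax,x\rangle$ (with $\langle x,y\rangle=y^*x$), of the normalized (probability) Euclidean surface measure on the unit sphere of $\mathbb{C}^n$. $\mathrm{d}z$ is two-dimensional Lebesgue measure on $\mathbb{C}\simeq\mathbb{R}^2$. Weak convergence is that of probability measures. *)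

(* Defs.v *)
From HB Require Import structures.
From mathcomp Require Import all_boot all_order all_algebra.
From mathcomp Require Import all_classical all_reals all_analysis.
From mathcomp Require Import measurable_realfun.
From mathcomp Require Import complex.

Set Implicit Arguments.
Unset Strict Implicit.
Unset Printing Implicit Defensive.

Import Order.TTheory GRing.Theory Num.Theory.
Import numFieldNormedType.Exports.

Local Open Scope classical_set_scope.
Local Open Scope ring_scope.
Local Open Scope complex_scope.
Local Open Scope sesquilinear_scope.

(* C^n is the type 'cV[R[i]]_n, with <x, y> = y^* x. *)
Section hermitian.
Context {R : realType}.

Definition adjmx m n (A : 'M[R[i]]_(m, n)) : 'M[R[i]]_(n, m) := A ^t*.

Definition cdot n (x y : 'cV[R[i]]_n) : R[i] := (adjmx y *m x) 0 0.

Definition l2norm n (x : 'cV[R[i]]_n) : R := Num.sqrt (complex.Re (cdot x x)).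

Definition opnorm n (A : 'M[R[i]]_n) : R :=
  sup [set l2norm (A *m x) | x in [set x : 'cV[R[i]]_n | l2norm x = 1]].

End hermitian.

Section product_sigma_finite.
Local Open Scope ereal_scope.
Context d1 d2 (T1 : measurableType d1) (T2 : measurableType d2) (R : realType).
Variable m1 : {sigma_finite_measure set T1 -> \bar R}.
Variable m2 : {sigma_finite_measure set T2 -> \bar R}.

(* Needed because the canonical instance of the library is not found by
   unification for two abstract sigma-finite measures. *)
Lemma product_sigma_finite : sigma_finite setT (m1 \x m2).
Proof.
have /sigma_finiteP[F [TF ndF Foo]] := sigma_finiteT m1.
have /sigma_finiteP[G [TG ndG Goo]] := sigma_finiteT m2.
exists (fun n => F n `*` G n).
  rewrite -setXTT TF TG predeqE => -[x y]; split.
    move=> [/= [n _ Fnx] [k _ Gky]]; exists (maxn n k) => //; split.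
    - by move: x Fnx; exact/subsetPset/ndF/leq_maxl.
    - by move: y Gky; exact/subsetPset/ndG/leq_maxr.
  by move=> [n _ []/= ? ?]; split; exists n.
move=> k; have [? ?] := Foo k; have [? ?] := Goo k.
split; first exact: measurableX.
by rewrite product_measure1E// lte_mul_pinfty// ge0_fin_numE.
Qed.

End product_sigma_finite.

Lemma pushforward_measureP d1 d2 (T1 : measurableType d1)
    (T2 : measurableType d2) (R : realType)
    (m : {measure set T1 -> \bar R}) (f : T1 -> T2) :
  measurable_fun [set: T1] f ->
  exists nu : {measure set T2 -> \bar R}, pushforward m f = nu.
Proof.
move=> mf; pose nu := [the {measure set T2 -> \bar R} of pushforward m f].
by exists (nu mf).
Qed.

(* The n-fold product of a measure m, on tuples. *)
Section tuple_measure.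
Local Open Scope ereal_scope.
Context d (T : measurableType d) (R : realType).

Definition tcons n (p : T * n.-tuple T) : n.+1.-tuple T := cons_tuple p.1 p.2.

Fixpoint tuple_measure (m : set T -> \bar R) n : set (n.-tuple T) -> \bar R :=
  if n is n'.+1 then pushforward (m \x @tuple_measure m n') (@tcons n')
  else dirac [tuple].

Lemma measurable_tcons n : measurable_fun [set: T * n.-tuple T] (@tcons n).
Proof. by apply: measurable_cons. Qed.

Definition tuncons n (x : n.+1.-tuple T) : T * n.-tuple T :=
  (thead x, behead_tuple x).

Lemma tconsK n : cancel (@tcons n) (@tuncons n).
Proof.
by move=> -[x t]; rewrite /tuncons theadE; congr pair; apply: val_inj.
Qed.

Lemma measurable_tuncons n :
  measurable_fun [set: n.+1.-tuple T] (@tuncons n).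
Proof.
apply: measurable_fun_pair; first exact: measurable_tnth.
exact: measurable_behead.
Qed.

Section step.
Variables (m : {sigma_finite_measure set T -> \bar R}) (n : nat).
Variable mu : {sigma_finite_measure set (n.-tuple T) -> \bar R}.

Let step : set (n.+1.-tuple T) -> \bar R := pushforward (m \x mu) (@tcons n).

Let stepP : exists nu : {measure set (n.+1.-tuple T) -> \bar R}, step = nu.
Proof. exact: pushforward_measureP (@measurable_tcons n). Qed.

Let step0 : step set0 = 0. Proof. by have [nu ->] := stepP. Qed.

Let step_ge0 A : 0 <= step A. Proof. by have [nu ->] := stepP. Qed.

Let step_sigma_additive : semi_sigma_additive step.
Proof. by have [nu ->] := stepP; exact: measure_semi_sigma_additive. Qed.

HB.instance Definition _ :=
  isMeasure.Build _ _ _ step step0 step_ge0 step_sigma_additive.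

Let step_sigma_finite : sigma_finite setT step.
Proof.
have [F FT mF] : sigma_finite setT (m \x mu) by exact: product_sigma_finite.
exists (fun i => (@tuncons n) @^-1` F i).
  by rewrite -preimage_bigcup -FT preimage_setT.
move=> i; split.
  rewrite -[X in measurable X]setTI.
  by apply: measurable_tuncons => //; have [] := mF i.
have [_] := mF i.
congr (_ < _); congr (product_measure1 _ _ _).
by apply/seteqP; split => p /=; rewrite tconsK.
Qed.

HB.instance Definition _ :=
  Measure_isSigmaFinite.Build _ _ _ step step_sigma_finite.

Lemma tuple_measureS_ex :
  exists nu : {sigma_finite_measure set (n.+1.-tuple T) -> \bar R},
    step = nu.
Proof. by exists step. Qed.

End step.

Lemma tuple_measureP (m : {sigma_finite_measure set T -> \bar R}) n :
  exists mu : {sigma_finite_measure set (n.-tuple T) -> \bar R},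
    @tuple_measure m n = mu.
Proof.
elim: n => [|n [mu muE]] /=; first by exists (dirac [tuple]).
by rewrite muE; exact: tuple_measureS_ex.
Qed.

Section instance.
Variables (m : {sigma_finite_measure set T -> \bar R}) (n : nat).
Local Notation mu := (@tuple_measure m n).

Let mu0 : mu set0 = 0. Proof. by have [nu ->] := tuple_measureP m n. Qed.

Let mu_ge0 A : 0 <= mu A. Proof. by have [nu ->] := tuple_measureP m n. Qed.

Let mu_sigma_additive : semi_sigma_additive mu.
Proof.
by have [nu ->] := tuple_measureP m n; exact: measure_semi_sigma_additive.
Qed.

Let mu_sigma_finite : sigma_finite setT mu.
Proof. by have [nu ->] := tuple_measureP m n; exact: sigma_finiteT. Qed.

HB.instance Definition _ :=
  isMeasure.Build _ _ _ mu mu0 mu_ge0 mu_sigma_additive.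

HB.instance Definition _ := Measure_isSigmaFinite.Build _ _ _ mu mu_sigma_finite.

End instance.

End tuple_measure.

(* C is identified with the plane through (x, y) |-> x + iy. The factors are
   measurableTypeR R (a copy of R with its Borel sets) because this is the
   type on which lebesgue_measure is defined. *)
Notation plane R := (measurableTypeR R * measurableTypeR R)%type.

Section plane.
Context {R : realType}.

Definition plane_lebesgue : set (plane R) -> \bar R :=
  (lebesgue_measure \x lebesgue_measure)%E.

Let plane_lebesgue_sigma_finite : sigma_finite setT plane_lebesgue.
Proof. exact: product_sigma_finite. Qed.

HB.instance Definition _ := Measure.on plane_lebesgue.

HB.instance Definition _ :=
  Measure_isSigmaFinite.Build _ _ _ plane_lebesgue plane_lebesgue_sigma_finite.

End plane.

Section sphere.
Context {R : realType} (n : nat).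
Local Notation Cn := (n.-tuple (plane R)).

Definition cvec (t : Cn) : 'cV[R[i]]_n :=
  \col_i ((tnth t i).1 +i* (tnth t i).2).

Definition Cn_norm (t : Cn) : R := l2norm (cvec t).

Definition radial_proj (t : Cn) : Cn :=
  [tuple ((Cn_norm t)^-1 * (tnth t i).1, (Cn_norm t)^-1 * (tnth t i).2) | i < n].

(* Lebesgue measure on C^n, that is, on R^(2n). *)
Definition Cn_lebesgue : set Cn -> \bar R := @tuple_measure _ _ R plane_lebesgue n.

HB.instance Definition _ := SigmaFiniteMeasure.on Cn_lebesgue.

(* The surface measure of the unit sphere of R^N is defined from Lebesgue
   measure through sigma(E) = N * lambda {r u | 0 < r <= 1, u in E}; here
   N = 2n. As a measure on C^n, it is carried by the unit sphere. *)
Definition sphere_surface (E : set Cn) : \bar R :=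
  ((2 * n)%:R%:E *
   Cn_lebesgue [set t | (0 < Cn_norm t <= 1)%R /\ E (radial_proj t)])%E.

Section measurability.
Context d (T : measurableType d).

Let cmeas (f : T -> R[i]) :=
  measurable_fun setT (fun x => complex.Re (f x) : R) /\
  measurable_fun setT (fun x => complex.Im (f x) : R).

Let cmeas_cst c : cmeas (fun=> c). Proof. by split. Qed.

Let cmeasD f g : cmeas f -> cmeas g -> cmeas (fun x => f x + g x).
Proof.
move=> [f1 f2] [g1 g2]; split.
  rewrite (_ : (fun _ => _) =
    (fun x => complex.Re (f x) + complex.Re (g x) : R)).
    exact: measurable_funD.
  by apply/funext => x; case: (f x) (g x) => ? ? [].
rewrite (_ : (fun _ => _) =
  (fun x => complex.Im (f x) + complex.Im (g x) : R)).
  exact: measurable_funD.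
by apply/funext => x; case: (f x) (g x) => ? ? [].
Qed.

Let cmeasM f g : cmeas f -> cmeas g -> cmeas (fun x => f x * g x).
Proof.
move=> [f1 f2] [g1 g2]; split.
  rewrite (_ : (fun _ => _) =
    (fun x => complex.Re (f x) * complex.Re (g x)
            - complex.Im (f x) * complex.Im (g x) : R)).
    by apply: measurable_funB; exact: measurable_funM.
  by apply/funext => x; case: (f x) (g x) => ? ? [].
rewrite (_ : (fun _ => _) =
  (fun x => complex.Re (f x) * complex.Im (g x)
          + complex.Im (f x) * complex.Re (g x) : R)).
  by apply: measurable_funD; exact: measurable_funM.
by apply/funext => x; case: (f x) (g x) => ? ? [].
Qed.

Let cmeas_conj f : cmeas f -> cmeas (fun x => ((f x)^*)%R).
Proof.
move=> [f1 f2]; split.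
  rewrite (_ : (fun _ => _) = (fun x => complex.Re (f x) : R))//.
  by apply/funext => x; case: (f x).
rewrite (_ : (fun _ => _) = (fun x => - complex.Im (f x) : R)).
  exact: measurable_funN.
by apply/funext => x; case: (f x).
Qed.

Let cmeas_sum (I : Type) (r : seq I) (F : I -> T -> R[i]) :
  (forall i, cmeas (F i)) -> cmeas (fun x => \sum_(i <- r) F i x).
Proof.
move=> mF; elim: r => [|i r ih].
  by rewrite (_ : (fun _ => _) = fun=> 0)//; apply/funext => x; rewrite big_nil.
rewrite (_ : (fun _ => _) = fun x => F i x + \sum_(j <- r) F j x).
  exact: cmeasD.
by apply/funext => x; rewrite big_cons.
Qed.

Let cmeas_mulmx p q s (F : T -> 'M[R[i]]_(p, q)) (G : T -> 'M[R[i]]_(q, s)) :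
  (forall i j, cmeas (fun x => F x i j)) ->
  (forall i j, cmeas (fun x => G x i j)) ->
  forall i j, cmeas (fun x => (F x *m G x) i j).
Proof.
move=> mF mG i j.
rewrite (_ : (fun _ => _) = fun x => \sum_k F x i k * G x k j).
  by apply: cmeas_sum => k; exact: cmeasM.
by apply/funext => x; rewrite mxE.
Qed.

Lemma measurable_cdot (F G : T -> 'cV[R[i]]_n) :
  (forall i, cmeas (fun x => F x i 0)) -> (forall i, cmeas (fun x => G x i 0)) ->
  cmeas (fun x => cdot (F x) (G x)).
Proof.
move=> mF mG; apply: cmeas_mulmx => i j; last by rewrite (ord1 j).
rewrite (_ : (fun _ => _) = fun x => ((G x j 0)^*)%R); first exact: cmeas_conj.
by apply/funext => x; rewrite !mxE (ord1 i).
Qed.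

Lemma measurable_Amul (A : 'M[R[i]]_n) (F : T -> 'cV[R[i]]_n) :
  (forall i, cmeas (fun x => F x i 0)) ->
  (forall i, cmeas (fun x => (A *m F x) i 0)).
Proof.
move=> mF i; apply: cmeas_mulmx => [? ?|j k]; first exact: cmeas_cst.
by rewrite (ord1 k).
Qed.

End measurability.

Lemma measurable_cvec i :
  measurable_fun setT (fun t : Cn => complex.Re (cvec t i 0) : R) /\
  measurable_fun setT (fun t : Cn => complex.Im (cvec t i 0) : R).
Proof.
split.
  rewrite (_ : (fun _ => _) = fst \o (fun t : Cn => tnth t i)).
    by apply: measurableT_comp => //; exact: measurable_tnth.
  by apply/funext => t; rewrite mxE.
rewrite (_ : (fun _ => _) = snd \o (fun t : Cn => tnth t i)).
  by apply: measurableT_comp => //; exact: measurable_tnth.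
by apply/funext => t; rewrite mxE.
Qed.

Lemma measurable_Cn_norm : measurable_fun setT Cn_norm.
Proof.
have [mRe _] := measurable_cdot measurable_cvec measurable_cvec.
have msqrt : measurable_fun setT (@Num.sqrt R).
  by apply: continuous_measurable_fun; exact: sqrt_continuous.
exact: (measurableT_comp msqrt mRe).
Qed.

Let measurable_Cn_normV : measurable_fun setT (fun t => (Cn_norm t)^-1).
Proof.
rewrite (_ : (fun _ => _) = (fun t => Cn_norm t `^ (-1))).
  exact: (measurableT_comp (@measurable_powR R (-1)) measurable_Cn_norm).
by apply/funext => t; rewrite powR_inv1 ?sqrtr_ge0.
Qed.

Lemma measurable_radial_proj : measurable_fun setT radial_proj.
Proof.
apply/measurable_fun_tnthP => i.
rewrite (_ : _ \o _ = fun t =>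
  ((Cn_norm t)^-1 * (tnth t i).1, (Cn_norm t)^-1 * (tnth t i).2)).
  have mt := @measurable_tnth _ (plane R) n i.
  by apply: measurable_fun_pair; apply: measurable_funM => //;
    apply: (measurableT_comp _ mt).
by apply/funext => t /=; rewrite tnth_mktuple.
Qed.

Let ball_set : set Cn := [set t | 0 < Cn_norm t <= 1].

Let measurable_ball_set : measurable ball_set.
Proof.
rewrite (_ : ball_set = Cn_norm @^-1` `]0, 1]).
  by rewrite -[X in measurable X]setTI; exact: measurable_Cn_norm.
by apply/seteqP; split => t /=; rewrite in_itv.
Qed.

Let sphere_surfaceP : exists nu : {measure set Cn -> \bar R}, sphere_surface = nu.
Proof.
have [nu nuE] := pushforward_measureP
  (mrestr Cn_lebesgue measurable_ball_set) measurable_radial_proj.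
exists (mscale ((2 * n)%:R)%:nng nu); apply/funext => E.
rewrite /sphere_surface.
transitivity (((2 * n)%:R)%:E * nu E)%E => //.
rewrite -[nu E]/((nu : set _ -> \bar R) E) -nuE.
by congr (_ * Cn_lebesgue _)%E; apply/seteqP; split => t [].
Qed.

Let surface0 : sphere_surface set0 = 0%E.
Proof. by have [nu ->] := sphere_surfaceP. Qed.

Let surface_ge0 A : (0 <= sphere_surface A)%E.
Proof. by have [nu ->] := sphere_surfaceP. Qed.

Let surface_sigma_additive : semi_sigma_additive sphere_surface.
Proof.
by have [nu ->] := sphere_surfaceP; exact: measure_semi_sigma_additive.
Qed.

HB.instance Definition _ := isMeasure.Build _ _ _ sphere_surface
  surface0 surface_ge0 surface_sigma_additive.

(* The second argument of mnormalize is the default value in case the total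
   mass is 0 or +oo; it is only used for n = 0 (sphere_uniformE below). *)
Definition sphere_uniform : probability Cn R :=
  mnormalize sphere_surface (dirac ([tuple (0 : R, 0 : R) | i < n] : Cn)).

Definition numerical_fun (A : 'M[R[i]]_n) (t : Cn) : plane R :=
  let w := cdot (A *m cvec t) (cvec t) in (complex.Re w, complex.Im w).

Lemma measurable_numerical_fun A : measurable_fun setT (numerical_fun A).
Proof.
have [mRe mIm] := measurable_cdot (measurable_Amul A measurable_cvec)
  measurable_cvec.
exact: measurable_fun_pair.
Qed.

HB.instance Definition _ A :=
  isMeasurableFun.Build _ _ _ _ (numerical_fun A) (measurable_numerical_fun A).

Definition numerical_measure (A : 'M[R[i]]_n) : probability (plane R) R :=
  distribution sphere_uniform (numerical_fun A).

End sphere.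

Lemma measurable_cube d (T : measurableType d) n (B : set T) :
  measurable B -> measurable [set t : n.-tuple T | forall i, B (tnth t i)].
Proof.
move=> mB.
rewrite (_ : [set _ | _] =
    \bigcap_(i in [set: 'I_n]) ((fun t : n.-tuple T => tnth t i) @^-1` B)).
  apply: fin_bigcap_measurable => // i _.
  by rewrite -[X in measurable X]setTI; exact: measurable_tnth.
by apply/seteqP; split => t /= h i; [move=> _|]; exact: h.
Qed.

Lemma tuple_measure_cube d (T : measurableType d) (R : realType)
    (m : {sigma_finite_measure set T -> \bar R}) n (B : set T) :
  measurable B ->
  tuple_measure m [set t : n.-tuple T | forall i, B (tnth t i)] =
  (m B ^+ n)%E.
Proof.
move=> mB.
elim: n => [|n ih].
  by rewrite /= diracE mem_set// => -[].
rewrite expeS -ih -product_measure1E//=; last exact: measurable_cube.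
rewrite /pushforward; congr (product_measure1 _ _ _).
apply/seteqP; split => -[x t] /=.
  move=> h; split; first by have := h ord0; rewrite tnth0.
  by move=> i; have := h (lift ord0 i); rewrite tnthS.
by move=> [Bx Bt] i; case: (unliftP ord0 i) => [j|] ->; rewrite ?tnthS ?tnth0.
Qed.

Section sphere_mass.
Context {R : realType} (n : nat).
Local Notation Cn := (n.-tuple (plane R)).

Lemma Cn_normE (t : Cn) :
  Cn_norm t =
  Num.sqrt (\sum_i (((tnth t i).1 : R) ^+ 2 + ((tnth t i).2 : R) ^+ 2)).
Proof.
rewrite /Cn_norm /l2norm /cdot mxE raddf_sum/=; congr Num.sqrt.
apply: eq_bigr => i _; rewrite !mxE/=.
by rewrite mulNr opprK !expr2.
Qed.

Lemma sphere_surface_setT : sphere_surface [set: Cn] =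
  ((2 * n)%:R%:E * Cn_lebesgue [set t : Cn | (0 < Cn_norm t <= 1)%R])%E.
Proof.
by congr (_ * Cn_lebesgue _)%E; apply/seteqP; split => t; [case|].
Qed.

Let measurable_ball :
  measurable [set t : Cn | (0 < Cn_norm t <= 1)%R].
Proof.
rewrite (_ : [set _ | _] = @Cn_norm R n @^-1` `]0, 1]).
  by rewrite -[X in measurable X]setTI; exact: measurable_Cn_norm.
by apply/seteqP; split => t /=; rewrite in_itv.
Qed.

Let cube (l r : R) : set Cn :=
  [set t | forall i, (`]l, r] `*` `]l, r]) (tnth t i)].

Let measurable_cubelr (l r : R) : measurable (cube l r).
Proof. by apply: measurable_cube; exact: measurableX. Qed.

Let cubeE (l r : R) : l <= r ->
  Cn_lebesgue (cube l r) = (((r - l) ^+ 2) ^+ n)%:E.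
Proof.
move=> lr; rewrite /Cn_lebesgue /cube tuple_measure_cube; last first.
  exact: measurableX.
have itvE : lebesgue_measure (`]l, r] : set R) = (r - l)%:E.
  rewrite lebesgue_measure_itv/= lte_fin; case: ltP => // rl.
  by rewrite (@le_anti _ R r l) ?rl// subrr.
rewrite EFin_expe; congr (_ ^+ n)%E.
rewrite expr2 EFinM -itvE; exact: product_measure1E.
Qed.

Lemma sphere_surface_gt0 : (0 < n)%N -> (0 < sphere_surface [set: Cn])%E.
Proof.
move=> n0; rewrite sphere_surface_setT mule_gt0//.
  by rewrite lte_fin ltr0n muln_gt0.
have N0 : 0 < (2 * n)%:R :> R by rewrite ltr0n muln_gt0.
pose c : R := (2 * n)%:R^-1.
have c0 : 0 < c by rewrite invr_gt0.
have c1 : c <= 1 by rewrite invf_le1// ler1n muln_gt0.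
have : (0 < Cn_lebesgue (cube 0 c))%E.
  by rewrite cubeE ?ltW// lte_fin subr0 !exprn_gt0.
move=> /lt_le_trans; apply; apply: le_measure; rewrite ?inE//.
move=> t tc /=; rewrite Cn_normE.
have sq (x : R) : 0 < x <= c -> 0 < x ^+ 2 <= c.
  move=> /andP[x0 xc]; rewrite exprn_gt0//= expr2.
  by apply: (le_trans _ xc); apply: ler_piMr; [exact: ltW|exact: le_trans c1].
have tb i : 0 < ((tnth t i).1 : R) ^+ 2 <= c /\ 0 < ((tnth t i).2 : R) ^+ 2 <= c.
  by have [] := tc i; rewrite /= !in_itv/= => h1 h2; split; exact: sq.
rewrite sqrtr_gt0; apply/andP; split.
  rewrite (bigD1 (Ordinal n0))//= ltr_wpDr//.
    by apply: sumr_ge0 => i _; rewrite addr_ge0// sqr_ge0.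
  by have [/andP[? _] /andP[? _]] := tb (Ordinal n0); exact: addr_gt0.
rewrite -[leRHS]sqrtr1 ler_sqrt ?ler01//.
apply: (@le_trans _ _ (\sum_(i < n) (c + c))).
  by apply: ler_sum => i _; have [/andP[_ ?] /andP[_ ?]] := tb i; exact: lerD.
by rewrite sumr_const card_ord -mulr2n -mulrnA -mulr_natr /c mulVf// gt_eqF.
Qed.

Lemma sphere_surface_lty : (sphere_surface [set: Cn] < +oo)%E.
Proof.
rewrite sphere_surface_setT lte_mul_pinfty ?lee_fin//.
apply: (@le_lt_trans _ _ (Cn_lebesgue (cube (-2) 1))); last first.
  by rewrite cubeE ?ltry// (@le_trans _ _ 0).
apply: le_measure; rewrite ?inE//.
move=> t /= /andP[_ t1] i.
have sqb (x : R) : x ^+ 2 <= 1 -> x \in `]-2, 1].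
  rewrite -[1](expr1n _ 2) -ler_sqrt ?sqr_ge0 ?expr1n// sqrtr1 sqrtr_sqr ler_norml.
  by rewrite in_itv/= => /andP[h ->]; rewrite andbT (lt_le_trans _ h)// ltrN2 ltr1n.
have S1 : \sum_j (((tnth t j).1 : R) ^+ 2 + ((tnth t j).2 : R) ^+ 2) <= 1.
  move: t1; rewrite Cn_normE -{1}sqrtr1 ler_sqrt//.
have {S1}: ((tnth t i).1 : R) ^+ 2 + ((tnth t i).2 : R) ^+ 2 <= 1.
  apply: le_trans S1; rewrite (bigD1 i)//= lerDl sumr_ge0// => j _.
  by rewrite addr_ge0// sqr_ge0.
move=> S1; split; apply: sqb; apply: le_trans S1.
  by rewrite lerDl sqr_ge0.
by rewrite lerDr sqr_ge0.
Qed.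

Lemma sphere_uniformE (E : set Cn) : (0 < n)%N ->
  sphere_uniform n E =
  (sphere_surface E * (fine (sphere_surface [set: Cn]))^-1%:E)%E.
Proof.
move=> n0; rewrite /sphere_uniform /= /mnormalize.
by rewrite gt_eqF ?sphere_surface_gt0// lt_eqF ?sphere_surface_lty.
Qed.

End sphere_mass.

Section gaussian.
Context {R : realType} (a b : R).

Definition gaussian_density (z : plane R) : R :=
  (pi * Num.sqrt (a ^+ 2 - b ^+ 2))^-1 *
  expR (- (z.1 : R) ^+ 2 / (a + b) - (z.2 : R) ^+ 2 / (a - b)).

Definition gaussian_measure (E : set (plane R)) : \bar R :=
  (\int[plane_lebesgue]_(z in E) (gaussian_density z)%:E)%E.

Lemma gaussian_density_ge0 z : 0 <= gaussian_density z.
Proof.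
by rewrite mulr_ge0 ?expR_ge0// invr_ge0 mulr_ge0 ?pi_ge0 ?sqrtr_ge0.
Qed.

Lemma measurable_gaussian_density : measurable_fun setT gaussian_density.
Proof.
apply: measurable_funM => //; apply: measurableT_comp => //.
apply: measurable_funB; apply: measurable_funM => //.
  apply: measurable_funN; apply: measurable_funX; exact: measurable_fst.
apply: measurable_funX; exact: measurable_snd.
Qed.

Let gaussian0 : gaussian_measure set0 = 0%E.
Proof. exact: integral_set0. Qed.

Let gaussian_ge0 E : (0 <= gaussian_measure E)%E.
Proof. by apply: integral_ge0 => z _; rewrite lee_fin gaussian_density_ge0. Qed.

Let gaussian_sigma_additive : semi_sigma_additive gaussian_measure.
Proof.
move=> /= F mF tF mUF; rewrite /gaussian_measure ge0_integral_bigcup//=.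
- apply: is_cvg_ereal_nneg_natsum_cond => k _ _; exact: gaussian_ge0.
- apply/measurable_EFinP; apply: measurable_funTS.
  exact: measurable_gaussian_density.
- by move=> z _; rewrite lee_fin gaussian_density_ge0.
Qed.

HB.instance Definition _ := isMeasure.Build _ _ _ gaussian_measure
  gaussian0 gaussian_ge0 gaussian_sigma_additive.

Lemma gaussian_measure_setT :
  0 <= b < a -> gaussian_measure [set: plane R] = 1%E.
Proof.
move=> /andP[b0 ba].
have amb : 0 < a - b by rewrite subr_gt0.
have apb : 0 < a + b by rewrite ltr_wpDr// (le_lt_trans b0).
pose s1 := Num.sqrt ((a + b) / 2); pose s2 := Num.sqrt ((a - b) / 2).
have s10 : s1 != 0 by rewrite gt_eqF// sqrtr_gt0 divr_gt0.
have s20 : s2 != 0 by rewrite gt_eqF// sqrtr_gt0 divr_gt0.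
have s1E : s1 ^+ 2 *+ 2 = a + b.
  by rewrite sqr_sqrtr ?divr_ge0 ?ltW// -mulr_natr divfK.
have s2E : s2 ^+ 2 *+ 2 = a - b.
  by rewrite sqr_sqrtr ?divr_ge0 ?ltW// -mulr_natr divfK.
have densE (z : plane R) :
    gaussian_density z = normal_pdf 0 s1 z.1 * normal_pdf 0 s2 z.2.
  rewrite !normal_pdfE// /normal_peak /normal_fun !subr0 s1E s2E.
  rewrite mulrACA -expRD -invfM /gaussian_density; congr (_ ^-1 * expR _).
    have sqE (c : R) (s : R) : s ^+ 2 *+ 2 = c -> s ^+ 2 * pi *+ 2 = c * pi.
      by move=> <-; rewrite mulrnAl.
    rewrite (sqE _ _ s1E) (sqE _ _ s2E) -sqrtrM; last first.
      by rewrite mulr_ge0 ?pi_ge0// ltW.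
    rewrite mulrACA -expr2 [(a + b) * _]mulrC -subr_sqr.
    by rewrite [_ * pi ^+ 2]mulrC sqrtrM ?sqr_ge0// sqrtr_sqr ger0_norm ?pi_ge0.
  by rewrite !mulNr.
rewrite /gaussian_measure.
under eq_integral do rewrite densE EFinM.
rewrite /plane_lebesgue [LHS]fubini_tonelli1/=; last 2 first.
- apply: emeasurable_funM; apply/measurable_EFinP.
    by apply: measurableT_comp => //; exact: measurable_normal_pdf.
  by apply: measurableT_comp => //; exact: measurable_normal_pdf.
- by move=> z; rewrite mule_ge0// lee_fin normal_pdf_ge0.
rewrite /fubini_F/=.
under eq_integral => x _.
  rewrite ge0_integralZl//=; last 3 first.
  - by apply/measurable_EFinP; exact: measurable_normal_pdf.
  - by move=> y _; rewrite lee_fin normal_pdf_ge0.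
  - by rewrite lee_fin normal_pdf_ge0.
  rewrite integral_normal_pdf mule1.
  over.
exact: integral_normal_pdf.
Qed.

End gaussian.

Definition weak_cvg {R : realType}
    (mu : nat -> {measure set (plane R) -> \bar R})
    (nu : {measure set (plane R) -> \bar R}) : Prop :=
  forall f : R * R -> R, continuous f -> (exists M, forall z, `|f z| <= M) ->
    (\int[mu n]_z (f z)%:E)%E @[n --> \oo] --> (\int[nu]_z (f z)%:E)%E.

(* Main.v *)
(* A uniform vector on the sphere is g/|g| for a standard complex Gaussian vector
   g of C^n, and |g|^2/n has mean 1 and variance 1/n; hence the law of
   <sqrt n A x, x> is close to that of n^(-1/2) <A g, g>. Every real linear
   functional of the latter is a quadratic form q(g) = <H g, g> with H Hermitian,
   Tr H = 0 and Tr H^2 = v convergent. Gaussian integration by parts gives, with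
   psi(t) = E cos(t q + c),
     psi'(t) = - t v psi(t) + error,
   where the error is controlled by E|<H^2 g, g> - v| <= (Tr H^4)^(1/2), and
   Tr H^4 = O(|A|^2/n) v tends to 0. So the characteristic functions converge to
   the Gaussian one, and trigonometric polynomials approximate bounded continuous
   functions with an error e (1 + |z|^2), integrable by the bound on second
   moments. *)

From HB Require Import structures.
Require Import Defs.
From mathcomp Require Import all_boot all_order all_algebra.
From mathcomp Require Import all_classical all_reals all_analysis.
From mathcomp Require Import complex measurable_realfun lra ring.

Import Order.TTheory GRing.Theory Num.Theory.
Import numFieldNormedType.Exports.

Local Open Scope classical_set_scope.
Local Open Scope ring_scope.
Local Open Scope complex_scope.

Set Implicit Arguments.
Unset Strict Implicit.
Unset Printing Implicit Defensive.

Import HBNNSimple.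

(** * Normal laws on the line and Gaussian products *)

(** Integration by parts is done one complex coordinate at a time: with the others frozen, q is a
    real polynomial c + 2 (x w1 + y w2) + b (x^2 + y^2) in that coordinate, and the one-dimensional
    Stein identity applies along each axis. Integrability is settled once, for all functions bounded
    by a polynomial in |g|^2: they are dominated by a multiple of exp(|g|^2/2), which the density,
    proportional to exp(-|g|^2), integrates. The obstacle in passing to the sphere is the random
    factor r = |g|^2/n: the vectors to compare are w and w/r. The estimate |f(w) - f(w/r)| <= e (1 +
    |w|^2) + K (r - 1)^2 handles it pointwise, and taking means leaves only second moments. It rests
    on a global modulus of continuity, |f(z) - f(w)| <= e (1 + |z|^2) + C (|z1 - w1| + |z2 - w2|),
    which also drives the trigonometric approximation: each coordinate x becomes L sin(x/L), and
    Bernstein averages in the variables (1 + sin(x/L))/2 turn f into a polynomial in sines. Working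
    with cos(t q + c) for every phase c keeps the whole argument real. *)

Section density.
Local Open Scope ereal_scope.
Context d (T : measurableType d) (R : realType).
Variables (m nu : {measure set T -> \bar R}) (w : T -> R).
Hypotheses (w0 : forall x, (0 <= w x)%R) (mw : measurable_fun setT w).
Hypothesis nuE : forall E, measurable E -> nu E = \int[m]_(x in E) (w x)%:E.

Lemma ge0_integral_density (f : T -> \bar R) :
  (forall x, 0 <= f x) -> measurable_fun setT f ->
  \int[nu]_x f x = \int[m]_x (f x * (w x)%:E).
Proof.
move=> f0 mf; pose h := nnsfun_approx measurableT mf.
have mwE : measurable_fun setT (EFin \o w) by exact/measurable_EFinP.
have -> : \int[nu]_x f x = lim (\int[nu]_x (EFin \o h n) x @[n --> \oo]).
  have fE x : f x = lim ((EFin \o h n) x @[n --> \oo]).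
    by apply/esym/cvg_lim => //; exact: cvg_nnsfun_approx.
  under eq_integral => x _ do rewrite fE.
  apply: monotone_convergence => //.
  - by move=> n; apply/measurable_EFinP.
  - by move=> n x Ex //=; rewrite lee_fin.
  - by move=> x Ex a b ab; rewrite lee_fin; exact/lefP/nd_nnsfun_approx.
have -> : \int[m]_x (f x * (w x)%:E) =
    lim (\int[m]_x ((EFin \o h n) x * (w x)%:E) @[n --> \oo]).
  have fE x : f x * (w x)%:E = lim ((EFin \o h n) x * (w x)%:E @[n --> \oo]).
    by apply/esym/cvg_lim => //; apply: cvgeZr => //; exact: cvg_nnsfun_approx.
  under eq_integral => x _ do rewrite fE.
  apply: monotone_convergence => //.
  - by move=> n; apply: emeasurable_funM => //; apply/measurable_EFinP.
  - by move=> n x Ex //=; rewrite mule_ge0 ?lee_fin.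
  - move=> x Ex a b ab; rewrite lee_wpmul2r ?lee_fin//.
    exact/lefP/nd_nnsfun_approx.
congr (limn _); apply/funext => n.
transitivity (\int[nu]_x
   (\sum_(y \in range (h n)) (y * \1_(h n @^-1` [set y]) x)%:E)).
  by apply: eq_integral => t tE; rewrite /= fimfunE -fsumEFin.
have indich r : measurable_fun setT (fun x => (r * \1_(h n @^-1` [set r]) x)%:E).
  by apply/measurable_EFinP; exact: measurable_funM.
rewrite ge0_integral_fsum//; last by move=> r y Ey; exact: nnfun_muleindic_ge0.
transitivity (\int[m]_x (\sum_(y \in range (h n))
    (y * \1_(h n @^-1` [set y]) x)%:E * (w x)%:E)); last first.
  apply: eq_integral => x xE.
  rewrite -ge0_mule_fsuml => [|y]; last exact: nnfun_muleindic_ge0.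
  by rewrite fsumEFin // -(fimfunE _ x).
rewrite ge0_integral_fsum//; last 2 first.
  - by move=> r; apply: emeasurable_funM.
  - by move=> r y Ey; rewrite mule_ge0 ?lee_fin//; exact: nnfun_muleindic_ge0.
apply: eq_fsbigr => r rhn.
under [RHS]eq_integral do rewrite EFinM -muleA.
rewrite integralZl_indic_nnsfun => //.
rewrite integral_indic// setIT nuE//.
have r0 : (0 <= r)%R.
  by move: rhn; rewrite inE => -[x _ <-].
rewrite ge0_integralZl//; last 2 first.
- by apply: emeasurable_funM => //; apply/measurable_EFinP.
- by move=> x _; rewrite mule_ge0 ?lee_fin.
congr (_ * _).
rewrite integral_mkcond; apply: eq_integral => x _.
by rewrite epatch_indic muleC.
Qed.

Lemma integral_density (f : T -> R) :
  measurable_fun setT f ->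
  \int[nu]_x (f x)%:E = \int[m]_x (f x * w x)%:E.
Proof.
move=> mf; rewrite integralE [RHS]integralE.
have mf' : measurable_fun setT (EFin \o f) by exact/measurable_EFinP.
rewrite !ge0_integral_density//; last 2 first.
- exact: measurable_funeneg.
- exact: measurable_funepos.
congr (_ - _); apply: eq_integral => x _; rewrite ?funeposE ?funenegE -?EFinN.
  by rewrite -!EFin_max -EFinM maxr_pMl// mul0r.
by rewrite -!EFin_max -EFinM maxr_pMl// mul0r mulNr.
Qed.

Lemma integrable_density (f : T -> R) :
  measurable_fun setT f ->
  m.-integrable setT (fun x => (f x * w x)%:E) ->
  nu.-integrable setT (EFin \o f).
Proof.
move=> mf /integrableP[_ fw]; apply/integrableP; split.
  exact/measurable_EFinP.
rewrite ge0_integral_density//.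
  under eq_integral do rewrite /= -[X in _ * X%:E]ger0_norm// -EFinM -normrM.
  exact: fw.
by do 2! [apply/measurableT_comp => //].
Qed.

End density.

(** * Integration by parts against a normal law *)

Section gaussian_ibp.
Context (R : realType).
Local Notation mu := (@lebesgue_measure R).

(** The fundamental theorem of calculus on growing symmetric intervals, followed by dominated
    convergence with [h] itself as dominating function. *)
Lemma integral_derive_eq0 (H h : R -> R) :
  (forall x, is_derive x (1:R) H (h x)) -> continuous h ->
  mu.-integrable setT (EFin \o h) ->
  H n%:R @[n --> \oo] --> (0 : R) -> H (- n%:R) @[n --> \oo] --> (0 : R) ->
  (\int[mu]_x (h x)%:E = 0)%E.
Proof.
move=> dH ch ih Hp Hm.
have cH : continuous H.
  by move=> x; apply/differentiable_continuous/derivable1_diffP; case: (dH x).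
(* With [n.+1] the interval is nondegenerate already at n = 0, as the fundamental theorem of
   calculus asks. *)
pose D n := `[(- n.+1%:R : R), n.+1%:R]%classic.
pose f_ n x := ((EFin \o h) \_ (D n)) x.
have mh : measurable_fun setT (EFin \o h) by exact: measurable_int ih.
have [] := @dominated_convergence _ _ _ mu setT measurableT f_ (EFin \o h)
   (fun x => `|(h x)%:E|%E).
- move=> n; apply/(measurable_restrictT _ _).1 => //; first exact: measurable_itv.
  exact: measurable_funTS.
- exact: mh.
- apply: aeW => x _; apply: cvg_near_cst.
  near=> n; rewrite /f_ patchE mem_set// /D /= in_itv/= -ler_norml.
  apply: (@le_trans _ _ n%:R); last by rewrite ler_nat.
  by near: n; exact: nbhs_infty_ger.
- exact: integrable_abse ih.
- apply: aeW => x n _; rewrite /f_ patchE; case: ifP => _ //.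
  by rewrite abse0.
move=> _ _ /= cv.
have E n : (\int[mu]_x f_ n x = (H n.+1%:R - H (- n.+1%:R))%:E)%E.
  rewrite /f_ -integral_mkcond EFinB; apply: continuous_FTC2 => //.
  - by rewrite gtrN// ltr0n.
  - by apply: continuous_subspaceT.
  - split; [by move=> x _; case: (dH x)| |].
      by apply: cvg_at_right_filter; exact: cH.
    by apply: cvg_at_left_filter; exact: cH.
  - by move=> x _; rewrite derive1E; exact: derive_val.

have cv0 : (\int[mu]_x f_ n x)%E @[n --> \oo] --> (0%:E : \bar R).
  rewrite (eq_cvg _ _ E).
  apply: cvg_EFin; first exact: nearW.
  rewrite -[X in _ --> X](subrr (0:R)).
  by apply: cvgB; [rewrite (cvg_shiftS (fun n => H n%:R))|
    rewrite (cvg_shiftS (fun n => H (- n%:R)))].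
exact: (cvg_unique _ cv cv0).
Unshelve. all: by end_near. Qed.

Variable s : R.
Hypothesis s0 : s != 0.
Local Notation pdf := (normal_pdf 0 s).
Local Notation N := (normal_prob 0 s).

Let pdfE x : pdf x = normal_peak s * expR (- x ^+ 2 / (s ^+ 2 *+ 2)).
Proof. by rewrite normal_pdfE// /normal_fun subr0. Qed.

Lemma integrable_expR_sqr :
  mu.-integrable setT (fun x => (expR (x ^+ 2 / (s ^+ 2 *+ 4)) * pdf x)%:E).
Proof.
(* The weight takes away half of the Gaussian exponent: 1/(2 s^2) - 1/(4 s^2) = 1/(4 s^2) = 1/(2
   s'^2). What remains is, up to the peak constants, the density with deviation s'. *)
pose s' := s * Num.sqrt 2.
have s'0 : s' != 0 by rewrite mulf_neq0// gt_eqF// sqrtr_gt0.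
have -> : (fun x => (expR (x ^+ 2 / (s ^+ 2 *+ 4)) * pdf x)%:E) =
    (fun x => ((normal_peak s / normal_peak s')%:E * (normal_pdf 0 s' x)%:E)%E).
  apply/funext => x; rewrite -EFinM; congr EFin.
  rewrite pdfE normal_pdfE// [RHS]mulrA mulfVK; last by rewrite gt_eqF// normal_peak_gt0.
  rewrite /normal_fun subr0 mulrCA -expRD; congr (_ * expR _).
  rewrite /s' exprMn sqr_sqrtr//; field.
  by rewrite s0.
by apply: integrableZl => //; exact: integrable_normal_pdf.
Qed.

Lemma integral_normal_prob (f : R -> R) : measurable_fun setT f ->
  (\int[N]_x (f x)%:E = \int[mu]_x (f x * pdf x)%:E)%E.
Proof.
move=> mf; apply: integral_density => //.
- by move=> x; exact: normal_pdf_ge0.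
- exact: measurable_normal_pdf.
Qed.

Lemma integrable_normal_growth (f : R -> R) (C : R) : measurable_fun setT f ->
  (forall x, `|f x| <= C * expR (x ^+ 2 / (s ^+ 2 *+ 4))) ->
  mu.-integrable setT (fun x => (f x * pdf x)%:E).
Proof.
move=> mf fC; apply: le_integrable (integrableZl _ C integrable_expR_sqr) => //.
  apply/measurable_EFinP; apply: measurable_funM => //.
  exact: measurable_normal_pdf.
move=> x _; rewrite -EFinM lee_fin mulrA !normrM ler_wpM2r//.
by apply: le_trans (fC x) _; rewrite -normrM ler_norm.
Qed.

Lemma normal_growth_integrable (f : R -> R) (C : R) : measurable_fun setT f ->
  (forall x, `|f x| <= C * expR (x ^+ 2 / (s ^+ 2 *+ 4))) ->
  N.-integrable setT (EFin \o f).
Proof.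
move=> mf fC.
apply: (@integrable_density _ _ _ mu _ (normal_pdf 0 s)) => //.
- by move=> x; exact: normal_pdf_ge0.
- exact: measurable_normal_pdf.
- exact: (integrable_normal_growth mf fC).
Qed.

Let dpdf (x : R) : is_derive x (1:R) pdf (- (x / s ^+ 2) * pdf x).
Proof.
have -> : pdf = fun x => normal_peak s * expR (- x ^+ 2 / (s ^+ 2 *+ 2)).
  by apply/funext => y; exact: pdfE.
apply: is_derive_eq.
rewrite /GRing.scale /= !(mulr1, mul1r, addr0, mulr0, expr1).
field.
by rewrite s0.
Qed.

(** Stein's identity: the integrand times the density is the derivative of
    [- s ^+ 2 * (G x * pdf x)]. Bounding [x * G x] instead of [G x] makes this primitive O(1/|x|),
    so the boundary terms vanish. *)
Lemma normal_ibp (G G' : R -> R) (C : R) :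
  (forall x, is_derive x (1:R) G (G' x)) -> continuous G' ->
  (forall x, `|x * G x| <= C * expR (x ^+ 2 / (s ^+ 2 *+ 4))) ->
  (forall x, `|G' x| <= C * expR (x ^+ 2 / (s ^+ 2 *+ 4))) ->
  (\int[N]_x (x * G x - s ^+ 2 * G' x)%:E = 0)%E.
Proof.
move=> dG cG' bG bG'.
have cG : continuous G.
  by move=> x; apply/differentiable_continuous/derivable1_diffP; case: (dG x).
have mG : measurable_fun setT G by exact: continuous_measurable_fun.
have mG' : measurable_fun setT G' by exact: continuous_measurable_fun.
have cp : continuous pdf by exact: continuous_normal_pdf.
have m1 : measurable_fun setT (fun x : R => x * G x) by exact: measurable_funM.
have m2 : measurable_fun setT (fun x : R => x * G x - s ^+ 2 * G' x).
  by apply: measurable_funB => //; exact: measurable_funM.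
have bH x : `|- s ^+ 2 * (G x * pdf x)| * `|x| <= s ^+ 2 * (C * normal_peak s).
  have C0 : 0 <= C by have := bG 0; rewrite mul0r normr0 expr0n/= mul0r expR0 mulr1.
  have -> : `|- s ^+ 2 * (G x * pdf x)| * `|x| = s ^+ 2 * (`|x * G x| * pdf x).
    rewrite -normrM (_ : _ * x = - (s ^+ 2 * ((x * G x) * pdf x))); last by ring.
    by rewrite normrN normrM (ger0_norm (sqr_ge0 s)) normrM (ger0_norm (normal_pdf_ge0 _ _ _)).
  rewrite ler_wpM2l ?sqr_ge0//.
  apply: le_trans (ler_wpM2r (normal_pdf_ge0 _ _ _) (bG x)) _.
  rewrite pdfE -mulrA ler_wpM2l// mulrCA ler_piMr ?normal_peak_ge0//.
  rewrite -expRD -(expR0 R) ler_expR.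
  have -> : x ^+ 2 / (s ^+ 2 *+ 4) + - x ^+ 2 / (s ^+ 2 *+ 2) =
      - (x ^+ 2 / (s ^+ 2 *+ 4)) by field; rewrite s0.
  by rewrite oppr_le0 divr_ge0 ?mulrn_wge0 ?sqr_ge0.
(* Stated for any [u] with |u n| = n, so as to serve both ends of the line. *)
have lim (u : R^nat) : (forall n, `|u n| = n%:R) ->
    (- s ^+ 2 * (G (u n) * pdf (u n))) @[n --> \oo] --> (0 : R).
  move=> un; rewrite -(cvg_shiftS (fun n => - s ^+ 2 * (G (u n) * pdf (u n)))).
  apply: norm_cvg0.
  apply: (@squeeze_cvgr _ _ _ _ (cst 0)
    (fun n => s ^+ 2 * (C * normal_peak s) * harmonic n)).
  - apply: nearW => n /=; rewrite normr_ge0/= ler_pdivlMr ?ltr0n//.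
    by rewrite -un.
  - exact: cvg_cst.
  - rewrite -[X in _ --> X](mulr0 (s ^+ 2 * (C * normal_peak s))).
    by apply: cvgMr; exact: cvg_harmonic.
rewrite integral_normal_prob//.
apply: (@integral_derive_eq0 (fun x => - s ^+ 2 * (G x * pdf x))
  (fun x => (x * G x - s ^+ 2 * G' x) * pdf x)).
- move=> x; have dGp := is_deriveZ (- s ^+ 2) (is_deriveM (dG x) (dpdf x)).
  apply: (is_derive_eq dGp).
  rewrite /GRing.scale /=; field.
  by rewrite s0.
- move=> x; apply: cvgM; last exact: cp.
  apply: cvgB; first by apply: cvgM; [exact: cvg_id|exact: cG].
  by apply: cvgM; [exact: cvg_cst|exact: cG'].
- apply: (@integrable_normal_growth _ (C + s ^+ 2 * C)) => //.
  move=> x; apply: le_trans (ler_normB _ _) _.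
  rewrite mulrDl lerD// normrM ger0_norm ?sqr_ge0// -mulrA.
  by rewrite ler_wpM2l ?sqr_ge0.
- by apply: (lim (fun n => n%:R)) => n; rewrite ger0_norm.
- by apply: (lim (fun n => - n%:R)) => n; rewrite normrN ger0_norm.
Qed.

End gaussian_ibp.

(** * Fubini on tuples and Gaussian products *)

Section tuple_integral.
Local Open Scope ereal_scope.
Context d (T : measurableType d) (R : realType).
Variable m : {sigma_finite_measure set T -> \bar R}.
Local Notation tm n := (@tuple_measure _ _ _ m n).

Lemma ge0_integral_tuple_measureS n (f : n.+1.-tuple T -> \bar R) :
  measurable_fun setT f -> (forall t, 0 <= f t) ->
  \int[tm n.+1]_t f t =
  \int[m]_z \int[tm n]_t f (tcons (z, t)).
Proof.
move=> mf f0.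
transitivity (\int[pushforward (m \x tm n) (@tcons _ T n)]_t f t) => //.
rewrite ge0_integral_pushforward//; last exact: measurable_tcons.
rewrite preimage_setT fubini_tonelli1// => [|p]; last exact: f0.
by apply: measurableT_comp => //; exact: measurable_tcons.
Qed.

(** The two orders serve different purposes: with the head outermost one can recurse into the tail,
    with the head innermost one can integrate the head alone. *)
Lemma integral_tuple_measureS n (f : n.+1.-tuple T -> \bar R) :
  (tm n.+1).-integrable setT f ->
  \int[tm n.+1]_t f t =
    \int[m]_z \int[tm n]_t f (tcons (z, t)) /\
  \int[tm n.+1]_t f t =
    \int[tm n]_t \int[m]_z f (tcons (z, t)).
Proof.
move=> fi.
have mf : measurable_fun setT f by exact: measurable_int fi.
have fi' : (m \x tm n).-integrable setT (f \o @tcons _ T n).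
  apply/integrableP; split.
    by apply: measurableT_comp => //; exact: measurable_tcons.
  move/integrableP : fi => [_].
  rewrite ge0_integral_tuple_measureS//; last exact: measurableT_comp.
  rewrite [X in _ -> X < _]fubini_tonelli1//=.
  apply: measurableT_comp => //.
  by apply: measurableT_comp => //; exact: measurable_tcons.
have -> : \int[tm n.+1]_t f t =
    \int[m \x tm n]_p (f \o @tcons _ T n) p.
  transitivity (\int[pushforward (m \x tm n) (@tcons _ T n)]_t f t) => //.
  by rewrite integral_pushforward//; exact: measurable_tcons.
by split; [rewrite -integral12_prod_meas1|rewrite -integral21_prod_meas1].
Qed.

End tuple_integral.

Section plane_gauss.
Context {R : realType}.
Local Notation mu := (@lebesgue_measure R).

Definition plane_gauss (s1 s2 : R) : set (plane R) -> \bar R :=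
  (normal_prob 0 s1 \x normal_prob 0 s2)%E.

Let plane_gauss_sigma_finite s1 s2 : sigma_finite setT (plane_gauss s1 s2).
Proof. exact: product_sigma_finite. Qed.

HB.instance Definition _ s1 s2 := Measure.on (plane_gauss s1 s2).

HB.instance Definition _ s1 s2 :=
  Measure_isSigmaFinite.Build _ _ _ (plane_gauss s1 s2)
    (plane_gauss_sigma_finite s1 s2).

Let plane_gauss_setT s1 s2 : plane_gauss s1 s2 setT = 1%E.
Proof.
rewrite -setXTT /plane_gauss -[LHS]/((normal_prob 0 s1 \x normal_prob 0 s2)%E _).
have P s : normal_prob 0 s [set: measurableTypeR R] = 1%E.
  exact: (@probability_setT _ _ _ (normal_prob 0 s)).
by rewrite product_measure1E// [X in (X * _)%E]P [X in (_ * X)%E]P mule1.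
Qed.

HB.instance Definition _ s1 s2 :=
  Measure_isProbability.Build _ _ _ (plane_gauss s1 s2) (plane_gauss_setT s1 s2).

End plane_gauss.

Section plane_growth.
Context {R : realType} (s : R).
Hypothesis s0 : s != 0.
Local Notation mu := (@lebesgue_measure R).

(** The exponent is half of the one in the Gaussian density, with opposite sign; the weight is thus
    integrable and still dominates every polynomial. *)
Definition gweight (z : plane R) : R :=
  expR (((z.1 : R) ^+ 2 + (z.2 : R) ^+ 2) / (s ^+ 2 *+ 4)).

Lemma gweight_ge0 z : 0 <= gweight z. Proof. exact: expR_ge0. Qed.

Lemma measurable_gweight : measurable_fun setT gweight.
Proof.
apply: measurableT_comp => //; apply: measurable_funM => //.
apply: measurable_funD; apply: measurable_funX; [exact: measurable_fst|exact: measurable_snd].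
Qed.

Let intw : (normal_prob 0 s).-integrable setT (fun x : R => (expR (x ^+ 2 / (s ^+ 2 *+ 4)))%:E).
Proof.
apply: (normal_growth_integrable s0 (C := 1)) => [|x].
  by apply: measurableT_comp => //; apply: measurable_funM => //; exact: measurable_funX.
by rewrite mul1r ger0_norm ?expR_ge0.
Qed.

Lemma integral_gweight_lty : (\int[plane_gauss s s]_z (gweight z)%:E < +oo)%E.
Proof.
rewrite [X in (X < _)%E]fubini_tonelli1//=; last 2 first.
- by apply/measurable_EFinP; exact: measurable_gweight.
- by move=> z; rewrite lee_fin gweight_ge0.
have intw' := intw.
move/integrableP : intw' => [mw].
under eq_integral do rewrite /= ger0_norm ?expR_ge0//.
set K := (X in (X < _)%E) => K_lty.
have K0 : (0 <= K)%E by apply: integral_ge0 => x _; rewrite lee_fin expR_ge0.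
rewrite /fubini_F /gweight /=.
have -> : (\int[normal_prob 0 s]_x \int[normal_prob 0 s]_y
   (expR ((x ^+ 2 + y ^+ 2) / (s ^+ 2 *+ 4)))%:E)%E = (K * K)%E.
  rewrite -[in RHS]ge0_integralZr//.
  apply: eq_integral => x _.
  rewrite -ge0_integralZl ?lee_fin ?expR_ge0//.
  by apply: eq_integral => y _; rewrite -EFinM -expRD mulrDl.
by rewrite lte_mul_pinfty// ge0_fin_numE.
Qed.

End plane_growth.

Section tuple_growth.
Context {R : realType} (s : R).
Hypothesis s0 : s != 0.
Local Notation Gm n := (@tuple_measure _ _ R (plane_gauss s s) n).
Local Notation Cn n := (n.-tuple (plane R)).

Definition tweight n (t : Cn n) : R := \prod_(i < n) gweight s (tnth t i).

Lemma tweight_ge0 n (t : Cn n) : 0 <= tweight t.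
Proof. by apply: prodr_ge0 => i _; exact: gweight_ge0. Qed.

Lemma measurable_tweight n : measurable_fun setT (@tweight n).
Proof.
apply: measurable_prod => i _.
by apply: measurableT_comp; [exact: measurable_gweight|exact: measurable_tnth].
Qed.

Lemma tweight_cons n z (t : Cn n) : tweight (tcons (z, t)) = gweight s z * tweight t.
Proof.
rewrite /tweight big_ord_recl tnth0; congr (_ * _).
by apply: eq_bigr => i _; rewrite tnthS.
Qed.

Lemma integral_tweight_lty n : (\int[Gm n]_t (tweight t)%:E < +oo)%E.
Proof.
elim: n => [|n ih].
  rewrite integral_dirac//= ?diracE ?mem_set// ?mul1e ?ltry//.
  apply/measurable_EFinP; exact: measurable_tweight.
rewrite ge0_integral_tuple_measureS//; last 2 first.
- by apply/measurable_EFinP; exact: measurable_tweight.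
- by move=> t; rewrite lee_fin tweight_ge0.
have K0 : (0 <= \int[Gm n]_t (tweight t)%:E)%E.
  by apply: integral_ge0 => t _; rewrite lee_fin tweight_ge0.
under eq_integral => z _.
  under eq_integral do rewrite tweight_cons EFinM.
  rewrite ge0_integralZl ?lee_fin ?gweight_ge0//; last 2 first.
  - by apply/measurable_EFinP; exact: measurable_tweight.
  - by move=> t _; rewrite lee_fin tweight_ge0.
  over.
rewrite ge0_integralZr//; last 2 first.
- by apply/measurable_EFinP; exact: measurable_gweight.
- by move=> z _; rewrite lee_fin gweight_ge0.
have w0 : (0 <= \int[plane_gauss s s]_z (gweight s z)%:E)%E.
  by apply: integral_ge0 => z _; rewrite lee_fin gweight_ge0.
by apply: lte_mul_pinfty => //; rewrite ge0_fin_numE// integral_gweight_lty.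
Qed.

Lemma growth_integrable n (f : Cn n -> R) (C : R) : measurable_fun setT f ->
  (forall t, `|f t| <= C * tweight t) -> (Gm n).-integrable setT (EFin \o f).
Proof.
move=> mf fC.
have iw : (Gm n).-integrable setT (fun t => (tweight t)%:E).
  apply/integrableP; split; first by apply/measurable_EFinP; exact: measurable_tweight.
  under eq_integral do rewrite abse_EFin ger0_norm ?tweight_ge0//.
  exact: integral_tweight_lty.
apply: le_integrable (integrableZl _ C iw) => //; first exact/measurable_EFinP.
move=> t _; rewrite -EFinM lee_fin.
by apply: le_trans (fC t) _; rewrite ler_norm.
Qed.

Definition upd n (t : Cn n) (j : 'I_n) (z : plane R) : Cn n :=
  [tuple (if i == j then z else tnth t i) | i < n].

Lemma upd_cons0 n z0 (t : Cn n) z : upd (tcons (z0, t)) ord0 z = tcons (z, t).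
Proof.
apply: eq_from_tnth => i; rewrite tnth_mktuple.
case: (unliftP ord0 i) => [j|] ->; last by rewrite eqxx tnth0.
by rewrite eq_sym (negbTE (neq_lift _ _)) !tnthS.
Qed.

Lemma upd_consS n z0 (t : Cn n) j z :
  upd (tcons (z0, t)) (lift ord0 j) z = tcons (z0, upd t j z).
Proof.
apply: eq_from_tnth => i; rewrite tnth_mktuple.
case: (unliftP ord0 i) => [k|] ->.
  by rewrite (inj_eq lift_inj) !tnthS tnth_mktuple.
by rewrite (negbTE (neq_lift _ _)) !tnth0.
Qed.

(** Fubini with the j-th coordinate innermost; the growth bound supplies the integrability that
    allows the exchange. *)
Lemma integral_coord_eq0 n (j : 'I_n) (f : Cn n -> R) (C : R) :
  measurable_fun setT f -> (forall t, `|f t| <= C * tweight t) ->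
  (forall t, \int[plane_gauss s s]_z (f (upd t j z))%:E = 0)%E ->
  (\int[Gm n]_t (f t)%:E = 0)%E.
Proof.
elim: n j f C => [[]//|n ih] j f C mf fC f0.
have fi := growth_integrable mf fC.
have [E1 E2] := integral_tuple_measureS fi.
case: (unliftP ord0 j) => [k|] jE.
  rewrite E1; apply: integral0_eq => z _.
  (* Once the head is frozen at z, its weight becomes part of the constant. *)
  apply: (ih k _ (C * gweight s z)).
  - apply: measurableT_comp => //; apply: measurableT_comp => //.
    exact: measurable_tcons.
  - by move=> t; rewrite -mulrA -tweight_cons.
  - by move=> t; rewrite -[RHS](f0 (tcons (z, t))) jE; apply: eq_integral => x _;
      rewrite upd_consS.
rewrite E2; apply: integral0_eq => t _.
(* The head (0, 0) is a placeholder, overwritten by [upd]. *)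
rewrite -[RHS](f0 (tcons (((0, 0) : plane R), t))) jE; apply: eq_integral => x _.
by rewrite upd_cons0.
Qed.

End tuple_growth.

(** * Functions of polynomial growth *)

Section poly_growth.
Context d (T : measurableType d) (R : realType) (u : T -> R).
Hypothesis u0 : forall t, 0 <= u t.

(** An algebra of functions, so that integrability can be read off from the shape of an expression.
    The control [u] is x^2 on the line, and the squared norm on the plane and on C^n. *)
Definition pgrowth (h : T -> R) :=
  measurable_fun setT h /\
  exists C k, 0 <= C /\ forall t, `|h t| <= C * (1 + u t) ^+ k.

Let u1 t : 1 <= 1 + u t. Proof. by rewrite lerDl. Qed.
Let u1k t k : 1 <= (1 + u t) ^+ k. Proof. exact: exprn_ege1. Qed.

Lemma pgrowth_cst c : pgrowth (fun=> c).
Proof.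
split; first exact: measurable_cst.
by exists `|c|, 0%N; split=> // t; rewrite expr0 mulr1.
Qed.

Lemma pgrowthD f g : pgrowth f -> pgrowth g -> pgrowth (fun t => f t + g t).
Proof.
move=> [mf [C [k [C0 fC]]]] [mg [D [l [D0 gD]]]].
split; first exact: measurable_funD.
exists (C + D), (k + l)%N; split=> [|t]; first exact: addr_ge0.
apply: le_trans (ler_normD _ _) _; rewrite mulrDl exprD; apply: lerD.
  apply: le_trans (fC t) _; rewrite ler_wpM2l// ler_peMr// (le_trans ler01)//.
apply: le_trans (gD t) _; rewrite ler_wpM2l// ler_peMl// (le_trans ler01)//.
Qed.

Lemma pgrowthM f g : pgrowth f -> pgrowth g -> pgrowth (fun t => f t * g t).
Proof.
move=> [mf [C [k [C0 fC]]]] [mg [D [l [D0 gD]]]].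
split; first exact: measurable_funM.
exists (C * D), (k + l)%N; split=> [|t]; first exact: mulr_ge0.
rewrite normrM exprD mulrACA; exact: ler_pM.
Qed.

Lemma pgrowthN f : pgrowth f -> pgrowth (fun t => - f t).
Proof.
move=> [mf [C [k [C0 fC]]]]; split; first exact: measurable_funN.
by exists C, k; split=> // t; rewrite normrN.
Qed.

Lemma pgrowthB f g : pgrowth f -> pgrowth g -> pgrowth (fun t => f t - g t).
Proof. by move=> pf pg; apply: pgrowthD => //; exact: pgrowthN. Qed.

Lemma pgrowthX f k : pgrowth f -> pgrowth (fun t => f t ^+ k).
Proof.
move=> pf; elim: k => [|k ih]; first exact: (pgrowth_cst 1).
under eq_fun do rewrite exprS.
exact: pgrowthM.
Qed.

Lemma pgrowth_sum (I : Type) (r : seq I) (F : I -> T -> R) :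
  (forall i, pgrowth (F i)) -> pgrowth (fun t => \sum_(i <- r) F i t).
Proof.
move=> pF; elim: r => [|i r ih].
  by under eq_fun do rewrite big_nil; exact: pgrowth_cst.
by under eq_fun do rewrite big_cons; exact: pgrowthD.
Qed.

(** Linear growth of [phi] covers all test functions used below: constants, the identity, the
    absolute value, sines and cosines. *)
Lemma pgrowth_comp (phi : R -> R) K f :
  measurable_fun setT phi -> (forall x, `|phi x| <= K * (1 + `|x|)) ->
  pgrowth f -> pgrowth (fun t => phi (f t)).
Proof.
move=> mphi bphi [mf [C [k [C0 fC]]]].
have K0 : 0 <= K.
  by have := le_trans (normr_ge0 _) (bphi 0); rewrite normr0 addr0 mulr1.
split; first exact: measurableT_comp.
exists (K * (1 + C)), k; split=> [|t]; first by rewrite mulr_ge0// addr_ge0.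
apply: le_trans (bphi _) _; rewrite -mulrA ler_wpM2l// mulrDl mul1r lerD//.
Qed.

Lemma pgrowth_sqr (f : T -> R) : measurable_fun setT f -> (forall t, f t ^+ 2 <= u t) ->
  pgrowth f.
Proof.
move=> mf fu; split=> //; exists 1, 1%N; split=> // t; rewrite mul1r expr1.
have := fu t; rewrite -real_normK ?num_real//.
have := u0 t; move: `|f t| (u t) => x v v0 xv.
by nra.
Qed.

(** With m = 2 (k + 1), 1 + u <= m (1 + u/m) <= m exp(u/m), and exp(u/m)^k <= exp(u/m)^(k+1) =
    exp(u/2). Using k + 1 keeps m positive when k = 0. *)
Lemma pgrowth_expR f : pgrowth f ->
  exists C, forall t, `|f t| <= C * expR (u t / 2).
Proof.
move=> [_ [C [k [C0 fC]]]].
exists (C * (2 * k.+1%:R) ^+ k) => t; apply: le_trans (fC t) _.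
rewrite -mulrA ler_wpM2l//.
have -> : expR (u t / 2) = expR (u t / (2 * k.+1%:R)) ^+ k.+1.
  rewrite -expRM_natl; congr expR.
  have k0 : k.+1%:R != 0 :> R by rewrite pnatr_eq0.
  by field; rewrite addrC natr1 k0.
have k1 : 1 <= 2 * k.+1%:R :> R by rewrite -natrM ler1n muln_gt0.
have e1 : 1 <= expR (u t / (2 * k.+1%:R)).
  by rewrite -[leLHS](expR0 R) ler_expR divr_ge0// (le_trans ler01).
apply: (@le_trans _ _ ((2 * k.+1%:R) ^+ k * expR (u t / (2 * k.+1%:R)) ^+ k)).
  rewrite -exprMn; apply: lerXn2r; rewrite ?nnegrE ?(le_trans ler01)//.
    by rewrite (le_trans _ (_ : 1 * 1 <= _)) ?ler_pM// mulr1.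
  apply: (@le_trans _ _ (2 * k.+1%:R * (1 + u t / (2 * k.+1%:R)))).
    rewrite mulrDr mulr1 mulrCA mulfV ?mulr1 ?lerD//.
  by rewrite ler_wpM2l ?expR_ge1Dx// (le_trans ler01).
by rewrite ler_wpM2l ?exprn_ge0 ?(le_trans ler01)// exprS ler_peMl// exprn_ge0// (le_trans ler01).
Qed.

End poly_growth.

Section gauss_plane_zero.
Context {R : realType} (s : R).
Hypothesis s0 : s != 0.
Local Notation N := (normal_prob 0 s).

Lemma gweight_growth_integrable (f : plane R -> R) C : measurable_fun setT f ->
  (forall z, `|f z| <= C * gweight s z) ->
  (plane_gauss s s).-integrable setT (EFin \o f).
Proof.
move=> mf fC.
have iw : (plane_gauss s s).-integrable setT (fun t => (gweight s t)%:E).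
  apply/integrableP; split; first by apply/measurable_EFinP; exact: measurable_gweight.
  under eq_integral do rewrite abse_EFin ger0_norm ?gweight_ge0//.
  exact: integral_gweight_lty.
apply: le_integrable (integrableZl _ C iw) => //; first exact/measurable_EFinP.
move=> t _; rewrite -EFinM lee_fin.
by apply: le_trans (fC t) _; rewrite ler_norm.
Qed.

Lemma integral_plane_eq0_fst (f : plane R -> R) C : measurable_fun setT f ->
  (forall z, `|f z| <= C * gweight s z) ->
  (forall y, \int[N]_x (f (x, y))%:E = 0)%E ->
  (\int[plane_gauss s s]_z (f z)%:E = 0)%E.
Proof.
move=> mf fC f0; have fi := gweight_growth_integrable mf fC.
rewrite -[LHS](integral21_prod_meas1 fi); apply: integral0_eq => y _.
exact: f0.
Qed.

Lemma integral_plane_eq0_snd (f : plane R -> R) C : measurable_fun setT f ->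
  (forall z, `|f z| <= C * gweight s z) ->
  (forall x, \int[N]_y (f (x, y))%:E = 0)%E ->
  (\int[plane_gauss s s]_z (f z)%:E = 0)%E.
Proof.
move=> mf fC f0; have fi := gweight_growth_integrable mf fC.
rewrite -[LHS](integral12_prod_meas1 fi); apply: integral0_eq => y _.
exact: f0.
Qed.

End gauss_plane_zero.

Section half_variance.
Context {R : realType}.

(* The coordinates of a standard complex Gaussian have variance 1/2. *)
Definition hs : R := Num.sqrt (2^-1).

Lemma hs_neq0 : hs != 0.
Proof. by rewrite gt_eqF// sqrtr_gt0 invr_gt0. Qed.

Lemma hs_sqr : hs ^+ 2 = 2^-1.
Proof. by rewrite sqr_sqrtr// invr_ge0. Qed.

Lemma hs_sqr4 : hs ^+ 2 *+ 4 = 2.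
Proof. by rewrite hs_sqr; field. Qed.

End half_variance.

(** * Integration by parts for a quadratic polynomial of one complex coordinate *)

Section planar_ibp.
Context {R : realType} (phi phi' : R -> R) (K : R).
Hypothesis dphi : forall x, is_derive x (1:R) phi (phi' x).
Hypothesis cphi' : continuous phi'.
Hypothesis bphi : forall x, `|phi x| <= K * (1 + `|x|).
Hypothesis bphi' : forall x, `|phi' x| <= K * (1 + `|x|).

Let cphi : continuous phi.
Proof.
by move=> x; apply/differentiable_continuous/derivable1_diffP; case: (dphi x).
Qed.

Let mphi : measurable_fun setT phi. Proof. exact: continuous_measurable_fun. Qed.
Let mphi' : measurable_fun setT phi'. Proof. exact: continuous_measurable_fun. Qed.

(** Stein's identity for (w + b x) phi(p(x)), where p'(x) = 2 (w + b x): the variance 1/2 cancels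
    this 2, so [phi'] enters with coefficient 1. *)
Lemma gauss_ibp_quadratic (c w b : R) :
  (\int[normal_prob 0 hs]_x (x * (w + b * x) * phi (c + 2 * x * w + b * x ^+ 2)
    - 2^-1 * b * phi (c + 2 * x * w + b * x ^+ 2)
    - (w + b * x) ^+ 2 * phi' (c + 2 * x * w + b * x ^+ 2))%:E = 0)%E.
Proof.
pose p x := c + 2 * x * w + b * x ^+ 2.
have dp (x : R) : is_derive x (1:R) p (2 * (w + b * x)).
  apply: is_derive_eq; rewrite /GRing.scale /= !(mulr1, addr0, mulr0, add0r, expr1).
  by ring.
pose G x := (w + b * x) * phi (p x).
pose G' x := b * phi (p x) + (w + b * x) * (2 * (w + b * x) * phi' (p x)).
have dG (x : R) : is_derive x (1:R) G (G' x).
  have dl : is_derive x (1:R) (fun x => w + b * x) b.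
    by apply: is_derive_eq; rewrite /GRing.scale /=; ring.
  apply: (is_derive_eq (is_deriveM dl (is_derive1_comp (dphi (p x)) (dp x)))).
  by rewrite /GRing.scale /= /G'; ring.
have u0 (x : R) : 0 <= x ^+ 2 by exact: sqr_ge0.
have pid : pgrowth (fun x : R => x ^+ 2) (fun x : R => x).
  by apply: pgrowth_sqr.
have pl : pgrowth (fun x : R => x ^+ 2) (fun x : R => w + b * x).
  by apply: pgrowthD => //; [exact: pgrowth_cst|apply: pgrowthM => //; exact: pgrowth_cst].
have pp : pgrowth (fun x : R => x ^+ 2) p.
  apply: pgrowthD => //.
    apply: pgrowthD => //; first exact: pgrowth_cst.
    apply: pgrowthM => //; last exact: pgrowth_cst.
    by apply: pgrowthM => //; exact: pgrowth_cst.
  by apply: pgrowthM => //; [exact: pgrowth_cst|exact: pgrowthX].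
have pphi : pgrowth (fun x : R => x ^+ 2) (fun x => phi (p x)) by exact: pgrowth_comp.
have pphi' : pgrowth (fun x : R => x ^+ 2) (fun x => phi' (p x)) by exact: pgrowth_comp.
have pG' : pgrowth (fun x : R => x ^+ 2) G'.
  apply: pgrowthD => //; apply: pgrowthM => //; first exact: pgrowth_cst.
  by apply: pgrowthM => //; apply: pgrowthM => //; exact: pgrowth_cst.
have pG : pgrowth (fun x : R => x ^+ 2) (fun x => x * G x).
  by do 2! [apply: pgrowthM => //].
have [C1 HC1] := pgrowth_expR u0 pG; have [C2 HC2] := pgrowth_expR u0 pG'.
pose C := Num.max C1 C2.
have := @normal_ibp R hs hs_neq0 G G' C dG.
rewrite hs_sqr4 hs_sqr => ibp.
rewrite -[RHS]ibp.
- by apply: eq_integral => x _; congr EFin; rewrite /G /G' /p; field.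
- have cp : continuous p.
    by move=> x; apply/differentiable_continuous/derivable1_diffP; case: (dp x).
  have cl : continuous (fun x : R => w + b * x).
    by move=> x; apply: cvgD; [exact: cvg_cst|apply: cvgM; [exact: cvg_cst|exact: cvg_id]].
  have c1 : continuous (phi \o p).
    by move=> x; apply: (@continuous_comp R R R p phi x); [exact: cp|exact: cphi].
  have c2 : continuous (phi' \o p).
    by move=> x; apply: (@continuous_comp R R R p phi' x); [exact: cp|exact: cphi'].
  move=> x; apply: cvgD; apply: cvgM; first exact: cvg_cst.
  + exact: (c1 x).
  + exact: (cl x).
  + apply: cvgM; last exact: (c2 x).
    by apply: cvgM; [exact: cvg_cst|exact: (cl x)].
- move=> x; apply: le_trans (HC1 x) _; rewrite ler_wpM2r ?expR_ge0//.
  by rewrite le_max lexx.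
- move=> x; apply: le_trans (HC2 x) _; rewrite ler_wpM2r ?expR_ge0//.
  by rewrite le_max lexx orbT.
Qed.


Let plane_u (z : plane R) : R := (z.1 : R) ^+ 2 + (z.2 : R) ^+ 2.

(** The sum of the identities along the two axes. In each, the other coordinate is absorbed into the
    constant term of the polynomial, and each contributes half of [b * phi p]. *)
Lemma planar_ibp_quadratic (c w1 w2 b : R) :
  (\int[plane_gauss hs hs]_z (let p := c + 2 * (z.1 * w1 + z.2 * w2) +
      b * ((z.1 : R) ^+ 2 + (z.2 : R) ^+ 2) in
    (z.1 * (w1 + b * z.1) + z.2 * (w2 + b * z.2)) * phi p - b * phi p
    - ((w1 + b * z.1) ^+ 2 + (w2 + b * z.2) ^+ 2) * phi' p)%:E = 0)%E.
Proof.
pose p (z : plane R) : R := c + 2 * (z.1 * w1 + z.2 * w2) +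
      b * ((z.1 : R) ^+ 2 + (z.2 : R) ^+ 2).
pose F (w x : R) (z : plane R) : R :=
  x * (w + b * x) * phi (p z) - 2^-1 * b * phi (p z) - (w + b * x) ^+ 2 * phi' (p z).
have u0 z : 0 <= plane_u z by rewrite addr_ge0 ?sqr_ge0.
have p1 : pgrowth plane_u (fun z => z.1 : R).
  by apply: pgrowth_sqr => //; [exact: measurable_fst|move=> z; rewrite lerDl sqr_ge0].
have p2 : pgrowth plane_u (fun z => z.2 : R).
  by apply: pgrowth_sqr => //; [exact: measurable_snd|move=> z; rewrite lerDr sqr_ge0].
have pc k : pgrowth plane_u (fun=> k) by exact: pgrowth_cst.
have pp : pgrowth plane_u p.
  by do ?[exact: pc|exact: p1|exact: p2|apply: pgrowthX => //|
          apply: pgrowthD => //|apply: pgrowthM => //].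
have pphi : pgrowth plane_u (fun z => phi (p z)) by exact: pgrowth_comp.
have pphi' : pgrowth plane_u (fun z => phi' (p z)) by exact: pgrowth_comp.
have pF w x : pgrowth plane_u x -> pgrowth plane_u (fun z => F w (x z) z).
  move=> px; rewrite /F.
  by do ?[exact: pc|exact: px|exact: pphi|exact: pphi'|apply: pgrowthB => //|apply: pgrowthX => //|
          apply: pgrowthD => //|apply: pgrowthM => //].
have gw z : expR (plane_u z / 2) = gweight hs z by rewrite /gweight hs_sqr4.
have pF1 := pF w1 _ p1; have pF2 := pF w2 _ p2.
have [C1 HC1] := pgrowth_expR u0 pF1; have [C2 HC2] := pgrowth_expR u0 pF2.
have {}HC1 z : `|F w1 z.1 z| <= C1 * gweight hs z by rewrite -gw.
have {}HC2 z : `|F w2 z.2 z| <= C2 * gweight hs z by rewrite -gw.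
have i1 := gweight_growth_integrable hs_neq0 pF1.1 HC1.
have i2 := gweight_growth_integrable hs_neq0 pF2.1 HC2.
transitivity (\int[plane_gauss hs hs]_z
    ((F w1 z.1 z)%:E + (F w2 z.2 z)%:E))%E.
  by apply: eq_integral => z _; rewrite -EFinD /= -/(p z) /F; congr EFin; field.
rewrite integralD//.
rewrite (integral_plane_eq0_fst hs_neq0 pF1.1 HC1); last first.
  move=> y; rewrite -[RHS](gauss_ibp_quadratic (c + 2 * y * w2 + b * y ^+ 2) w1 b).
  apply: eq_integral => x _; rewrite /F /p /=.
  by rewrite (_ : c + 2 * (x * w1 + y * w2) + b * (x ^+ 2 + y ^+ 2) =
    c + 2 * y * w2 + b * y ^+ 2 + 2 * x * w1 + b * x ^+ 2)//; ring.
rewrite (integral_plane_eq0_snd hs_neq0 pF2.1 HC2) ?adde0//.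
move=> y; rewrite -[RHS](gauss_ibp_quadratic (c + 2 * y * w1 + b * y ^+ 2) w2 b).
apply: eq_integral => x _; rewrite /F /p /=.
by rewrite (_ : c + 2 * (y * w1 + x * w2) + b * (y ^+ 2 + x ^+ 2) =
    c + 2 * y * w1 + b * y ^+ 2 + 2 * x * w2 + b * x ^+ 2)//; ring.
Qed.

End planar_ibp.

(** * Gaussian means of quadratic forms *)

Section hermitian_algebra.
Context {R : realType}.
Local Notation C := R[i].

Lemma adjmxE m n (A : 'M[C]_(m, n)) i j : adjmx A i j = conjc (A j i).
Proof. by rewrite !mxE. Qed.

Lemma cdotE n (x y : 'cV[C]_n) : cdot x y = \sum_i conjc (y i 0) * x i 0.
Proof. by rewrite /cdot mxE; apply: eq_bigr => i _; rewrite adjmxE. Qed.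

Lemma adjmxK m n : cancel (@adjmx R m n) (@adjmx R n m).
Proof. by move=> A; apply/matrixP => i j; rewrite !adjmxE conjcK. Qed.

Lemma adjmxD m n (A B : 'M[C]_(m, n)) : adjmx (A + B) = adjmx A + adjmx B.
Proof. by apply/matrixP => i j; rewrite !mxE rmorphD. Qed.

Lemma adjmxZ m n a (A : 'M[C]_(m, n)) : adjmx (a *: A) = conjc a *: adjmx A.
Proof. by apply/matrixP => i j; rewrite !mxE rmorphM. Qed.

Lemma adjmxM m n p (A : 'M[C]_(m, n)) (B : 'M[C]_(n, p)) :
  adjmx (A *m B) = adjmx B *m adjmx A.
Proof.
apply/matrixP => i j; rewrite adjmxE !mxE rmorph_sum; apply: eq_bigr => k _.
by rewrite rmorphM !adjmxE mulrC.
Qed.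

Lemma cdotDl n (x y z : 'cV[C]_n) : cdot (x + y) z = cdot x z + cdot y z.
Proof. by rewrite /cdot mulmxDr mxE. Qed.

Lemma cdotDr n (x y z : 'cV[C]_n) : cdot x (y + z) = cdot x y + cdot x z.
Proof. by rewrite /cdot adjmxD mulmxDl mxE. Qed.

Lemma cdotZl n a (x y : 'cV[C]_n) : cdot (a *: x) y = a * cdot x y.
Proof. by rewrite /cdot -scalemxAr mxE. Qed.

Lemma cdotZr n a (x y : 'cV[C]_n) : cdot x (a *: y) = conjc a * cdot x y.
Proof. by rewrite /cdot adjmxZ -scalemxAl mxE. Qed.

Lemma cdotC n (x y : 'cV[C]_n) : cdot x y = conjc (cdot y x).
Proof.
rewrite !cdotE rmorph_sum; apply: eq_bigr => i _.
by rewrite /= rmorphM /= conjcK mulrC.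
Qed.

Lemma cdot_adj m n (A : 'M[C]_(m, n)) x y : cdot (A *m x) y = cdot x (adjmx A *m y).
Proof. by rewrite /cdot adjmxM adjmxK mulmxA. Qed.

Lemma cdot_delta n (x : 'cV[C]_n) j : cdot x (delta_mx j 0) = x j 0.
Proof.
rewrite cdotE (bigD1 j)//= big1 ?addr0 => [|i ij]; rewrite mxE.
  by rewrite !eqxx conjc1 mul1r.
by rewrite (negbTE ij) conjc0 mul0r.
Qed.

Lemma Re_cdotxx n (x : 'cV[C]_n) :
  complex.Re (cdot x x) = \sum_i (complex.Re (x i 0) ^+ 2 + complex.Im (x i 0) ^+ 2).
Proof.
rewrite cdotE raddf_sum; apply: eq_bigr => i _.
by case: (x i 0) => a b /=; ring.
Qed.

End hermitian_algebra.

Section quadratic_form.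
Context {R : realType} (n : nat).
Local Notation Cn := (n.-tuple (plane R)).
Implicit Types (B : 'M[R[i]]_n) (t : Cn).

Definition qform B t : R := complex.Re (cdot (B *m cvec t) (cvec t)).

Definition sqnorm t : R := \sum_i (((tnth t i).1 : R) ^+ 2 + ((tnth t i).2 : R) ^+ 2).

Lemma sqnorm_ge0 t : 0 <= sqnorm t.
Proof. by apply: sumr_ge0 => i _; rewrite addr_ge0 ?sqr_ge0. Qed.

Lemma tweightE t : tweight hs t = expR (sqnorm t / 2).
Proof.
rewrite /tweight /sqnorm mulr_suml expR_sum; apply: eq_bigr => i _.
by rewrite /gweight hs_sqr4.
Qed.

Let wvec B t j := (B *m cvec t) j 0.

Lemma qformE B t : qform B t = \sum_j ((tnth t j).1 * complex.Re (wvec B t j) +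
  (tnth t j).2 * complex.Im (wvec B t j)).
Proof.
rewrite /qform cdotE raddf_sum; apply: eq_bigr => i _.
by rewrite -/(wvec B t i) mxE; case: (wvec B t i) => a b /=; rewrite mulNr opprK.
Qed.

Lemma cvec_upd t j z :
  cvec (upd t j z) = cvec (upd t j (0, 0)) + (z.1 +i* z.2) *: delta_mx j 0.
Proof.
apply/matrixP => i k; rewrite !mxE !tnth_mktuple ord1 eqxx andbT.
by case: eqP => _ /=; rewrite ?mulr1 ?add0r ?mulr0 ?addr0.
Qed.

Lemma wvec_upd B t j z : wvec B (upd t j z) j =
  wvec B (upd t j (0, 0)) j + (z.1 +i* z.2) * B j j.
Proof.
rewrite /wvec cvec_upd mulmxDr -scalemxAr mxE [X in _ + X]mxE; congr (_ + _ * _).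
by rewrite -colE mxE.
Qed.

(** Hermitian symmetry makes the two cross terms conjugate, hence the factor 2 and the real parts.
    The right-hand side has exactly the shape required by [planar_ibp_quadratic]. *)
Lemma qform_upd B t j z : adjmx B = B ->
  let w := wvec B (upd t j (0, 0)) j in
  qform B (upd t j z) = qform B (upd t j (0, 0)) +
    2 * (z.1 * complex.Re w + z.2 * complex.Im w) +
    complex.Re (B j j) * ((z.1 : R) ^+ 2 + (z.2 : R) ^+ 2).
Proof.
move=> hB w; rewrite /qform cvec_upd; set v := cvec _; set e := delta_mx j 0.
rewrite mulmxDr -scalemxAr !(cdotDl, cdotDr, cdotZl, cdotZr).
have -> : cdot (B *m e) v = conjc w.
  by rewrite cdot_adj hB cdotC; congr conjc; rewrite cdot_delta.
have -> : cdot (B *m v) e = w by rewrite cdot_delta.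
have -> : cdot (B *m e) e = B j j by rewrite cdot_delta -colE mxE.
case: w (B j j) (cdot _ _) => w1 w2 [b1 b2] [c1 c2] /=; ring.
Qed.

Lemma hermitian_diag B j : adjmx B = B -> complex.Im (B j j) = 0.
Proof.
move=> hB; have := congr1 (fun A : 'M[R[i]]_n => complex.Im (A j j)) hB.
rewrite adjmxE; case: (B j j) => a b /= /eqP.
by rewrite eq_sym -addr_eq0 -mulr2n mulrn_eq0/= => /eqP.
Qed.

Lemma pgrowth_fst j : pgrowth sqnorm (fun t => (tnth t j).1 : R).
Proof.
apply: pgrowth_sqr.
- exact: sqnorm_ge0.
- by apply: measurableT_comp; [exact: measurable_fst|exact: measurable_tnth].
- move=> t; rewrite /sqnorm (bigD1 j)//= -addrA lerDl addr_ge0 ?sqr_ge0// sumr_ge0// => i _.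
  by rewrite addr_ge0 ?sqr_ge0.
Qed.

Lemma pgrowth_snd j : pgrowth sqnorm (fun t => (tnth t j).2 : R).
Proof.
apply: pgrowth_sqr.
- exact: sqnorm_ge0.
- by apply: measurableT_comp; [exact: measurable_snd|exact: measurable_tnth].
- move=> t; rewrite /sqnorm (bigD1 j)//= [X in X + _]addrC -addrA lerDl addr_ge0 ?sqr_ge0// sumr_ge0// => i _.
  by rewrite addr_ge0 ?sqr_ge0.
Qed.

Lemma wvecE B t j : complex.Re (wvec B t j) = \sum_k (complex.Re (B j k) * (tnth t k).1 -
    complex.Im (B j k) * (tnth t k).2) /\
  complex.Im (wvec B t j) = \sum_k (complex.Re (B j k) * (tnth t k).2 +
    complex.Im (B j k) * (tnth t k).1).
Proof.
by split; rewrite /wvec mxE raddf_sum; apply: eq_bigr => k _; rewrite mxE;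
  case: (B j k) => a b /=.
Qed.

Let pgD := pgrowthD sqnorm_ge0.
Let pgM := @pgrowthM _ _ _ sqnorm.
Let pgC := @pgrowth_cst _ _ _ sqnorm.

Lemma pgrowth_wvec1 B j : pgrowth sqnorm (fun t => complex.Re (wvec B t j) : R).
Proof.
under eq_fun do rewrite (wvecE _ _ _).1.
apply: pgrowth_sum => [|k]; first exact: sqnorm_ge0.
apply: pgD; first by apply: pgM; [exact: pgC|exact: pgrowth_fst].
by apply: pgrowthN; apply: pgM; [exact: pgC|exact: pgrowth_snd].
Qed.

Lemma pgrowth_wvec2 B j : pgrowth sqnorm (fun t => complex.Im (wvec B t j) : R).
Proof.
under eq_fun do rewrite (wvecE _ _ _).2.
apply: pgrowth_sum => [|k]; first exact: sqnorm_ge0.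
apply: pgD; first by apply: pgM; [exact: pgC|exact: pgrowth_snd].
by apply: pgM; [exact: pgC|exact: pgrowth_fst].
Qed.

Lemma pgrowth_qform B : pgrowth sqnorm (qform B).
Proof.
rewrite (_ : qform B = fun t => qform B t)//; under eq_fun do rewrite qformE.
apply: pgrowth_sum => [|k]; first exact: sqnorm_ge0.
apply: pgD; apply: pgM.
- exact: pgrowth_fst.
- exact: pgrowth_wvec1.
- exact: pgrowth_snd.
- exact: pgrowth_wvec2.
Qed.

End quadratic_form.

Section gaussian_mean.
Context {R : realType} (n : nat).
Local Notation Cn := (n.-tuple (plane R)).
Local Notation Gm := (@tuple_measure _ _ R (plane_gauss hs hs) n).
Local Notation pg := (pgrowth (@sqnorm R n)).

Lemma tuple_gauss_setT : Gm setT = 1%E.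
Proof.
rewrite (_ : setT = [set t : Cn | forall i, setT (tnth t i)]); last first.
  by apply/seteqP; split.
have P : plane_gauss hs hs [set: plane R] = 1%E.
  exact: (@probability_setT _ _ _ (plane_gauss hs hs)).
by rewrite tuple_measure_cube// [X in (X ^+ _)%E]P -(EFin_expe 1) expr1n.
Qed.

Definition gmean (h : Cn -> R) : R := \int[Gm]_t h t.

Lemma pgrowth_integrable (h : Cn -> R) : pg h -> Gm.-integrable setT (EFin \o h).
Proof.
move=> ph; have [C hC] := pgrowth_expR (@sqnorm_ge0 R n) ph.
apply: (growth_integrable hs_neq0 ph.1 (C := C)) => t.
by rewrite tweightE.
Qed.

Lemma EFin_gmean h : pg h -> (\int[Gm]_t (h t)%:E = (gmean h)%:E)%E.
Proof.
move=> ph; rewrite /gmean /Rintegral fineK//.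
exact: integrable_fin_num (pgrowth_integrable ph).
Qed.

Lemma eq_gmean f g : f =1 g -> gmean f = gmean g.
Proof. by move=> /funext ->. Qed.

Lemma gmeanD f g : pg f -> pg g -> gmean (fun t => f t + g t) = gmean f + gmean g.
Proof. by move=> pf pg; rewrite /gmean RintegralD//; exact: pgrowth_integrable. Qed.

Lemma gmeanB f g : pg f -> pg g -> gmean (fun t => f t - g t) = gmean f - gmean g.
Proof. by move=> pf pg; rewrite /gmean RintegralB//; exact: pgrowth_integrable. Qed.

Lemma gmeanZ c f : pg f -> gmean (fun t => c * f t) = c * gmean f.
Proof. by move=> pf; rewrite /gmean RintegralZl//; exact: pgrowth_integrable. Qed.

Lemma gmean_cst c : gmean (fun=> c) = c.
Proof.
by rewrite /gmean Rintegral_cst// [X in fine X]tuple_gauss_setT mulr1.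
Qed.

Lemma gmean_sum (I : Type) (r : seq I) (F : I -> Cn -> R) :
  (forall i, pg (F i)) -> gmean (fun t => \sum_(i <- r) F i t) = \sum_(i <- r) gmean (F i).
Proof.
move=> pF; elim: r => [|i r ih].
  by rewrite big_nil -[RHS](gmean_cst 0); apply: eq_gmean => t; rewrite big_nil.
rewrite big_cons -ih -gmeanD//; last by apply: pgrowth_sum => //; exact: sqnorm_ge0.
by apply: eq_gmean => t; rewrite big_cons.
Qed.

Lemma gmean_le f g : pg f -> pg g -> (forall t, f t <= g t) -> gmean f <= gmean g.
Proof. by move=> pf pg fg; apply: le_Rintegral => //; exact: pgrowth_integrable. Qed.

Lemma pgrowth_norm f : pg f -> pg (fun t => `|f t|).
Proof.
apply: (pgrowth_comp (@sqnorm_ge0 R n) (phi := fun x : R => `|x|) (K := 1)) => [|x].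
  exact: normr_measurable.
by rewrite normr_id mul1r lerDr.
Qed.

Lemma gmean_norm f : pg f -> `|gmean f| <= gmean (fun t => `|f t|).
Proof.
by move=> pf; apply: le_normr_Rintegral => //; exact: pgrowth_integrable.
Qed.

Section ibp.
Variables (B : 'M[R[i]]_n) (phi phi' : R -> R) (K : R).
Hypothesis hB : adjmx B = B.
Hypothesis dphi : forall x, is_derive x (1:R) phi (phi' x).
Hypothesis cphi' : continuous phi'.
Hypothesis bphi : forall x, `|phi x| <= K * (1 + `|x|).
Hypothesis bphi' : forall x, `|phi' x| <= K * (1 + `|x|).

Local Notation w1 t j := (complex.Re ((B *m cvec t) j 0)).
Local Notation w2 t j := (complex.Im ((B *m cvec t) j 0)).

Let mphi : measurable_fun setT phi.
Proof.
apply: continuous_measurable_fun => x.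
by apply/differentiable_continuous/derivable1_diffP; case: (dphi x).
Qed.

Let mphi' : measurable_fun setT phi'. Proof. exact: continuous_measurable_fun. Qed.

Let pphi : pg (fun t => phi (qform B t)).
Proof. exact: (pgrowth_comp (@sqnorm_ge0 R n) mphi bphi (pgrowth_qform B)). Qed.

Let pphi' : pg (fun t => phi' (qform B t)).
Proof. exact: (pgrowth_comp (@sqnorm_ge0 R n) mphi' bphi' (pgrowth_qform B)). Qed.

Let pgD := pgrowthD (@sqnorm_ge0 R n).
Let pgM := @pgrowthM _ _ _ (@sqnorm R n).
Let pgX := @pgrowthX _ _ _ (@sqnorm R n).
Let pgB := pgrowthB (@sqnorm_ge0 R n).
Let pgC := @pgrowth_cst _ _ _ (@sqnorm R n).

Let a_ j t := ((tnth t j).1 * w1 t j + (tnth t j).2 * w2 t j) * phi (qform B t).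
Let b_ j t := complex.Re (B j j) * phi (qform B t).
Let c_ j t := (w1 t j ^+ 2 + w2 t j ^+ 2) * phi' (qform B t).

Let pa j : pg (a_ j).
Proof.
apply: pgM => //; apply: pgD; apply: pgM.
- exact: pgrowth_fst.
- exact: pgrowth_wvec1.
- exact: pgrowth_snd.
- exact: pgrowth_wvec2.
Qed.

Let pb j : pg (b_ j). Proof. by apply: pgM => //; exact: pgC. Qed.

Let pc j : pg (c_ j).
Proof.
by apply: pgM => //; apply: pgD; apply: pgX; [exact: pgrowth_wvec1|exact: pgrowth_wvec2].
Qed.

Let coord_ibp j : gmean (fun t => a_ j t - b_ j t - c_ j t) = 0.
Proof.
have pf : pg (fun t => a_ j t - b_ j t - c_ j t) by do 2! [apply: pgB => //].
apply/eqP; rewrite -(@eqe R) -EFin_gmean//; apply/eqP.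
have [C hC] := pgrowth_expR (@sqnorm_ge0 R n) pf.
apply: (integral_coord_eq0 hs_neq0 (j := j) (C := C)).
- exact: pf.1.
- by move=> t; rewrite tweightE.
move=> t; pose t0 := upd t j (0, 0).
rewrite -[RHS](planar_ibp_quadratic dphi cphi' bphi bphi' (qform B t0) (w1 t0 j)
  (w2 t0 j) (complex.Re (B j j))).
apply: eq_integral => z _; congr EFin => /=.
rewrite /a_ /b_ /c_ qform_upd// wvec_upd -/t0.
set P := _ + _ + _ * _.
(* Since the diagonal entry is real, updating coordinate j to z shifts the two parts of (B t)_j by b
   z.1 and b z.2, as in the planar identity. *)
have := hermitian_diag j hB; rewrite tnth_mktuple eqxx.
case: (B j j) ((B *m cvec t0) j 0) @P => b1 b2 [u v] /= ->.
by ring.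
Qed.

(** Sum of the coordinate identities over j: the three families add up to <B t, t>, to the trace of
    B, and to |B t|^2 = <B^2 t, t>. *)
Lemma gaussian_ibp : gmean (fun t => qform B t * phi (qform B t)) =
  complex.Re (\tr B) * gmean (fun t => phi (qform B t)) +
  gmean (fun t => qform (B *m B) t * phi' (qform B t)).
Proof.
have -> : (fun t => qform B t * phi (qform B t)) = (fun t => \sum_j a_ j t).
  by apply/funext => t; rewrite {1}qformE mulr_suml.
have -> : (fun t => qform (B *m B) t * phi' (qform B t)) = (fun t => \sum_j c_ j t).
  apply/funext => t; rewrite /c_ -mulr_suml -Re_cdotxx /qform -mulmxA.
  by rewrite -[X in cdot (X *m _) _]hB cdot_adj adjmxK.
rewrite raddf_sum -gmeanZ// gmean_sum// gmean_sum//.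
rewrite (_ : (fun t => _) = (fun t => \sum_j b_ j t)); last first.
  by apply/funext => t; rewrite -mulr_suml.
rewrite gmean_sum// -big_split; apply: eq_bigr => j _.
have := coord_ibp j; rewrite gmeanB// ?gmeanB//; last exact: pgB.
by move=> /eqP; rewrite subr_eq0 => /eqP <- /=; rewrite addrC subrK.
Qed.

End ibp.

(** Integration by parts with the constant test function 1. *)
Lemma gmean_qform B : adjmx B = B -> gmean (qform B) = complex.Re (\tr B).
Proof.
move=> hB; have := @gaussian_ibp B (fun=> 1) (fun=> 0) 1 hB.
rewrite gmean_cst mulr1 (_ : (fun t => qform B t * 1) = qform B); last first.
  by apply/funext => t; rewrite mulr1.
rewrite (_ : (fun t => _ * 0) = fun=> 0); last by apply/funext => t; rewrite mulr0.
rewrite gmean_cst addr0; apply.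
- exact: cst_continuous.
- by move=> x; rewrite normr1 mul1r lerDl.
- by move=> x; rewrite normr0 mul1r addr_ge0.
Qed.

(** Integration by parts with the identity as test function. *)
Lemma gmean_qform_sqr B : adjmx B = B ->
  gmean (fun t => qform B t ^+ 2) = complex.Re (\tr B) ^+ 2 + complex.Re (\tr (B *m B)).
Proof.
move=> hB; have hBB : adjmx (B *m B) = B *m B by rewrite adjmxM hB.
have := @gaussian_ibp B id (fun=> 1) 1 hB.
rewrite (_ : (fun t => qform (B *m B) t * 1) = qform (B *m B)); last first.
  by apply/funext => t; rewrite mulr1.
rewrite !gmean_qform//= -expr2; apply.
- exact: cst_continuous.
- by move=> x; rewrite mul1r lerDr.
- by move=> x; rewrite normr1 mul1r lerDl.
Qed.

End gaussian_mean.

(** * Characteristic functions *)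

Section charfun.
Context d (T : measurableType d) (R : realType) (mu : {measure set T -> \bar R}).
Hypothesis mu1 : mu.-integrable setT (EFin \o (fun=> 1%R : R)).
Variables (X : T -> R) (c : R).
Hypothesis iX : mu.-integrable setT (EFin \o X).

Let mX : measurable_fun setT X. Proof. exact/measurable_EFinP/(measurable_int _ iX). Qed.

Let marg (t : R) : measurable_fun setT (fun y => t * X y + c).
Proof. by apply: measurable_funD => //; exact: measurable_funM. Qed.

Let mcos t : measurable_fun setT (fun y => cos (t * X y + c)).
Proof. by apply: measurableT_comp => //; apply: continuous_measurable_fun; exact: continuous_cos. Qed.

Let msin t : measurable_fun setT (fun y => sin (t * X y + c)).
Proof. by apply: measurableT_comp => //; apply: continuous_measurable_fun; exact: continuous_sin. Qed.

Let icos t : mu.-integrable setT (EFin \o (fun y => cos (t * X y + c))).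
Proof.
apply: le_integrable mu1 => //; first exact/measurable_EFinP.
by move=> y _; rewrite /= lee_fin normr1 cos_max.
Qed.

Let dcos y (t : R) : is_derive t (1:R) (fun t => cos (t * X y + c))
  (- (X y * sin (t * X y + c))).
Proof.
have da : is_derive t (1:R) (fun t => t * X y + c) (X y).
  by apply: is_derive_eq; rewrite /GRing.scale /=; ring.
apply: (is_derive_eq (is_derive1_comp (g := fun s => s * X y + c) (is_derive_cos _) da)).
by rewrite mulNr mulrC.
Qed.

(** Differentiation under the integral, dominated by |X| uniformly in t. The phase c lets one real
    integral carry both the real and the imaginary part of the characteristic function. *)
Lemma is_derive_charfun (t : R) :
  is_derive t (1:R) (fun t => \int[mu]_y cos (t * X y + c))
    (- \int[mu]_y (X y * sin (t * X y + c))).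
Proof.
have tI : `]t - 1, t + 1[%classic t by rewrite /= in_itv/= ltrBlDr !ltrDl ltr01.
pose f t y := cos (t * X y + c).
have dE s y : partial1of2 f s y = - (X y * sin (s * X y + c)).
  by rewrite partial1of2E; case: (dcos y s).
have h1 : forall x, `]t - 1, t + 1[%classic x -> mu.-integrable setT (EFin \o f x).
  by move=> x _; exact: icos.
have h2 : forall x y, `]t - 1, t + 1[%classic x -> setT y -> derivable (f ^~ y) x 1.
  by move=> x y _ _; case: (dcos y x).
have h3 : mu.-integrable setT (EFin \o (fun y => `|X y|)).
  exact: (integrable_abse iX).
have h4 : forall x y, `]t - 1, t + 1[%classic x -> setT y -> `|partial1of2 f x y| <= `|X y|.
  by move=> x y _ _; rewrite dE normrN normrM ler_piMr// sin_max.
have nn y : 0 <= `|X y| by [].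
apply: DeriveDef.
  exact: (derivable_under_integral measurableT tI h1 h2 nn h3 h4).
rewrite -derive1E (differentiation_under_integral measurableT tI h1 h2 nn h3 h4).
have isin : mu.-integrable setT (EFin \o (fun y => X y * sin (t * X y + c))).
  apply: le_integrable h3 => //.
    by apply/measurable_EFinP; exact: measurable_funM.
  by move=> y _; rewrite /= lee_fin normrM normr_id ler_piMr// sin_max.
rewrite -[RHS]mulN1r -RintegralZl//; apply: eq_Rintegral => y _.
by rewrite dE mulN1r.
Qed.

End charfun.

Section gaussian_ode.
Context (R : realType).

(** The integrating factor exp(v t^2/2) turns the assumption into a bound on a derivative. The mean
    value theorem gives a point x in (0, 1), and the remaining factor exp(-v/2) exp(v x^2/2) is at
    most 1. *)
Lemma gaussian_ode (psi psi' : R -> R) (v D : R) : 0 <= v ->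
  (forall t, is_derive t (1:R) psi (psi' t)) ->
  (forall t, 0 <= t <= 1 -> `|psi' t + t * v * psi t| <= D) ->
  `|psi 1 - expR (- v / 2) * psi 0| <= D.
Proof.
move=> v0 dpsi bD.
pose e (t : R) := expR (v / 2 * t ^+ 2).
have de (t : R) : is_derive t (1:R) e (v * t * e t).
  have da : is_derive t (1:R) (fun t => v / 2 * t ^+ 2) (v * t).
    by apply: is_derive_eq; rewrite /GRing.scale /=; field.
  apply: (is_derive_eq (is_derive1_comp (g := fun t => v / 2 * t ^+ 2) (is_derive_expR _) da)).
  by rewrite mulrC.
pose G t := e t * psi t.
pose G' t := e t * (psi' t + t * v * psi t).
have dG (t : R) : is_derive t (1:R) G (G' t).
  apply: (is_derive_eq (is_deriveM (de t) (dpsi t))).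
  by rewrite /GRing.scale /= /G'; ring.
have cG : {within `[0, 1], continuous G}.
  apply: derivable_within_continuous => t _; by case: (dG t).
have [x x01 E] := MVT ltr01 (fun x _ => dG x) cG.
have -> : psi 1 - expR (- v / 2) * psi 0 = expR (- v / 2) * (G 1 - G 0).
  rewrite /G /e expr1n mulr1 expr0n/= mulr0 expR0 mul1r mulrBr mulrA.
  by rewrite -expRD mulNr addNr expR0 mul1r.
rewrite E subr0 mulr1 normrM ger0_norm ?expR_ge0// /G' normrM.
rewrite (ger0_norm (expR_ge0 _)) mulrA -expRD.
move: x01; rewrite in_itv/= => /andP[/ltW x0 /ltW x1].
have bx : `|psi' x + x * v * psi x| <= D by apply: bD; rewrite x0 x1.
apply: le_trans bx; rewrite ler_piMl// -[leRHS](expR0 R) ler_expR.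
have x2 : x ^+ 2 <= 1 by rewrite expr_le1.
have : v * x ^+ 2 <= v by rewrite ler_piMr.
lra.
Qed.

End gaussian_ode.

Section gauss_charfun.
Context {R : realType}.

(** Here Stein's identity makes the differential equation of [gaussian_ode] exact, so that lemma
    applies with error 0. *)
Lemma normal_charfun (s al c : R) : s != 0 ->
  (\int[normal_prob 0 s]_x (cos (al * x + c))%:E =
   (expR (- (al ^+ 2 * s ^+ 2) / 2) * cos c)%:E)%E.
Proof.
move=> s0; set N := normal_prob 0 s.
pose X (x : R) := al * x.
have e4 (x : R) : 1 + (x ^+ 2 / (s ^+ 2 *+ 4)) <= expR (x ^+ 2 / (s ^+ 2 *+ 4)).
  exact: expR_ge1Dx.
have q0 (x : R) : 0 <= x ^+ 2 / (s ^+ 2 *+ 4).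
  by rewrite divr_ge0 ?mulrn_wge0 ?sqr_ge0.
have i1 : N.-integrable setT (EFin \o (fun=> 1%R : R)).
  apply: (normal_growth_integrable s0 (C := 1)) => // x.
  by rewrite normr1 mul1r (le_trans _ (e4 x))// lerDl.
have bx (x : R) : `|x| <= (1 + s ^+ 2 *+ 4) * expR (x ^+ 2 / (s ^+ 2 *+ 4)).
  have s4 : 0 < s ^+ 2 *+ 4 by rewrite pmulrn_lgt0// exprn_even_gt0.
  apply: (@le_trans _ _ ((1 + s ^+ 2 *+ 4) * (1 + x ^+ 2 / (s ^+ 2 *+ 4)))); last first.
    by rewrite ler_wpM2l// addr_ge0// ltW.
  rewrite mulrDl mul1r mulrDr mulr1 [X in _ + (_ + X)]mulrCA mulfV ?gt_eqF// mulr1.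
  have := q0 x; have := sqr_ge0 (`|x| - 1); rewrite sqrrB real_normK ?num_real// mulr1 expr1n.
  move: (x ^+ 2 / _) (normr_ge0 x) s4 => q; move: `|x| (x ^+ 2) (s ^+ 2 *+ 4) => y z w.
  by lra.
have iX : N.-integrable setT (EFin \o X).
  apply: (normal_growth_integrable s0 (C := `|al| * (1 + s ^+ 2 *+ 4))) => [|x].
    exact: measurable_funM.
  by rewrite normrM -mulrA ler_wpM2l.
have icos t : N.-integrable setT (EFin \o (fun x => cos (t * X x + c))).
  apply: le_integrable i1 => //; last by move=> y _; rewrite /= lee_fin normr1 cos_max.
  apply/measurable_EFinP; apply: measurableT_comp.
    by apply: continuous_measurable_fun; exact: continuous_cos.
  by apply: measurable_funD => //; do 2! [apply: measurable_funM => //].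
pose psi t : R := \int[N]_x cos (t * X x + c).
pose psi' t : R := - \int[N]_x (X x * sin (t * X x + c)).
have dpsi t : is_derive t (1:R) psi (psi' t) by exact: is_derive_charfun.
have ibp t : psi' t + t * (al ^+ 2 * s ^+ 2) * psi t = 0.
  (* This is the function G for which x G(x) is the integrand of psi'(t). *)
  have dG (x : R) : is_derive x (1:R) (fun x => - al * sin (t * X x + c))
      (- al * (t * al * cos (t * X x + c))).
    have da : is_derive x (1:R) (fun x => t * X x + c) (t * al).
      by apply: is_derive_eq; rewrite /GRing.scale /=; ring.
    apply: (is_derive_eq (is_deriveZ (- al)
      (is_derive1_comp (g := fun x => t * X x + c) (is_derive_sin _) da))).
    by rewrite /GRing.scale /= [cos _ * _]mulrC.
  have isin : N.-integrable setT (EFin \o (fun x => X x * sin (t * X x + c))).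
    apply: le_integrable iX => //.
      apply/measurable_EFinP; apply: measurable_funM; first exact: measurable_funM.
      apply: measurableT_comp.
        by apply: continuous_measurable_fun; exact: continuous_sin.
      by apply: measurable_funD => //; do 2! [apply: measurable_funM => //].
    by move=> y _; rewrite /= lee_fin normrM ler_piMr// sin_max.
  have s4 : 0 <= 1 + s ^+ 2 *+ 4 by rewrite addr_ge0// mulrn_wge0 ?sqr_ge0.
  (* A single constant must serve both growth bounds: the first summand is for x G, the second for
     G'. *)
  have := normal_ibp s0 (C := `|al| * (1 + s ^+ 2 *+ 4) + `|al * (t * al)|) dG.
  move=> ibp; have {}ibp : (\int[N]_x (x * (- al * sin (t * X x + c)) -
      s ^+ 2 * (- al * (t * al * cos (t * X x + c))))%:E = 0)%E.
    apply: ibp.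
    - move=> x; apply: cvgM; first exact: cvg_cst.
      apply: cvgM; first exact: cvg_cst.
      apply: (@continuous_comp R R R (fun x => t * X x + c) cos x); last exact: continuous_cos.
      apply: cvgD; last exact: cvg_cst.
      by apply: cvgM; [exact: cvg_cst|apply: cvgM; [exact: cvg_cst|exact: cvg_id]].
    - move=> x; rewrite mulrCA mulNr normrN normrM mulrDl -mulrA.
      rewrite (@le_trans _ _ (`|al| * ((1 + s ^+ 2 *+ 4) * expR (x ^+ 2 / (s ^+ 2 *+ 4)))))//.
        by rewrite ler_wpM2l// normrM (le_trans (ler_piMr _ (sin_max _))).
      by rewrite lerDl mulr_ge0// expR_ge0.
    - move=> x; rewrite mulNr normrN [_ * (_ * cos _)]mulrA [leLHS]normrM.
      apply: le_trans (ler_piMr _ (cos_max _)) _ => //.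
      rewrite -[leLHS]mulr1 ler_pM//.
        by rewrite lerDr mulr_ge0.
      by rewrite (le_trans _ (e4 x))// lerDl.
  rewrite /psi' /psi -mulN1r -!RintegralZl// -RintegralD//; last 2 first.
  - exact: (integrableZl measurableT (-1) isin).
  - exact: (integrableZl measurableT (t * (al ^+ 2 * s ^+ 2)) (icos t)).
  rewrite (_ : (fun x => _) = (fun x => x * (- al * sin (t * X x + c)) -
      s ^+ 2 * (- al * (t * al * cos (t * X x + c))))); last first.
    by apply/funext => x; rewrite /X; ring.
  by rewrite /Rintegral ibp.
have := @gaussian_ode R psi psi' (al ^+ 2 * s ^+ 2) 0.
rewrite mulr_ge0 ?sqr_ge0// => /(_ isT dpsi).
have -> : psi 0 = cos c.
  rewrite /psi; under eq_Rintegral do rewrite mul0r add0r.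
  by rewrite Rintegral_cst// [X in fine X](@probability_setT _ _ _ N) mulr1.
move=> h; have {}h : `|psi 1 - expR (- (al ^+ 2 * s ^+ 2) / 2) * cos c| <= 0.
  by apply: h => t _; rewrite ibp normr0.
move: h; rewrite normr_le0 subr_eq0 => /eqP <-.
rewrite /psi /Rintegral fineK; last exact: integrable_fin_num (icos 1).
by apply: eq_integral => x _; rewrite mul1r.
Qed.

End gauss_charfun.

Section plane_charfun.
Context {R : realType} (s1 s2 : R).
Hypotheses (s10 : s1 != 0) (s20 : s2 != 0).

(** Integrating the second coordinate first treats al x + c as the phase, so the one-dimensional
    formula applies twice. *)
Lemma plane_charfun (al be c : R) :
  (\int[plane_gauss s1 s2]_z (cos (al * z.1 + be * z.2 + c))%:E =
   (expR (- (al ^+ 2 * s1 ^+ 2 + be ^+ 2 * s2 ^+ 2) / 2) * cos c)%:E)%E.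
Proof.
pose f (z : plane R) : R := cos (al * z.1 + be * z.2 + c).
have mf : measurable_fun setT f.
  apply: measurableT_comp.
    by apply: continuous_measurable_fun; exact: continuous_cos.
  by apply: measurable_funD => //; apply: measurable_funD; apply: measurable_funM.
have fi : (plane_gauss s1 s2).-integrable setT (EFin \o f).
  apply: (le_integrable measurableT (f := EFin \o f) (g := cst 1%E)).
  - exact/measurable_EFinP.
  - by move=> z _; rewrite /= normr1 lee_fin cos_max.
  - exact: finite_measure_integrable_cst.
rewrite -[LHS](integral12_prod_meas1 fi) /fubini_F /f /=.
transitivity (\int[normal_prob 0 s1]_x ((expR (- (be ^+ 2 * s2 ^+ 2) / 2))%:E *
    (cos (al * x + c))%:E))%E.
  apply: eq_integral => x _; rewrite -EFinM -normal_charfun//.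
  by apply: eq_integral => y _; congr (cos _)%:E; ring.
rewrite integralZl//; last first.
  apply: (le_integrable measurableT (g := cst 1%E)).
  - apply/measurable_EFinP; apply: measurableT_comp.
      by apply: continuous_measurable_fun; exact: continuous_cos.
    by apply: measurable_funD => //; exact: measurable_funM.
  - by move=> z _; rewrite /= normr1 lee_fin cos_max.
  - exact: finite_measure_integrable_cst.
by rewrite normal_charfun// -EFinM mulrA -expRD; congr (expR _ * _)%:E; field.
Qed.

End plane_charfun.

Section qform_charfun.
Context {R : realType} (n : nat) (H : 'M[R[i]]_n).
Hypothesis hH : adjmx H = H.
Hypothesis trH : complex.Re (\tr H) = 0.
Local Notation H2 := (H *m H).
Local Notation pg := (pgrowth (@sqnorm R n)).

Let hH2 : adjmx H2 = H2. Proof. by rewrite adjmxM hH. Qed.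

Let v := complex.Re (\tr H2).

Lemma gmean_qform_sqr0 : gmean (fun t => qform H t ^+ 2) = v.
Proof. by rewrite gmean_qform_sqr// trH expr0n/= add0r. Qed.

Lemma Re_tr_sqr_ge0 : 0 <= v.
Proof.
rewrite -gmean_qform_sqr0 -(gmean_cst n 0); apply: gmean_le.
- exact: pgrowth_cst.
- by apply: pgrowthX; exact: pgrowth_qform.
- by move=> t; exact: sqr_ge0.
Qed.

Let pgD := pgrowthD (@sqnorm_ge0 R n).
Let pgM := @pgrowthM _ _ _ (@sqnorm R n).
Let pgX := @pgrowthX _ _ _ (@sqnorm R n).
Let pgB := pgrowthB (@sqnorm_ge0 R n).
Let pgC := @pgrowth_cst _ _ _ (@sqnorm R n).

Lemma gmean_var_qform (B : 'M[R[i]]_n) : adjmx B = B ->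
  gmean (fun t => (qform B t - complex.Re (\tr B)) ^+ 2) = complex.Re (\tr (B *m B)).
Proof.
move=> hB; have pB := pgrowth_qform B.
rewrite (eq_gmean (g := fun t => qform B t ^+ 2 -
   2 * complex.Re (\tr B) * qform B t + complex.Re (\tr B) ^+ 2)); last first.
  by move=> t; ring.
rewrite gmeanD ?gmeanB ?gmeanZ ?gmean_cst ?gmean_qform_sqr ?gmean_qform//.
- by ring.
- exact: pgX.
- by apply: pgM => //; exact: pgC.
- by apply: pgB; [exact: pgX|apply: pgM => //; exact: pgC].
Qed.

(** From 2 |x| <= e + x^2/e and the variance of the quadratic form. The free parameter e plays the
    part of Cauchy-Schwarz, whose bound is the optimum over e. *)
Lemma gmean_abs_dev (B : 'M[R[i]]_n) e : 0 < e -> adjmx B = B ->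
  gmean (fun t => `|qform B t - complex.Re (\tr B)|) <=
  (e + complex.Re (\tr (B *m B)) / e) / 2.
Proof.
move=> e0 hB; rewrite -gmean_var_qform//.
have pB : pg (fun t => qform B t - complex.Re (\tr B)).
  by apply: pgB; [exact: pgrowth_qform|exact: pgC].
rewrite (_ : _ / 2 = gmean (fun t => 2^-1 * (e + e^-1 *
    (qform B t - complex.Re (\tr B)) ^+ 2))); last first.
  rewrite gmeanZ ?gmeanD ?gmeanZ ?gmean_cst//.
  - by rewrite mulrC [X in _ + X]mulrC.
  - exact: pgX.
  - by apply: pgM; [exact: pgC|exact: pgX].
  - by apply: pgD; [exact: pgC|apply: pgM; [exact: pgC|exact: pgX]].
apply: gmean_le => //.
- exact: pgrowth_norm.
- apply: pgM; first exact: pgC.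
  by apply: pgD; [exact: pgC|apply: pgM; [exact: pgC|exact: pgX]].
move=> t; set x := _ - _.
have := sqr_ge0 (`|x| - e); rewrite sqrrB real_normK ?num_real// => h.
rewrite (_ : 2^-1 * _ = (e ^+ 2 + x ^+ 2) / (2 * e)); last by field; rewrite gt_eqF.
rewrite ler_pdivlMr ?mulr_gt0//.
by move: h; rewrite -mulr_natr; lra.
Qed.

(** Along psi(t) = E cos(t q + c), the defect psi' + t v psi is -t E((<H^2 g, g> - v) cos(t q + c)),
    bounded by the mean deviation of <H^2 g, g> because 0 <= t <= 1. *)
Lemma qform_charfun c e : 0 < e ->
  `|gmean (fun t => cos (qform H t + c)) - expR (- v / 2) * cos c| <=
  (e + complex.Re (\tr (H2 *m H2)) / e) / 2.
Proof.
move=> e0; set D := (X in _ <= X).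
have bcos (x : R) : `|cos x| <= 1 * (1 + `|x|).
  by rewrite mul1r (le_trans (cos_max _))// lerDl.
have bsin (x : R) : `|sin x| <= 1 * (1 + `|x|).
  by rewrite mul1r (le_trans (sin_max _))// lerDl.
have mcos : measurable_fun setT (@cos R).
  by apply: continuous_measurable_fun; exact: continuous_cos.
have msin : measurable_fun setT (@sin R).
  by apply: continuous_measurable_fun; exact: continuous_sin.
have parg t : pg (fun y => t * qform H y + c).
  by apply: pgD; [apply: pgM; [exact: pgC|exact: pgrowth_qform]|exact: pgC].
have pcos t : pg (fun y => cos (t * qform H y + c)).
  exact: (pgrowth_comp (@sqnorm_ge0 R n) mcos bcos (parg t)).
pose psi t := gmean (fun y => cos (t * qform H y + c)).
pose psi' t := - gmean (fun y => qform H y * sin (t * qform H y + c)).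
have dpsi t : is_derive t (1:R) psi (psi' t).
  apply: is_derive_charfun; last by apply: pgrowth_integrable; exact: pgrowth_qform.
  by apply: pgrowth_integrable; exact: pgC.
have ibp t : psi' t = - (t * gmean (fun y => qform H2 y * cos (t * qform H y + c))).
  congr (- _).
  have dsin (x : R) : is_derive x (1:R) (fun x => sin (t * x + c)) (t * cos (t * x + c)).
    have da : is_derive x (1:R) (fun x => t * x + c) t.
      by apply: is_derive_eq; rewrite /GRing.scale /=; ring.
    apply: (is_derive_eq (is_derive1_comp (g := fun x => t * x + c) (is_derive_sin _) da)).
    by rewrite mulrC.
  have := @gaussian_ibp R n H (fun x => sin (t * x + c)) (fun x => t * cos (t * x + c))
    (1 + `|t|) hH.
  (* Tracelessness removes the first-order term of the integration by parts. *)
  rewrite trH mul0r add0r => /(_ dsin) ->.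
  - rewrite -gmeanZ; last by apply: pgM => //; exact: pgrowth_qform.
    by apply: eq_gmean => y; rewrite mulrCA.
  - move=> x; apply: cvgM; first exact: cvg_cst.
    apply: (@continuous_comp R R R (fun x => t * x + c) cos x); last exact: continuous_cos.
    apply: cvgD; last exact: cvg_cst.
    by apply: cvgM; [exact: cvg_cst|exact: cvg_id].
  - move=> x; apply: le_trans (sin_max _) _.
    by rewrite mulrDl mul1r -addrA lerDl addr_ge0// mulr_ge0// addr_ge0.
  - move=> x; rewrite normrM (le_trans (ler_piMr _ (cos_max _)))//.
    by have := normr_ge0 x; have := normr_ge0 t; nra.
have bD t : 0 <= t <= 1 -> `|psi' t + t * v * psi t| <= D.
  move=> /andP[t0 t1].
  have -> : psi' t + t * v * psi t =
      - t * gmean (fun y => (qform H2 y - v) * cos (t * qform H y + c)).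
    rewrite ibp (eq_gmean (f := fun y => (qform H2 y - v) * cos (t * qform H y + c))
      (g := fun y => qform H2 y * cos (t * qform H y + c) -
      v * cos (t * qform H y + c))); last by move=> y; rewrite mulrBl.
    rewrite gmeanB ?gmeanZ// /psi.
    - by ring.
    - by apply: pgM => //; exact: pgrowth_qform.
    - by apply: pgM => //; exact: pgC.
  have pd : pg (fun y => qform H2 y - v).
    by apply: pgB; [exact: pgrowth_qform|exact: pgC].
  have pdc : pg (fun y => (qform H2 y - v) * cos (t * qform H y + c)) by exact: pgM.
  rewrite normrM normrN (ger0_norm t0).
  apply: le_trans (_ : _ <= `|gmean (fun y => (qform H2 y - v) * cos (t * qform H y + c))|) _.
    by rewrite ler_piMl.
  apply: le_trans (gmean_norm pdc) _.
  apply: le_trans (gmean_abs_dev e0 hH2).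
  apply: gmean_le; [exact: pgrowth_norm|exact: pgrowth_norm|].
  by move=> y; rewrite normrM ler_piMr// cos_max.
have := gaussian_ode Re_tr_sqr_ge0 dpsi bD.
rewrite /psi (eq_gmean (g := fun y => cos (qform H y + c))); last first.
  by move=> y; rewrite mul1r.
rewrite (eq_gmean (f := fun y => cos (0 * _ + c)) (g := fun y => cos c)); last first.
  by move=> y; rewrite mul0r add0r.
by rewrite gmean_cst.
Qed.

End qform_charfun.

(** * The uniform law on the sphere as a projected Gaussian *)

Section lebesgue_scaling.
Local Open Scope ereal_scope.
Context {R : realType} (r : R).
Hypothesis r0 : (0 < r)%R.
Local Notation mu := (@lebesgue_measure R).

(** Uniqueness of Lebesgue measure: both sides are measures that agree on the intervals ]a, b]. *)
Lemma lebesgue_measure_scale (A : set (measurableTypeR R)) : measurable A ->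
  mu A = r%:E * mu ((fun x : R => r * x)%R @^-1` A).
Proof.
move=> mA.
have mr : measurable_fun setT ((fun x => r * x)%R : measurableTypeR R -> measurableTypeR R).
  exact: measurable_funM.
have [nu nuE] := pushforward_measureP mu mr.
have r0' := ltW r0.
have := @lebesgue_measure_unique R (mscale (NngNum r0') nu).
have -> : r%:E * mu ((fun x : R => r * x)%R @^-1` A) = mscale (NngNum r0') nu A.
  by rewrite /mscale/= -nuE.
apply=> // X [[a b] /= _ <-].
rewrite /mscale/= -nuE /pushforward.
have -> : (fun x : R => r * x)%R @^-1` `]a, b]%classic = `](a / r)%R, (b / r)%R]%classic.
  apply/seteqP; split => x /=; rewrite !in_itv/= ltr_pdivrMr// ler_pdivlMr//;
  by rewrite [(x * r)%R]mulrC.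
rewrite [LHS]lebesgue_measure_itv [X in _ = _ * X]lebesgue_measure_itv/=.
rewrite !lte_fin ltr_pM2r ?invr_gt0//.
case: ifPn => _; last by rewrite mule0.
rewrite -!EFinD -EFinM; congr EFin; field.
by rewrite gt_eqF.
Qed.

Lemma ge0_integral_scale (f : measurableTypeR R -> \bar R) : measurable_fun setT f ->
  (forall x, 0 <= f x) ->
  \int[mu]_x f x = r%:E * \int[mu]_x f (r * x)%R.
Proof.
move=> mf f0.
have mr : measurable_fun setT ((fun x => r * x)%R : measurableTypeR R -> measurableTypeR R).
  exact: measurable_funM.
have [nu nuE] := pushforward_measureP mu mr.
have r0' := ltW r0.
rewrite (eq_measure_integral (mscale (NngNum r0') nu)); last first.
  move=> A mA _; rewrite [LHS](lebesgue_measure_scale mA).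
  exact: (congr1 (fun m => r%:E * m A) nuE).
rewrite ge0_integral_mscale//=; congr (_ * _).
transitivity (\int[pushforward mu ((fun x => r * x)%R : measurableTypeR R -> measurableTypeR R)]_x f x).
  exact: (congr1 (fun m => \int[m]_x f x) (esym nuE)).
by rewrite ge0_integral_pushforward.
Qed.

Lemma ge0_integral_plane_scale (f : plane R -> \bar R) : measurable_fun setT f ->
  (forall z, 0 <= f z) ->
  \int[plane_lebesgue]_z f z =
  (r ^+ 2)%:E * \int[plane_lebesgue]_z f (r * z.1, r * z.2)%R.
Proof.
move=> mf f0.
have mr : measurable_fun setT ((fun z => (r * z.1, r * z.2))%R : plane R -> plane R).
  by apply: measurable_fun_pair; apply: measurable_funM.
pose g : plane R -> \bar R := fun z => f (r * z.1, r * z.2)%R.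
have mg : measurable_fun setT g by exact: (measurableT_comp mf mr).
have g0 z : 0 <= g z by exact: f0.
have F0 h x : (forall z : plane R, 0 <= h z) -> 0 <= fubini_F mu h x.
  by move=> h0; apply: integral_ge0 => y _; exact: h0.
transitivity ((r ^+ 2)%:E * \int[plane_lebesgue]_z g z) => //.
rewrite [LHS](fubini_tonelli1 f mf f0) [X in _ = _ * X](fubini_tonelli1 g mg g0).
rewrite ge0_integral_scale//; last 2 first.
- exact: measurable_fun_fubini_tonelli_F.
- by move=> x; exact: F0.
rewrite expr2 EFinM -muleA; congr (_ * _).
rewrite -ge0_integralZl//; last 3 first.
- exact: measurable_fun_fubini_tonelli_F.
- by move=> x _; exact: F0.
- by rewrite lee_fin ltW.
apply: eq_integral => x _; rewrite /fubini_F/= [LHS]ge0_integral_scale//.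
by apply: measurableT_comp => //; exact: measurable_pair1.
Qed.

End lebesgue_scaling.

Section tuple_scaling.
Local Open Scope ereal_scope.
Context {R : realType}.
Local Notation Cn n := (n.-tuple (plane R)).
Local Notation L n := (@tuple_measure _ _ R plane_lebesgue n).

Definition tscale n (r : R) (t : Cn n) : Cn n :=
  [tuple (r * (tnth t i).1, r * (tnth t i).2)%R | i < n].

Lemma measurable_tscale n r : measurable_fun setT (@tscale n r).
Proof.
apply/measurable_fun_tnthP => i.
rewrite (_ : _ \o _ = fun t : Cn n => (r * (tnth t i).1, r * (tnth t i).2)%R).
  have mt := @measurable_tnth _ (plane R) n i.
  by apply: measurable_fun_pair; apply: measurable_funM => //;
    apply: (measurableT_comp _ mt).
by apply/funext => t /=; rewrite tnth_mktuple.
Qed.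

Lemma tscale_cons n r z (t : Cn n) :
  tscale r (tcons (z, t)) = tcons ((r * z.1, r * z.2)%R : plane R, tscale r t).
Proof.
apply: eq_from_tnth => i; rewrite tnth_mktuple.
by case: (unliftP ord0 i) => [j|] ->; rewrite ?tnthS ?tnth0 ?tnth_mktuple.
Qed.

(** Each complex coordinate contributes r^2, one r for each of its real axes. *)
Lemma ge0_integral_tuple_scale n (r : R) (f : Cn n -> \bar R) : (0 < r)%R ->
  measurable_fun setT f -> (forall t, 0 <= f t) ->
  \int[L n]_t f t = ((r ^+ 2) ^+ n)%:E * \int[L n]_t f (tscale r t).
Proof.
move=> r0; elim: n f => [|n ih] f mf f0.
  rewrite expr0 mul1e; apply: eq_integral => t _; congr f.
  by apply: eq_from_tnth => -[].
have mfs : measurable_fun setT (f \o tscale r).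
  by apply: measurableT_comp => //; exact: measurable_tscale.
rewrite [LHS]ge0_integral_tuple_measureS//.
rewrite [X in _ = _ * X](ge0_integral_tuple_measureS _ mfs); last by move=> t; exact: f0.
have mfc z : measurable_fun setT (fun t => f (tcons (z, t))).
  apply: measurableT_comp => //.
  by apply: (measurableT_comp (@measurable_tcons _ (plane R) n)); exact: measurable_pair1.
pose F (z : plane R) := \int[L n]_t f (tcons (z, t)).
have mF : measurable_fun setT F.
  apply: (measurable_fun_fubini_tonelli_F (f \o @tcons _ (plane R) n)); last by move=> p; exact: f0.
  by apply: measurableT_comp => //; exact: measurable_tcons.
have F0 z : 0 <= F z by apply: integral_ge0 => t _; exact: f0.
transitivity (\int[plane_lebesgue]_z F z) => //.
rewrite (ge0_integral_plane_scale r0 mF F0).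
rewrite (exprS (r ^+ 2)%R) [(_ * _ ^+ n)%:E]EFinM -muleA; congr (_ * _).
have mFs : measurable_fun setT (fun z : plane R => \int[L n]_t (f \o tscale r) (tcons (z, t))).
  apply: (measurable_fun_fubini_tonelli_F ((f \o tscale r) \o @tcons _ (plane R) n)); last by move=> p; exact: f0.
  by apply: measurableT_comp => //; exact: measurable_tcons.
rewrite -ge0_integralZl//; last 2 first.
- by move=> z _; apply: integral_ge0 => t _; exact: f0.
- by rewrite lee_fin exprn_ge0// exprn_ge0// ltW.
apply: eq_integral => z _; rewrite /F ih//.
by congr (_ * _); apply: eq_integral => t _; rewrite /= tscale_cons.
Qed.

End tuple_scaling.

Section tuple_gauss_density.
Local Open Scope ereal_scope.
Context {R : realType}.
Local Notation Cn n := (n.-tuple (plane R)).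
Local Notation L n := (@tuple_measure _ _ R plane_lebesgue n).
Local Notation Gm n := (@tuple_measure _ _ R (plane_gauss hs hs) n).
Local Notation mu := (@lebesgue_measure R).

Definition plane_pdf (s1 s2 : R) (z : plane R) : R :=
  (normal_pdf 0 s1 z.1 * normal_pdf 0 s2 z.2)%R.

Lemma plane_pdf_ge0 s1 s2 z : (0 <= plane_pdf s1 s2 z)%R.
Proof. by rewrite mulr_ge0// normal_pdf_ge0. Qed.

Lemma measurable_plane_pdf s1 s2 : measurable_fun setT (plane_pdf s1 s2).
Proof.
by apply: measurable_funM; apply: measurableT_comp => //; exact: measurable_normal_pdf.
Qed.

Lemma ge0_integral_normal_prob s (f : measurableTypeR R -> \bar R) :
  measurable_fun setT f -> (forall x, 0 <= f x) ->
  \int[normal_prob 0 s]_x f x = \int[mu]_x (f x * (normal_pdf 0 s x)%:E).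
Proof.
move=> mf f0; apply: ge0_integral_density => //.
- by move=> x; exact: normal_pdf_ge0.
- exact: measurable_normal_pdf.
Qed.

Lemma ge0_integral_plane_gauss s1 s2 (f : plane R -> \bar R) :
  measurable_fun setT f -> (forall z, 0 <= f z) ->
  \int[plane_gauss s1 s2]_z f z = \int[plane_lebesgue]_z (f z * (plane_pdf s1 s2 z)%:E).
Proof.
move=> mf f0.
have mp : measurable_fun setT (EFin \o plane_pdf s1 s2).
  by apply/measurable_EFinP; exact: measurable_plane_pdf.
have mfp : measurable_fun setT (fun z => f z * (plane_pdf s1 s2 z)%:E).
  exact: emeasurable_funM.
have fp0 z : 0 <= f z * (plane_pdf s1 s2 z)%:E.
  by rewrite mule_ge0// lee_fin plane_pdf_ge0.
rewrite [LHS](fubini_tonelli1 f mf f0) [RHS](fubini_tonelli1 _ mfp fp0).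
rewrite ge0_integral_normal_prob//; last 2 first.
- exact: measurable_fun_fubini_tonelli_F.
- by move=> x; apply: integral_ge0 => y _; exact: f0.
apply: eq_integral => x _; rewrite /fubini_F.
have mfx : measurable_fun setT (fun y => f (x, y)).
  by apply: measurableT_comp => //; exact: measurable_pair1.
rewrite ge0_integral_normal_prob// -ge0_integralZr//; last 3 first.
- apply: emeasurable_funM => //; apply/measurable_EFinP; exact: measurable_normal_pdf.
- by move=> y _; rewrite mule_ge0// lee_fin normal_pdf_ge0.
- by rewrite lee_fin normal_pdf_ge0.
by apply: eq_integral => y _; rewrite /plane_pdf/= EFinM -muleA [X in _ * X]muleC.
Qed.

Definition tuple_pdf n (t : Cn n) : R := (\prod_(i < n) plane_pdf hs hs (tnth t i))%R.

Lemma tuple_pdf_ge0 n (t : Cn n) : (0 <= tuple_pdf t)%R.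
Proof. by apply: prodr_ge0 => i _; exact: plane_pdf_ge0. Qed.

Lemma measurable_tuple_pdf n : measurable_fun setT (@tuple_pdf n).
Proof.
apply: measurable_prod => i _.
by apply: measurableT_comp; [exact: measurable_plane_pdf|exact: measurable_tnth].
Qed.

Lemma tuple_pdf_cons n z (t : Cn n) :
  tuple_pdf (tcons (z, t)) = (plane_pdf hs hs z * tuple_pdf t)%R.
Proof.
rewrite /tuple_pdf big_ord_recl tnth0; congr (_ * _)%R.
by apply: eq_bigr => i _; rewrite tnthS.
Qed.

Lemma ge0_integral_tuple_gauss n (f : Cn n -> \bar R) :
  measurable_fun setT f -> (forall t, 0 <= f t) ->
  \int[Gm n]_t f t = \int[L n]_t (f t * (tuple_pdf t)%:E).
Proof.
elim: n f => [|n ih] f mf f0.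
  by apply: eq_integral => t _; rewrite /tuple_pdf big_ord0 mule1.
have mfp : measurable_fun setT (fun t => f t * (tuple_pdf t)%:E).
  by apply: emeasurable_funM => //; apply/measurable_EFinP; exact: measurable_tuple_pdf.
rewrite ge0_integral_tuple_measureS// [RHS](ge0_integral_tuple_measureS _ mfp); last first.
  by move=> t; rewrite mule_ge0// lee_fin tuple_pdf_ge0.
have mF : measurable_fun setT (fun z : plane R => \int[Gm n]_t f (tcons (z, t))).
  apply: (measurable_fun_fubini_tonelli_F (f \o @tcons _ (plane R) n)); last by move=> p; exact: f0.
  by apply: measurableT_comp => //; exact: measurable_tcons.
rewrite [LHS](ge0_integral_plane_gauss _ _ mF); last first.
  by move=> z; apply: integral_ge0 => t _; exact: f0.
apply: eq_integral => z _.
have mfc : measurable_fun setT (fun t => f (tcons (z, t))).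
  apply: measurableT_comp => //.
  by apply: (measurableT_comp (@measurable_tcons _ (plane R) n)); exact: measurable_pair1.
rewrite ih// -ge0_integralZr//; last 3 first.
- by apply: emeasurable_funM => //; apply/measurable_EFinP; exact: measurable_tuple_pdf.
- by move=> t _; rewrite mule_ge0// lee_fin tuple_pdf_ge0.
- by rewrite lee_fin plane_pdf_ge0.
by apply: eq_integral => t _; rewrite tuple_pdf_cons EFinM -muleA [X in _ * X]muleC.
Qed.

(** The density depends on t through |t| only; its superlevel sets are balls, which is what the
    computation on cones uses. *)
Lemma tuple_pdfE n (t : Cn n) :
  tuple_pdf t = ((normal_peak hs ^+ 2) ^+ n * expR (- sqnorm t))%R.
Proof.
have pE (z : plane R) : plane_pdf hs hs z =
    (normal_peak hs ^+ 2 * expR (- ((z.1 : R) ^+ 2 + (z.2 : R) ^+ 2)))%R.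
  rewrite /plane_pdf !normal_pdfE ?hs_neq0// /normal_fun !subr0 hs_sqr.
  by rewrite mulrACA -expRD -expr2; congr (_ * expR _)%R; field.
rewrite /tuple_pdf (eq_bigr _ (fun i _ => pE (tnth t i))).
by rewrite big_split/= prodr_const card_ord -expR_sum sumrN.
Qed.

End tuple_gauss_density.

(** * Gaussian measure of cones *)

Section sphere_gauss.
Local Open Scope ereal_scope.
Context {R : realType} (n : nat).
Hypothesis n0 : (0 < n)%N.
Local Notation Cn := (n.-tuple (plane R)).
Local Notation L := (@tuple_measure _ _ R plane_lebesgue n).
Local Notation Gm := (@tuple_measure _ _ R (plane_gauss hs hs) n).
Local Notation mu := (@lebesgue_measure R).

Lemma Cn_norm_sqnorm (t : Cn) : Cn_norm t = Num.sqrt (sqnorm t).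
Proof. by rewrite Cn_normE. Qed.

Lemma measurable_sqnorm : measurable_fun setT (@sqnorm R n).
Proof.
apply: measurable_sum => i; apply: measurable_funD; apply: measurable_funX.
  by apply: measurableT_comp; [exact: measurable_fst|exact: measurable_tnth].
by apply: measurableT_comp; [exact: measurable_snd|exact: measurable_tnth].
Qed.

Lemma sqnorm_tscale r (t : Cn) : sqnorm (tscale r t) = (r ^+ 2 * sqnorm t)%R.
Proof.
rewrite /sqnorm mulr_sumr; apply: eq_bigr => i _.
by rewrite tnth_mktuple /= !exprMn mulrDr.
Qed.

Lemma radial_proj_tscale r (t : Cn) : (0 < r)%R ->
  radial_proj (tscale r t) = radial_proj t.
Proof.
move=> r0; have rN : Cn_norm (tscale r t) = (r * Cn_norm t)%R.
  by rewrite !Cn_norm_sqnorm sqnorm_tscale sqrtrM ?sqr_ge0// sqrtr_sqr ger0_norm// ltW.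
apply: eq_from_tnth => i; rewrite !tnth_mktuple rN /=.
have K a : ((r * Cn_norm t)^-1 * (r * a) = (Cn_norm t)^-1 * a)%R.
  by rewrite invfM mulrACA mulVf ?gt_eqF// mul1r.
by rewrite !K.
Qed.

Lemma tuple_gauss_norm0 : Gm [set t | Cn_norm t = 0%R] = 0.
Proof.
pose B : set (plane R) := ([set 0%R] : set R) `*` ([set 0%R] : set R).
have mB : measurable B by apply: measurableX; exact: measurable_set1.
rewrite (_ : [set t | _] = [set t : Cn | forall i, B (tnth t i)]); last first.
  apply/seteqP; split => t /=.
    rewrite Cn_norm_sqnorm => /eqP; rewrite sqrtr_eq0 => s0 i.
    have h j : true -> (0 <= ((tnth t j).1 : R) ^+ 2 + ((tnth t j).2 : R) ^+ 2)%R.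
      by rewrite addr_ge0 ?sqr_ge0.
    have /eqP : sqnorm t = 0%R by apply/eqP; rewrite eq_le s0 sqnorm_ge0.
    rewrite psumr_eq0// => /allP/(_ i); rewrite mem_index_enum => /(_ isT).
    by rewrite paddr_eq0 ?sqr_ge0// !sqrf_eq0 => /andP[/eqP ? /eqP ?]; split.
  move=> h; rewrite Cn_norm_sqnorm /sqnorm big1 ?sqrtr0// => i _.
  by have [/= -> ->] := h i; rewrite expr0n addr0.
rewrite tuple_measure_cube//.
have B0 : plane_gauss hs hs B = 0.
  have N0 : normal_prob 0 hs ([set 0%R] : set R) = 0.
    by rewrite /normal_prob integral_set1.
  transitivity (normal_prob 0 hs ([set 0%R] : set R) * normal_prob 0 hs ([set 0%R] : set R)).
    by apply: product_measure1E; exact: measurable_set1.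
  by rewrite [X in X * _]N0 mul0e.
by rewrite [X in X ^+ _]B0; case: n n0 => // m _; rewrite expeS mul0e.
Qed.

(** This is n!/pi^n, the inverse of the volume of the unit ball of C^n. Its value is obtained from
    the total mass of the Gaussian, not from the integral. *)
Definition layer_const : \bar R := ((normal_peak hs ^+ 2) ^+ n)%:E *
  \int[mu]_u (\1_(`]0%R, 1%R[%classic : set R) u * (- ln u) ^+ n)%:E.

Lemma layer_const_ge0 : 0 <= layer_const.
Proof.
rewrite /layer_const mule_ge0 ?lee_fin ?exprn_ge0 ?exprn_ge0 ?normal_peak_ge0//.
apply: integral_ge0 => u _; rewrite lee_fin indicE; case: (boolP (u \in _)) => [|_]; last by rewrite mul0r.
rewrite inE /= in_itv/= => /andP[u0 u1]; rewrite mul1r exprn_ge0// oppr_ge0.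
by rewrite ln_le0// ltW.
Qed.

(** Layer-cake formula: exp(-|t|^2) is the length of the set of u in ]0, 1[ with u <= exp(-|t|^2).
    At height u the cone is cut by the ball of radius (-ln u)^(1/2), and scaling to the unit ball
    yields the same Lebesgue measure for every u, times (-ln u)^n. *)
Lemma tuple_gauss_cone (E : set Cn) : measurable E ->
  Gm (@radial_proj R n @^-1` E) =
  layer_const * L [set t | (0 < Cn_norm t <= 1)%R /\ E (radial_proj t)].
Proof.
move=> mE.
have mP : measurable (@radial_proj R n @^-1` E).
  by rewrite -[X in measurable X]setTI; exact: measurable_radial_proj.
have mN : measurable [set t : Cn | (0 < Cn_norm t)%R].
  rewrite (_ : [set t | _] = @Cn_norm R n @^-1` `]0%R, +oo[).
    by rewrite -[X in measurable X]setTI; exact: measurable_Cn_norm.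
  by apply/seteqP; split => t /=; rewrite in_itv/= andbT.
have mN1 : measurable [set t : Cn | (0 < Cn_norm t <= 1)%R].
  rewrite (_ : [set t | _] = @Cn_norm R n @^-1` `]0%R, 1%R]).
    by rewrite -[X in measurable X]setTI; exact: measurable_Cn_norm.
  by apply/seteqP; split => t /=; rewrite in_itv.
(* The origin, a null set as n > 0, is removed: elsewhere exp(-|t|^2) < 1, so the heights remain in
   the open interval. *)
pose A := (@radial_proj R n @^-1` E) `&` [set t : Cn | (0 < Cn_norm t)%R].
have mA : measurable A by exact: measurableI.
pose C := [set t | (0 < Cn_norm t <= 1)%R /\ E (radial_proj t)].
have mC : measurable C.
  by rewrite (_ : C = [set t : Cn | (0 < Cn_norm t <= 1)%R] `&` (@radial_proj R n @^-1` E))//;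
    exact: measurableI.
have -> : Gm (@radial_proj R n @^-1` E) = Gm A.
  rewrite (_ : _ @^-1` _ = A `|` ((@radial_proj R n @^-1` E) `\` [set t : Cn | (0 < Cn_norm t)%R])); last first.
    by rewrite setUIDK.
  rewrite measureU//; last 2 first.
  - exact: measurableD.
  - by apply/seteqP; split => t // -[[_ ?] [_ ?]].
  rewrite [X in _ + X](_ : _ = 0) ?adde0//.
  apply: (@subset_measure0 _ _ _ Gm _ [set t | Cn_norm t = 0%R]) => //.
  - exact: measurableD.
  - rewrite (_ : [set t | _] = ~` [set t : Cn | (0 < Cn_norm t)%R]).
      exact: measurableC.
    apply/seteqP; split => t /=; first by move=> ->; rewrite ltxx.
    by move=> /negP; rewrite -leNgt => h; apply/eqP; rewrite eq_le h Cn_norm_sqnorm sqrtr_ge0.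
  - by move=> t [_ /negP]; rewrite -leNgt => h; apply/eqP; rewrite eq_le h Cn_norm_sqnorm sqrtr_ge0.
  - exact: tuple_gauss_norm0.
(* The region under the graph of exp(-|t|^2) above the cone, to be sliced first by t and then by
   u. *)
pose S : set (Cn * measurableTypeR R) :=
  [set p | A p.1 /\ ((0 < p.2 < 1)%R /\ (p.2 <= expR (- sqnorm p.1))%R)].
have mS : measurable S.
  rewrite (_ : S = (A `*` setT) `&` ((setT `*` `]0%R, 1%R[%classic) `&`
      ((fun p : Cn * measurableTypeR R => expR (- sqnorm p.1) - p.2)%R @^-1` `[0%R, +oo[))).
    apply: measurableI; first exact: measurableX.
    apply: measurableI; first exact: measurableX.
    rewrite -[X in measurable X]setTI.
    have mf : measurable_fun setT
        (fun p : Cn * measurableTypeR R => expR (- sqnorm p.1) - p.2)%R.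
      apply: measurable_funB; last exact: measurable_snd.
      apply: measurableT_comp => //; apply: measurable_funN.
      exact: (measurableT_comp measurable_sqnorm measurable_fst).
    by apply: mf.
  apply/seteqP; split => -[t u] /=; rewrite !in_itv/= andbT subr_ge0.
    by move=> [? [? ?]].
  by move=> [[? _] [[_ ?] ?]].
pose kn : R := ((normal_peak hs ^+ 2) ^+ n)%R.
have kn0 : (0 <= kn)%R by rewrite exprn_ge0// exprn_ge0// normal_peak_ge0.
have m1S : measurable_fun setT (fun p : Cn * measurableTypeR R => (\1_S p : R)%:E).
  by apply/measurable_EFinP; exact: measurable_indic.
have S0 (p : Cn * measurableTypeR R) : 0 <= (\1_S p : R)%:E by rewrite lee_fin.
transitivity (\int[Gm]_t (\1_A t : R)%:E); first by rewrite integral_indic// setIT.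
rewrite ge0_integral_tuple_gauss//; last first.
  by apply/measurable_EFinP; exact: measurable_indic.
transitivity (\int[L]_t (kn%:E * \int[mu]_u (\1_S (t, u) : R)%:E)).
  apply: eq_integral => t _; rewrite tuple_pdfE -/kn EFinM muleCA; congr (_ * _).
  rewrite indicE; case: (boolP (t \in A)) => tA; last first.
    rewrite mul0e integral0_eq// => u _; rewrite indicE memNset//= => -[At _].
    by move/negP : tA; apply; rewrite inE.
  have s0 : (0 < sqnorm t)%R.
    move: tA; rewrite inE => -[_ /=]; rewrite Cn_norm_sqnorm.
    by rewrite sqrtr_gt0.
  rewrite mul1e (_ : (fun u => _) = fun u => (\1_(`]0%R, expR (- sqnorm t)]%classic) u)%:E).
    rewrite integral_indic// setIT [RHS]lebesgue_measure_itv/= lte_fin expR_gt0.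
    by rewrite oppr0 adde0.
  apply/funext => u; congr (_%:R)%:E; congr nat_of_bool.
  apply/idP/idP; rewrite !inE /S/= in_itv/=.
    by move=> [_ [/andP[-> _] ->]].
  move=> /andP[u0 ue]; split; first by move: tA; rewrite inE.
  split => //; rewrite u0/=; apply: le_lt_trans ue _.
  by rewrite -[ltRHS](expR0 R) ltr_expR oppr_lt0.
rewrite ge0_integralZl ?lee_fin//; last 2 first.
- exact: (measurable_fun_fubini_tonelli_F _ m1S S0).
- by move=> t _; apply: integral_ge0 => u _; exact: S0.
rewrite (fubini_tonelli (m1 := L) (m2 := mu) (fun p => (\1_S p : R)%:E))//.
rewrite /layer_const -/kn -muleA; congr (_ * _).
rewrite -ge0_integralZr//; last 2 first.
- apply/measurable_EFinP; apply: measurable_funM; first exact: measurable_indic.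
  by apply: measurable_funX; apply: measurable_funN; exact: measurable_ln.
- move=> u _; rewrite lee_fin indicE; case: (boolP (u \in _)) => [|_]; last by rewrite mul0r.
  rewrite inE /= in_itv/= => /andP[u0 u1]; rewrite mul1r exprn_ge0// oppr_ge0.
  by rewrite ln_le0// ltW.
apply: eq_integral => u _; rewrite indicE.
case: (boolP (u \in `]0%R, 1%R[%classic)) => u01; last first.
  rewrite mul0r mul0e integral0_eq// => t _; rewrite indicE memNset//= => -[_ [h _]].
  by move/negP : u01; apply; rewrite inE /= in_itv.
move: (u01); rewrite inE /= in_itv/= => /andP[u0 u1].
have lu : (0 < - ln u)%R by rewrite oppr_gt0 ln_lt0// u0.
(* The radius of the ball { exp(-|t|^2) >= u }; rescaling by r produces the factor (r^2)^n = (-ln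
   u)^n. *)
pose r : R := Num.sqrt (- ln u).
have r0 : (0 < r)%R by rewrite sqrtr_gt0.
have r2 : (r ^+ 2 = - ln u)%R by rewrite sqr_sqrtr// ltW.
rewrite mul1r (ge0_integral_tuple_scale r0)//; last first.
  by apply: (measurableT_comp m1S); exact: measurable_pair2.
rewrite r2; congr (_ * _).
transitivity (\int[L]_t (\1_C t : R)%:E); last by rewrite integral_indic// setIT.
apply: eq_integral => t _; congr (_%:R)%:E; congr nat_of_bool.
have key : (u <= expR (- (r ^+ 2 * sqnorm t)))%R = (Cn_norm t <= 1)%R.
  rewrite -[u in LHS]lnK ?posrE// ler_expR -[ln u]opprK -r2 lerN2.
  rewrite ger_pMr ?exprn_gt0// Cn_norm_sqnorm -[in RHS](sqrtr1 R) ler_sqrt//.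
have Nr : (0 < Cn_norm (tscale r t))%R = (0 < Cn_norm t)%R.
  by rewrite !Cn_norm_sqnorm !sqrtr_gt0 sqnorm_tscale pmulr_rgt0// exprn_gt0.
have SC : S (tscale r t, u) <-> C t.
  have rp : E (radial_proj (tscale r t)) = E (radial_proj t).
    by rewrite radial_proj_tscale.
  split => [[[Et N0] [_ N1]]|[/andP[N0 N1] Et]].
    split; last by rewrite -rp.
    by apply/andP; split; [rewrite -Nr|rewrite -key -sqnorm_tscale].
  split; first by split; [rewrite /preimage/= rp|rewrite /= Nr].
  by split; [rewrite /= u0 u1|rewrite /= sqnorm_tscale key].
by apply/idP/idP => /set_mem h; apply: mem_set; apply/SC.
Qed.

(** Both sides are constant multiples of the Lebesgue measure of the truncated cone over E, and both
    have total mass 1. *)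
Lemma sphere_uniform_gauss (E : set Cn) : measurable E ->
  sphere_uniform n E = Gm (@radial_proj R n @^-1` E).
Proof.
move=> mE; rewrite sphere_uniformE// tuple_gauss_cone//.
(* The case of the full sphere determines [layer_const] as the inverse of the volume of the ball. *)
have tot := @tuple_gauss_cone setT measurableT.
rewrite preimage_setT (tuple_gauss_setT n) in tot.
have fs : sphere_surface [set: Cn] \is a fin_num.
  by rewrite ge0_fin_numE ?sphere_surface_lty.
have ps := @sphere_surface_gt0 R n n0.
have n20 : (0 < (2 * n)%:R :> R)%R by rewrite ltr0n muln_gt0.
pose V : \bar R := L [set t | (0 < Cn_norm t <= 1)%R /\ setT (radial_proj t)].
have VE : sphere_surface [set: Cn] = (2 * n)%:R%:E * V by [].
have V0 : 0 <= V by exact: measure_ge0.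
have fV : V \is a fin_num.
  rewrite ge0_fin_numE//; apply: contraTT fs; rewrite -leNgt leye_eq => /eqP VV.
  by rewrite VE VV gt0_muley// lte_fin.
have V1 : (0 < fine V)%R.
  move: ps; rewrite VE -(fineK fV) -EFinM lte_fin.
  by rewrite pmulr_rgt0.
have cE : layer_const = (fine V)^-1%:E.
  move: tot; rewrite -/V -(fineK fV).
  case: layer_const layer_const_ge0 => [c| |]//.
    move=> _; rewrite -EFinM => -[h]; congr EFin.
    by rewrite -[RHS]mul1r h mulfK// gt_eqF.
  by move=> _; rewrite gt0_mulye// lte_fin.
rewrite cE VE -(fineK fV) -EFinM /= invfM.
rewrite /sphere_surface muleAC -EFinM mulrA mulfV ?gt_eqF//.
by rewrite mul1r.
Qed.

End sphere_gauss.

(** * Trigonometric approximation and weak convergence *)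

Section modulus.
Context {R : realType} (f : R * R -> R).
Hypothesis cf : continuous f.
Variable M : R.
Hypothesis fM : forall z, `|f z| <= M.

(** Compactness of the box, in near-covering form. Only z is confined to the box; w may leave it, so
    this is slightly more than uniform continuity on the box. *)
Lemma box_unif_continuous (k e : R) : 0 < e ->
  exists2 d : R, 0 < d & forall z w : R * R, `|z.1| <= k -> `|z.2| <= k ->
    `|z.1 - w.1| < d -> `|z.2 - w.2| < d -> `|f z - f w| <= e.
Proof.
move=> e0.
pose K : set (R * R) := `[- k, k] `*` `[- k, k].
have cK : compact K by apply: compact_setX; exact: segment_compact.
pose P (d : R) (z : R * R) := forall w : R * R, `|z.1 - w.1| < d ->
  `|z.2 - w.2| < d -> `|f z - f w| <= e.
have : \forall d \near (0:R)^'+, K `<=` P d.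
  have /compact_near_coveringP ncK := cK.
  apply: ncK => z Kz.
  have e20 : 0 < e / 2 by rewrite divr_gt0.
  have /cvgrPdist_lt /(_ _ e20) := @cf z.
  move=> /nbhs_ballP[r /= r0 zr].
  exists (ball z (r / 2), [set d | d < r / 2]) => /=.
    split; first by apply: nbhsx_ballx; rewrite divr_gt0.
    by apply: nbhs_right_lt; rewrite divr_gt0.
  move=> [z' d] /= [[z1 z2] dr] w w1 w2.
  have Bw : ball z r w.
    split; rewrite /ball/=.
      rewrite -(subrKA z'.1); apply: le_lt_trans (ler_normD _ _) _.
      by rewrite (splitr r) ltrD// (lt_trans w1).
    rewrite -(subrKA z'.2); apply: le_lt_trans (ler_normD _ _) _.
    by rewrite (splitr r) ltrD// (lt_trans w2).
  have Bz : ball z r z'.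
    by split; rewrite /ball/=; [apply: lt_trans z1 _|apply: lt_trans z2 _];
      rewrite ltr_pdivrMr// ltr_pMr// ltr1n.
  have h1 := zr _ Bw; have h2 := zr _ Bz.
  rewrite -(subrKA (f z)); apply: le_trans (ler_normD _ _) _.
  by rewrite (splitr e); apply: lerD; [rewrite distrC|]; exact/ltW.
move=> [d /= d0 dP]; exists (d / 2); first by rewrite divr_gt0.
move=> z w z1 z2 w1 w2; apply: (dP (d / 2)) => //=.
- by rewrite sub0r normrN ger0_norm ?ltr_pdivrMr ?ltr_pMr ?ltr1n// ltW// divr_gt0.
- by rewrite divr_gt0.
- by split; rewrite /= in_itv/= -ler_norml.
Qed.

(** Three regimes: if z is outside a large box, 2M <= e |z|^2; if w is at distance at least d from z
    in some coordinate, 2M is at most 2M/d times the distance; otherwise uniform continuity on the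
    box gives e. *)
Lemma modulus_of_continuity (e : R) : 0 < e -> exists2 C : R, 0 <= C &
  forall z w : R * R, `|f z - f w| <=
    e * (1 + (z.1 ^+ 2 + z.2 ^+ 2)) + C * (`|z.1 - w.1| + `|z.2 - w.2|).
Proof.
move=> e0.
have M0 : 0 <= M by exact: le_trans (fM (0, 0)).
(* Chosen so that e k^2 = 2M, the oscillation bound of f. *)
pose k : R := Num.sqrt (2 * M / e).
have k2 : k ^+ 2 = 2 * M / e by rewrite sqr_sqrtr// divr_ge0 ?mulr_ge0// ltW.
have k0 : 0 <= k by rewrite sqrtr_ge0.
have [d d0 fd] := box_unif_continuous k e0.
have f2M z w : `|f z - f w| <= 2 * M.
  by apply: le_trans (ler_normB _ _) _; rewrite mulr_natl mulr2n lerD.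
exists (2 * M / d); first by rewrite divr_ge0 ?mulr_ge0// ltW.
move=> z w.
have q0 : 0 <= z.1 ^+ 2 + z.2 ^+ 2 by rewrite addr_ge0 ?sqr_ge0.
have C0 : 0 <= 2 * M / d * (`|z.1 - w.1| + `|z.2 - w.2|).
  by rewrite mulr_ge0 ?addr_ge0// divr_ge0 ?mulr_ge0// ltW.
have big (x : R) : k < `|x| -> x ^+ 2 <= z.1 ^+ 2 + z.2 ^+ 2 ->
    `|f z - f w| <= e * (1 + (z.1 ^+ 2 + z.2 ^+ 2)) +
      2 * M / d * (`|z.1 - w.1| + `|z.2 - w.2|).
  move=> kx xz; apply: (le_trans (f2M _ _)); rewrite -[leLHS]addr0 lerD//.
  apply: (@le_trans _ _ (e * k ^+ 2)); first by rewrite k2 [e * _]mulrC divfK ?gt_eqF.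
  rewrite ler_wpM2l ?(ltW e0)//; apply: (@le_trans _ _ (x ^+ 2)).
    by rewrite -[x ^+ 2]real_normK ?num_real// lerXn2r ?nnegrE// ltW.
  by rewrite (le_trans xz)// lerDr.
have far (x : R) : d <= x -> x <= `|z.1 - w.1| + `|z.2 - w.2| ->
    `|f z - f w| <= e * (1 + (z.1 ^+ 2 + z.2 ^+ 2)) +
      2 * M / d * (`|z.1 - w.1| + `|z.2 - w.2|).
  move=> dx xz; apply: (le_trans (f2M _ _)); rewrite -[leLHS]add0r lerD//.
    by apply: mulr_ge0; [exact: ltW|rewrite addr_ge0].
  rewrite -mulrA -[leLHS]mulr1 ler_wpM2l ?mulr_ge0//.
  by rewrite mulrC ler_pdivlMr// mul1r (le_trans dx).
have [z1|z1] := leP `|z.1| k; last by apply: (big _ z1); rewrite lerDl sqr_ge0.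
have [z2|z2] := leP `|z.2| k; last by apply: (big _ z2); rewrite lerDr sqr_ge0.
have [w1|w1] := ltP `|z.1 - w.1| d; last by apply: (far _ w1); rewrite lerDl.
have [w2|w2] := ltP `|z.2 - w.2| d; last by apply: (far _ w2); rewrite lerDr.
apply: le_trans (fd z w z1 z2 w1 w2) _.
by rewrite -[leLHS]addr0 lerD// ler_pMr// lerDl.
Qed.

End modulus.

Section bernstein.
Context {R : realType}.

(* Expectation of g at a binomial variable, written as a recursion on the last
   coin toss; this avoids binomial coefficients. *)
Fixpoint bern (N : nat) (g : nat -> R) (p : R) : R :=
  if N is N'.+1 then p * bern N' (fun k => g k.+1) p + (1 - p) * bern N' g p
  else g 0%N.

Lemma bernD N f g p : bern N (fun k => f k + g k) p = bern N f p + bern N g p.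
Proof. by elim: N f g => [//|N ih] f g /=; rewrite !ih; ring. Qed.

Lemma bernZ N c g p : bern N (fun k => c * g k) p = c * bern N g p.
Proof. by elim: N g => [//|N ih] g /=; rewrite !ih; ring. Qed.

Lemma bern_cst N c p : bern N (fun=> c) p = c.
Proof. by elim: N => [//|N ih] /=; rewrite ih; ring. Qed.

Lemma bern_le N f g p : 0 <= p <= 1 -> (forall k, f k <= g k) ->
  bern N f p <= bern N g p.
Proof.
move=> /andP[p0 p1]; elim: N f g => [|N ih] f g fg /=; first exact: fg.
by rewrite lerD// ler_wpM2l ?subr_ge0// ih.
Qed.

Lemma bern_norm N f p : 0 <= p <= 1 -> `|bern N f p| <= bern N (fun k => `|f k|) p.
Proof.
move=> p01; rewrite ler_norml; apply/andP; split.
  rewrite -mulN1r -bernZ; apply: bern_le => // k.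
  by rewrite mulN1r lerNl -normrN ler_norm.
by apply: bern_le => // k; exact: ler_norm.
Qed.

(** Variance plus squared bias. The centre a is arbitrary for the induction: a success shifts it by
    1. *)
Lemma bern_sqr N a p : bern N (fun k => (k%:R - a) ^+ 2) p =
  N%:R * (p * (1 - p)) + (N%:R * p - a) ^+ 2.
Proof.
elim: N a => [|N ih] a /=; first by ring.
rewrite ih (_ : (fun k => _) = (fun k => (k%:R - (a - 1)) ^+ 2)); last first.
  by apply/funext => k; rewrite -natr1; ring.
by rewrite ih -natr1; ring.
Qed.

(** From |x| <= e + x^2/e and the binomial variance, with p (1 - p) <= 1. *)
Lemma bern_dist N p e : 0 < e -> (0 < N)%N -> 0 <= p <= 1 ->
  bern N (fun k => `|p - k%:R / N%:R|) p <= e + (e * N%:R)^-1.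
Proof.
move=> e0 N0 p01.
have Nr0 : 0 < N%:R :> R by rewrite ltr0n.
have h k : `|p - k%:R / N%:R| <= e + (e * N%:R ^+ 2)^-1 * (k%:R - N%:R * p) ^+ 2.
  rewrite (_ : (_)^-1 * _ = (p - k%:R / N%:R) ^+ 2 / e); last first.
    by field; rewrite !gt_eqF.
  set x := p - _; rewrite -(ler_pM2l e0) mulrDr [e * (_ / _)]mulrC divfK ?gt_eqF//.
  have := sqr_ge0 (`|x| - e); rewrite sqrrB real_normK ?num_real//.
  have := mulr_ge0 (ltW e0) (normr_ge0 x).
  by rewrite -mulr_natr; lra.
apply: le_trans (bern_le N p01 h) _.
rewrite bernD bern_cst bernZ bern_sqr subrr expr0n/= addr0 lerD2l.
have -> : (e * N%:R ^+ 2)^-1 * (N%:R * (p * (1 - p))) = (e * N%:R)^-1 * (p * (1 - p)).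
  by field; rewrite !gt_eqF.
move: p01 => /andP[p0 p1].
rewrite ler_piMr ?invr_ge0 ?mulr_ge0 ?(ltW e0)//.
by rewrite mulr_ile1 ?subr_ge0// gerBl.
Qed.

End bernstein.

Section trigonometric_approximation.
Context {R : realType}.
Implicit Types (f g h : R * R -> R).

(** The phase c makes sines available from cosines alone, and constants come from zero
    frequencies. *)
Inductive trigpoly : (R * R -> R) -> Prop :=
| trigpoly_cos al be c : trigpoly (fun z => cos (al * z.1 + be * z.2 + c))
| trigpolyD f g : trigpoly f -> trigpoly g -> trigpoly (fun z => f z + g z)
| trigpolyZ k f : trigpoly f -> trigpoly (fun z => k * f z).

Lemma trigpoly_cst k : trigpoly (fun=> k).
Proof.
have := trigpolyZ k (trigpoly_cos 0 0 0); congr (trigpoly _).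
by apply/funext => z; rewrite !mul0r !addr0 cos0 mulr1.
Qed.

Lemma sin_cos_product (u v : R) :
  sin u * cos v = 2^-1 * cos (v + u - pi / 2) + 2^-1 * cos (v - u + pi / 2).
Proof.
rewrite cosDpihalf cosBpihalf sinD sinB.
by field.
Qed.

Lemma trigpoly_sin_fst k h : trigpoly h -> trigpoly (fun z => sin (k * z.1) * h z).
Proof.
elim=> [al be c|f g _ hf _ hg|a f _ hf].
- have h1 := trigpolyZ 2^-1 (trigpoly_cos (al + k) be (c - pi / 2)).
  have h2 := trigpolyZ 2^-1 (trigpoly_cos (al - k) be (c + pi / 2)).
  have := trigpolyD h1 h2; congr (trigpoly _); apply/funext => z.
  rewrite sin_cos_product; congr (_ * cos _ + _ * cos _); ring.
- by have := trigpolyD hf hg; congr (trigpoly _); apply/funext => z; rewrite mulrDr.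
- by have := trigpolyZ a hf; congr (trigpoly _); apply/funext => z; rewrite mulrCA.
Qed.

Lemma trigpoly_sin_snd k h : trigpoly h -> trigpoly (fun z => sin (k * z.2) * h z).
Proof.
elim=> [al be c|f g _ hf _ hg|a f _ hf].
- have h1 := trigpolyZ 2^-1 (trigpoly_cos al (be + k) (c - pi / 2)).
  have h2 := trigpolyZ 2^-1 (trigpoly_cos al (be - k) (c + pi / 2)).
  have := trigpolyD h1 h2; congr (trigpoly _); apply/funext => z.
  rewrite sin_cos_product; congr (_ * cos _ + _ * cos _); ring.
- by have := trigpolyD hf hg; congr (trigpoly _); apply/funext => z; rewrite mulrDr.
- by have := trigpolyZ a hf; congr (trigpoly _); apply/funext => z; rewrite mulrCA.
Qed.

(** The recursion of [bern] multiplies only by p and 1 - p, so stability under multiplication by p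
    suffices. Coefficients may depend on z, which allows nesting one average in another. *)
Lemma trigpoly_bern N (p : R * R -> R) (g : nat -> R * R -> R) :
  (forall h, trigpoly h -> trigpoly (fun z => p z * h z)) ->
  (forall k, trigpoly (g k)) -> trigpoly (fun z => bern N (g ^~ z) (p z)).
Proof.
move=> hp; elim: N g => [|N ih] g hg /=; first exact: hg.
have h1 := hp _ (ih _ (fun k => hg k.+1)).
have h2 := trigpolyD (ih _ hg) (trigpolyZ (-1) (hp _ (ih _ hg))).
have := trigpolyD h1 h2; congr (trigpoly _); apply/funext => z; ring.
Qed.

(** Brings the sine into [0, 1], the range of a coin bias. *)
Let half_sin (k x : R) : R := (1 + sin (k * x)) / 2.

Let half_sin01 k x : 0 <= half_sin k x <= 1.
Proof.
have := sin_max (k * x); rewrite ler_norml => /andP[h1 h2].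
by rewrite /half_sin; apply/andP; split; lra.
Qed.

(** The mean value theorem twice: x - sin x = (1 - cos y) x and 1 - cos y = y sin w, with 0 <= w <=
    y <= x. *)
Lemma dist_sin (x : R) : `|x - sin x| <= x ^+ 2.
Proof.
wlog x0 : x / 0 <= x.
  move=> h; have [|/ltW xn] := leP 0 x; first exact: h.
  have := h (- x); rewrite oppr_ge0 sinN sqrrN => /(_ xn).
  by rewrite -opprD normrN.
have dsin (y : R) : is_derive y (1:R) (fun y => y - sin y) (1 - cos y).
  by apply: is_derive_eq.
have cs : {within `[0, x], continuous (fun y : R => y - sin y)}.
  by apply: derivable_within_continuous => y _; case: (dsin y).
have cc (y : R) : {within `[0, y], continuous (@cos R)}.
  by apply: continuous_subspaceT; exact: continuous_cos.
have [y yx E] := MVT_segment x0 (fun y _ => dsin y) cs.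
move: E; rewrite sin0 !subr0 => ->.
move: yx; rewrite in_itv/= => /andP[y0 yx].
have [w wy E] := MVT_segment y0 (fun y _ => is_derive_cos y) (cc y).
have {E} : 1 - cos y = sin w * y.
  by move: E; rewrite cos0 subr0 => /(congr1 -%R); rewrite opprB mulNr opprK.
move=> ->; rewrite !normrM (ger0_norm x0) (ger0_norm y0) expr2 ler_wpM2r//.
apply: le_trans yx; rewrite ler_piMl// sin_max//.
Qed.

(** L sin(x/L) is within x^2/L of x, so replacing both coordinates by such sines costs a small
    multiple of 1 + |z|^2. The new arguments lie in [-L, L], where a double Bernstein average is
    uniformly close to f and is a polynomial in sines. *)
Lemma trig_approximation f (M e : R) : continuous f -> (forall z, `|f z| <= M) ->
  0 < e -> exists2 h, trigpoly h &
    forall z, `|f z - h z| <= e * (1 + (z.1 ^+ 2 + z.2 ^+ 2)).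
Proof.
move=> cf fM e0.
have e40 : 0 < e / 4 by rewrite divr_gt0.
have [C C0 fC] := modulus_of_continuity cf fM e40.
(* Large enough for C/L <= e/4; the 1 keeps L positive when C = 0. *)
pose L := 1 + C / (e / 4).
have L0 : 0 < L by rewrite ltr_pwDl// divr_ge0// ltW.
have CL : C / L <= e / 4.
  by rewrite ler_pdivrMr// /L mulrDr mulr1 [e / 4 * _]mulrC divfK ?gt_eqF// lerDr ltW.
pose fL (z : R * R) := f (L * sin (L^-1 * z.1), L * sin (L^-1 * z.2)).
have LS (x : R) : `|x - L * sin (L^-1 * x)| <= x ^+ 2 / L.
  have -> : x - L * sin (L^-1 * x) = L * (L^-1 * x - sin (L^-1 * x)).
    by rewrite mulrBr mulrA mulfV ?mul1r// gt_eqF.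
  rewrite normrM (ger0_norm (ltW L0)).
  rewrite (_ : x ^+ 2 / L = L * (L^-1 * x) ^+ 2); last by field; rewrite gt_eqF.
  by rewrite ler_wpM2l ?dist_sin// ltW.
have h1 z : `|f z - fL z| <= e / 2 * (1 + (z.1 ^+ 2 + z.2 ^+ 2)).
  apply: le_trans (fC _ _) _ => /=.
  have q0 : 0 <= z.1 ^+ 2 + z.2 ^+ 2 by rewrite addr_ge0 ?sqr_ge0.
  have : C * (`|z.1 - L * sin (L^-1 * z.1)| + `|z.2 - L * sin (L^-1 * z.2)|) <=
      e / 4 * (z.1 ^+ 2 + z.2 ^+ 2).
    apply: (@le_trans _ _ (C / L * (z.1 ^+ 2 + z.2 ^+ 2))).
      rewrite -[leRHS]mulrA; apply: ler_wpM2l => //.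
      have -> : L^-1 * (z.1 ^+ 2 + z.2 ^+ 2) = z.1 ^+ 2 / L + z.2 ^+ 2 / L by ring.
      exact: lerD.
    by rewrite ler_wpM2r.
  by move: q0; lra.
(* The sines have values in the square of half-side L, where 1 + |z|^2 <= 1 + 2 L^2: the weighted
   error there is at most e/4. *)
pose e' := e / 4 / (1 + (L ^+ 2 + L ^+ 2)).
have D0 : 0 < 1 + (L ^+ 2 + L ^+ 2) by rewrite ltr_pwDl// addr_ge0 ?sqr_ge0.
have e'0 : 0 < e' by rewrite divr_gt0.
have [C' C'0 fC'] := modulus_of_continuity cf fM e'0.
pose K := C' * (L * 2) + 1.
have K0 : 0 < K by rewrite ltr_wpDl// mulr_ge0// mulr_ge0// ltW.
(* Each Bernstein average will be within 2d of its argument, and K (d + d) = e/8; the two variables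
   thus cost e/4. The 1 in K makes it positive. *)
pose d := e / 4 / (4 * K).
have d0 : 0 < d by rewrite divr_gt0// mulr_gt0.
have [N N0 dN] : exists2 N : nat, (0 < N)%N & (d * N%:R)^-1 <= d.
  exists (Num.truncn (d ^- 2)).+1 => //.
  have : d ^- 2 < (Num.truncn (d ^- 2)).+1%:R by exact: truncnS_gt.
  move: (_.+1%:R) => m dm.
  have m0 : 0 < m by rewrite (le_lt_trans _ dm)// invr_ge0 exprn_ge0// ltW.
  have d2 : 0 < d ^+ 2 by rewrite exprn_gt0.
  have dm0 : 0 < d * m by rewrite mulr_gt0.
  rewrite -(ler_pM2r dm0) mulVf ?gt_eqF// mulrA -expr2.
  by rewrite -(@mulfV _ (d ^+ 2)) ?gt_eqF// ler_pM2l// ltW.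
(* Sample points of [-L, L], matching sin(x/L) = 2p - 1 for p = (1 + sin(x/L))/2. *)
pose node (k : nat) : R := L * (2 * (k%:R / N%:R) - 1).
pose h (z : R * R) := bern N (fun k => bern N (fun l => f (node k, node l))
   (half_sin L^-1 z.2)) (half_sin L^-1 z.1).
exists h.
  have mul_fst g : trigpoly g -> trigpoly (fun z => half_sin L^-1 z.1 * g z).
    move=> tg; have := trigpolyZ 2^-1 (trigpolyD tg (trigpoly_sin_fst L^-1 tg)).
    by congr (trigpoly _); apply/funext => z; rewrite /half_sin; field.
  have mul_snd g : trigpoly g -> trigpoly (fun z => half_sin L^-1 z.2 * g z).
    move=> tg; have := trigpolyZ 2^-1 (trigpolyD tg (trigpoly_sin_snd L^-1 tg)).
    by congr (trigpoly _); apply/funext => z; rewrite /half_sin; field.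
  apply: (trigpoly_bern N (p := fun z => half_sin L^-1 z.1)
    (g := fun k z => bern N (fun l => f (node k, node l)) (half_sin L^-1 z.2))) => // k.
  apply: (trigpoly_bern N (p := fun z => half_sin L^-1 z.2)
    (g := fun l z => f (node k, node l))) => // l.
  exact: trigpoly_cst.
move=> z.
have h2 : `|fL z - h z| <= e / 2.
  set p := half_sin L^-1 z.1; set q := half_sin L^-1 z.2.
  have p01 : 0 <= p <= 1 by exact: half_sin01.
  have q01 : 0 <= q <= 1 by exact: half_sin01.
  have xp : L * sin (L^-1 * z.1) = L * (2 * p - 1) by rewrite /p /half_sin; field.
  have yq : L * sin (L^-1 * z.2) = L * (2 * q - 1) by rewrite /q /half_sin; field.
  pose B k l : R := `|fL z - f (node k, node l)|.
  have le1 : `|fL z - h z| <= bern N (fun k => bern N (B k) q) p.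
    rewrite /h -/p -/q -[X in `|X - _|](bern_cst N _ p) -mulN1r -bernZ -bernD.
    apply: le_trans (bern_norm _ _ p01) _; apply: bern_le => // k.
    rewrite -[X in `|X + _|](bern_cst N _ q) -bernZ -bernD.
    apply: le_trans (bern_norm _ _ q01) _; apply: bern_le => // l.
    by rewrite mulN1r.
  apply: le_trans le1 _.
  have bB k l : B k l <= e / 4 + (C' * (L * 2)) * `|p - k%:R / N%:R| +
      (C' * (L * 2)) * `|q - l%:R / N%:R|.
    apply: le_trans (fC' _ _) _; rewrite xp yq -addrA /=; apply: lerD.
      have -> : e / 4 = e' * (1 + (L ^+ 2 + L ^+ 2)) by rewrite divfK// gt_eqF.
      rewrite ler_wpM2l ?(ltW e'0)//.
      have bd (s : R) : 0 <= s <= 1 -> (L * (2 * s - 1)) ^+ 2 <= L ^+ 2.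
        move=> /andP[s0 s1]; rewrite exprMn ler_piMr ?sqr_ge0//.
        by have := mulr_ge0 s0 (_ : 0 <= 1 - s); rewrite subr_ge0 => /(_ s1); nra.
      by rewrite lerD2l lerD// bd.
    have nd (s t : R) : `|L * (2 * s - 1) - L * (2 * t - 1)| = L * 2 * `|s - t|.
      rewrite -mulrBr (_ : 2 * s - 1 - (2 * t - 1) = 2 * (s - t)); last by ring.
      by rewrite !normrM (ger0_norm (ltW L0)) ger0_norm// mulrA.
    by rewrite !nd mulrDr !mulrA.
  apply: le_trans (bern_le N p01 (fun k => bern_le N q01 (bB k))) _.
  have -> : (fun k => bern N (fun l => e / 4 + C' * (L * 2) * `|p - k%:R / N%:R| +
       C' * (L * 2) * `|q - l%:R / N%:R|) q) = (fun k => e / 4 + C' * (L * 2) * `|p - k%:R / N%:R| +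
       C' * (L * 2) * bern N (fun l => `|q - l%:R / N%:R|) q).
    by apply/funext => k; rewrite bernD bern_cst bernZ.
  rewrite !bernD !bern_cst bernZ.
  have b1 := le_trans (bern_dist d0 N0 p01) (lerD (lexx d) dN).
  have b2 := le_trans (bern_dist d0 N0 q01) (lerD (lexx d) dN).
  have CK : C' * (L * 2) <= K by rewrite /K lerDl.
  have C20 : 0 <= C' * (L * 2) by rewrite mulr_ge0// mulr_ge0// ltW.
  have Kd : K * (d + d) = e / 4 / 2 by rewrite /d; field; rewrite gt_eqF.
  have key (b : R) : b <= d + d -> C' * (L * 2) * b <= e / 4 / 2.
    move=> bd; rewrite -Kd; apply: (@le_trans _ _ (C' * (L * 2) * (d + d))).
      by rewrite ler_wpM2l.
    by rewrite ler_wpM2r// addr_ge0// ltW.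
  by have := key _ b1; have := key _ b2; lra.
rewrite -(subrKA (fL z)); apply: le_trans (ler_normD _ _) _.
have q0 : 0 <= e * (z.1 ^+ 2 + z.2 ^+ 2) by rewrite mulr_ge0 ?(ltW e0)// addr_ge0 ?sqr_ge0.
by have := h1 z; move: q0 h2; lra.
Qed.

End trigonometric_approximation.

(** * Weak convergence from characteristic functions and second moments *)

Section levy_continuity.
Context {R : realType}.
Local Notation sq z := ((z.1 : R) ^+ 2 + (z.2 : R) ^+ 2).

Lemma measurable_trigpoly (h : plane R -> R) : trigpoly h -> measurable_fun setT h.
Proof.
elim=> [al be c|f g _ mf _ mg|k f _ mf]; last 2 first.
- exact: measurable_funD.
- exact: measurable_funM.
apply: measurableT_comp.
  by apply: continuous_measurable_fun; exact: continuous_cos.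
by apply: measurable_funD => //; apply: measurable_funD; apply: measurable_funM.
Qed.

Lemma trigpoly_bounded (h : R * R -> R) : trigpoly h -> exists K, forall z, `|h z| <= K.
Proof.
elim=> [al be c|f g _ [K fK] _ [L gL]|k f _ [K fK]].
- by exists 1 => z; exact: cos_max.
- by exists (K + L) => z; apply: le_trans (ler_normD _ _) _; exact: lerD.
- by exists (`|k| * K) => z; rewrite normrM ler_wpM2l.
Qed.

(** Measurability for the product sigma-algebra: f is the pointwise limit of trigonometric
    polynomials with error (1 + |z|^2)/(n + 1). *)
Lemma continuous_bounded_measurable (f : plane R -> R) (M : R) :
  continuous (f : R * R -> R) -> (forall z, `|f z| <= M) -> measurable_fun setT f.
Proof.
move=> cf fM.
have e0 n : 0 < (n.+1%:R)^-1 :> R by rewrite invr_gt0.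
have /choice[h hh] : forall n, exists h : R * R -> R, trigpoly h /\
    forall z, `|f z - h z| <= (n.+1%:R)^-1 * (1 + sq z).
  by move=> n; have [h th fh] := trig_approximation cf fM (e0 n); exists h.
apply: (@measurable_fun_cvg _ (plane R) R setT h f).
  by move=> n; apply: measurable_trigpoly; have [] := hh n.
move=> z _; apply/subr_cvg0; apply: norm_cvg0.
apply: (@squeeze_cvgr _ _ _ _ (cst 0) (fun n => harmonic n * (1 + sq z))).
- by apply: nearW => n /=; rewrite normr_ge0/= distrC; have [_] := hh n.
- exact: cvg_cst.
- by rewrite -[X in _ --> X](mul0r (1 + sq z)); apply: cvgMl; exact: cvg_harmonic.
Qed.

Lemma bounded_integrable (mu : probability (plane R) R) (f : plane R -> R) (M : R) :
  measurable_fun setT f -> (forall z, `|f z| <= M) -> mu.-integrable setT (EFin \o f).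
Proof.
move=> mf fM; have M0 : 0 <= M by exact: le_trans (fM (0, 0)).
apply: (le_integrable measurableT (g := cst M%:E)).
- exact/measurable_EFinP.
- by move=> z _; rewrite /= lee_fin (ger0_norm M0).
- exact: finite_measure_integrable_cst.
Qed.

Lemma integral_second_moment (mu : probability (plane R) R) (f h : plane R -> R)
    (M K m e : R) : 0 <= e ->
  measurable_fun setT f -> (forall z, `|f z| <= M) ->
  measurable_fun setT h -> (forall z, `|h z| <= K) ->
  (forall z, `|f z - h z| <= e * (1 + sq z)) ->
  (\int[mu]_z (sq z)%:E <= m%:E)%E ->
  `|\int[mu]_z f z - \int[mu]_z h z| <= e * (1 + m).
Proof.
move=> e0 mf fM mh hK fh moment.
have if_ := bounded_integrable mu mf fM; have ih := bounded_integrable mu mh hK.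
have msq : measurable_fun setT (fun z : plane R => sq z).
  by apply: measurable_funD; apply: measurable_funX.
have isq : mu.-integrable setT (EFin \o (fun z : plane R => sq z)).
  apply/integrableP; split; first exact/measurable_EFinP.
  under eq_integral do rewrite /= ger0_norm ?addr_ge0 ?sqr_ge0//.
  exact: le_lt_trans moment (ltry _).
have i1 : mu.-integrable setT (EFin \o (fun=> 1 : R)).
  exact: (finite_measure_integrable_cst mu 1).
have id : mu.-integrable setT (EFin \o (fun z => f z - h z)).
  exact: (integrableB measurableT if_ ih).
have i1sq : mu.-integrable setT (EFin \o (fun z : plane R => 1 + sq z)).
  exact: (integrableD measurableT i1 isq).
rewrite -RintegralB//; apply: le_trans (le_normr_Rintegral _ id) _ => //.
apply: (@le_trans _ _ (\int[mu]_z (e * (1 + sq z)))).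
  apply: le_Rintegral => //; first exact: (integrable_abse id).
  exact: (integrableZl measurableT e i1sq).
rewrite RintegralZl// ler_wpM2l// RintegralD// lerD//.
  by rewrite Rintegral_cst// [X in fine X](@probability_setT _ _ _ mu) mul1r.
rewrite -lee_fin /Rintegral fineK//.
exact: integrable_fin_num isq.
Qed.

Variables (nu : nat -> probability (plane R) R) (nu0 : probability (plane R) R).
Variable m : R.
Hypothesis cvg_cos : forall al be c,
  \int[nu n]_z cos (al * z.1 + be * z.2 + c) @[n --> \oo] -->
  \int[nu0]_z cos (al * z.1 + be * z.2 + c).
Hypothesis moment : \forall n \near \oo, (\int[nu n]_z (sq z)%:E <= m%:E)%E.
Hypothesis moment0 : (\int[nu0]_z (sq z)%:E <= m%:E)%E.

Lemma cvg_trigpoly (h : R * R -> R) : trigpoly h ->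
  \int[nu n]_z h z @[n --> \oo] --> \int[nu0]_z h z.
Proof.
have int (mu : probability (plane R) R) g : trigpoly g -> mu.-integrable setT (EFin \o g).
  move=> tg; have [K gK] := trigpoly_bounded tg.
  exact: (bounded_integrable mu (measurable_trigpoly tg) gK).
elim=> [al be c|f g tf hf tg hg|k f tf hf]; first exact: cvg_cos.
- rewrite RintegralD//; try exact: int.
  rewrite (_ : (fun n => _) = (fun n => \int[nu n]_z f z + \int[nu n]_z g z)).
    exact: cvgD.
  by apply/funext => n; rewrite RintegralD//; exact: int.
- rewrite RintegralZl//; last exact: int.
  rewrite (_ : (fun n => _) = (fun n => k * \int[nu n]_z f z)).
    by apply: cvgM => //; exact: cvg_cst.
  by apply/funext => n; rewrite RintegralZl//; exact: int.
Qed.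

Lemma levy_continuity (f : R * R -> R) (M : R) : continuous f ->
  (forall z, `|f z| <= M) ->
  \int[nu n]_z f z @[n --> \oo] --> \int[nu0]_z f z.
Proof.
move=> cf fM.
have mf : measurable_fun setT (f : plane R -> R).
  exact: continuous_bounded_measurable cf fM.
have m0 : 0 <= m.
  rewrite -lee_fin; apply: le_trans moment0; apply: integral_ge0 => z _.
  by rewrite lee_fin addr_ge0 ?sqr_ge0.
apply/cvgrPdist_le => e e0.
(* The mean of d (1 + |z|^2) is at most d (1 + m) = e/3 under both laws; the last third is for the
   polynomial. *)
pose d := e / 3 / (1 + m).
have d0 : 0 < d by rewrite !divr_gt0// ltr_wpDr.
have de : d * (1 + m) = e / 3 by rewrite divfK// gt_eqF// ltr_wpDr.
have [h th fh] := trig_approximation cf fM d0.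
have [K hK] := trigpoly_bounded th.
have mh := measurable_trigpoly th.
have e30 : 0 < e / 3 by rewrite divr_gt0.
have /cvgrPdist_le/(_ _ e30) hcvg := cvg_trigpoly th.
have b0 := integral_second_moment (ltW d0) mf fM mh hK fh moment0.
near=> n.
have mn : (\int[nu n]_z (sq z)%:E <= m%:E)%E by near: n.
have bn := integral_second_moment (ltW d0) mf fM mh hK fh mn.
have hn : `|\int[nu0]_z h z - \int[nu n]_z h z| <= e / 3 by near: n.
move: b0 bn hn; rewrite de !ler_norml => /andP[? ?] /andP[? ?] /andP[? ?].
by apply/andP; split; lra.
Unshelve. all: by end_near. Qed.

End levy_continuity.

(** * Hermitian parts and the operator norm *)

Lemma mxtrace_lincomb_sqr (F : comNzRingType) n (k c d : F) (A B : 'M[F]_n) :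
  \tr ((k *: (c *: A + d *: B)) *m (k *: (c *: A + d *: B))) =
  k ^+ 2 * (c ^+ 2 * \tr (A *m A) + d ^+ 2 * \tr (B *m B) +
    c * d * \tr (B *m A) *+ 2).
Proof.
rewrite -scalemxAl -scalemxAr !mulmxDl !mulmxDr -!scalemxAl -!scalemxAr.
by rewrite !(mxtraceZ, mxtraceD) (mxtrace_mulC A B); ring.
Qed.

Section operator_norm.
Context {R : realType}.
Local Notation C := R[i].

Definition vsq n (x : 'cV[C]_n) : R := complex.Re (cdot x x).

Lemma vsq_ge0 n (x : 'cV[C]_n) : 0 <= vsq x.
Proof.
by rewrite /vsq Re_cdotxx sumr_ge0// => i _; rewrite addr_ge0 ?sqr_ge0.
Qed.

Lemma vsqZ n (k : C) (x : 'cV[C]_n) :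
  vsq (k *: x) = (complex.Re k ^+ 2 + complex.Im k ^+ 2) * vsq x.
Proof.
rewrite /vsq !Re_cdotxx mulr_sumr; apply: eq_bigr => i _; rewrite mxE.
by case: k (x i 0) => a b [c d] /=; ring.
Qed.

Lemma vsq_eq0 n (x : 'cV[C]_n) : vsq x = 0 -> x = 0.
Proof.
rewrite /vsq Re_cdotxx => /eqP; rewrite psumr_eq0 => [/allP h|i _]; last first.
  by rewrite addr_ge0 ?sqr_ge0.
apply/matrixP => i j; rewrite ord1 mxE; have := h i; rewrite mem_index_enum => /(_ isT).
by rewrite paddr_eq0 ?sqr_ge0// !sqrf_eq0; case: (x i 0) => a b /= /andP[/eqP -> /eqP ->].
Qed.

Lemma vsqD n (x y : 'cV[C]_n) : vsq (x + y) = vsq x + vsq y + 2 * complex.Re (cdot x y).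
Proof.
rewrite /vsq cdotDl !cdotDr [cdot y x]cdotC !raddfD /=.
by case: (cdot x y) => a b /=; ring.
Qed.

Lemma vsqD_le n (x y : 'cV[C]_n) : vsq (x + y) <= 2 * (vsq x + vsq y).
Proof.
have := vsq_ge0 (x + (-1)%:C *: y); rewrite !vsqD vsqZ cdotZr /= expr0n/= addr0.
have -> : complex.Re (conjc (-1)%:C * cdot x y) = - complex.Re (cdot x y).
  by case: (cdot _ _) => p q /=; ring.
by rewrite sqrrN expr1n mul1r; lra.
Qed.

Lemma l2norm_vsq n (x : 'cV[C]_n) : l2norm x ^+ 2 = vsq x.
Proof. by rewrite /l2norm sqr_sqrtr// vsq_ge0. Qed.

(** Boundedness is what makes the [sup] in [opnorm] an upper bound. A crude one from absolute row
    sums is enough; each S i occurs twice, for the real and the imaginary part. *)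
Lemma l2norm_opnorm_ubound n (A : 'M[C]_n) :
  has_ubound [set l2norm (A *m x) | x in [set x : 'cV[C]_n | l2norm x = 1]].
Proof.
pose S (i : 'I_n) : R := \sum_j (`|complex.Re (A i j)| + `|complex.Im (A i j)|).
exists (Num.sqrt (\sum_i (S i ^+ 2 + S i ^+ 2))) => _ [x x1 <-].
have vx : vsq x = 1 by rewrite -l2norm_vsq x1 expr1n.
have xj j : `|complex.Re (x j 0)| <= 1 /\ `|complex.Im (x j 0)| <= 1.
  have h : complex.Re (x j 0) ^+ 2 + complex.Im (x j 0) ^+ 2 <= 1.
    rewrite -vx /vsq Re_cdotxx (bigD1 j)//= lerDl sumr_ge0// => i _.
    by rewrite addr_ge0 ?sqr_ge0.
  have s1 (u : R) : u ^+ 2 <= 1 -> `|u| <= 1.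
    by rewrite -real_normK ?num_real// expr_le1.
  by split; apply: s1; apply: le_trans h; rewrite ?lerDl ?lerDr sqr_ge0.
have S0 i : 0 <= S i by apply: sumr_ge0 => j _; rewrite addr_ge0.
rewrite /l2norm ler_sqrt; last by apply: sumr_ge0 => i _; rewrite addr_ge0 ?sqr_ge0.
rewrite -/(vsq _) /vsq Re_cdotxx; apply: ler_sum => i _.
have sq (u : R) : `|u| <= S i -> u ^+ 2 <= S i ^+ 2.
  by move=> uS; rewrite -real_normK ?num_real// lerXn2r ?nnegrE.
have bb (p q u v : R) : `|u| <= 1 -> `|v| <= 1 -> `|p * u + q * v| <= `|p| + `|q|.
  move=> u1 v1; apply: le_trans (ler_normD _ _) _; rewrite !normrM.
  by rewrite lerD// ler_piMr.
apply: lerD; apply: sq; rewrite mxE raddf_sum /=; apply: le_trans (ler_norm_sum _ _ _) _;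
  apply: ler_sum => j _; have [] := xj j; case: (A i j) (x j 0) => p q [u v] /= u1 v1.
- by rewrite -mulrN; apply: bb => //; rewrite normrN.
- exact: bb.
Qed.

Lemma vsq_opnorm n (A : 'M[C]_n) (x : 'cV[C]_n) :
  vsq (A *m x) <= opnorm A ^+ 2 * vsq x.
Proof.
have [/eqP x0|x0] := boolP (vsq x == 0).
  by rewrite x0 (vsq_eq0 x0) mulmx0 /vsq Re_cdotxx mulr0 big1// => i _; rewrite mxE/= expr0n addr0.
have vx : 0 < vsq x by rewrite lt_neqAle eq_sym x0 vsq_ge0.
pose k : C := ((Num.sqrt (vsq x))^-1)%:C.
have k2 : complex.Re k ^+ 2 + complex.Im k ^+ 2 = (vsq x)^-1.
  by rewrite /= expr0n addr0 exprVn sqr_sqrtr// ltW.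
have y1 : l2norm (k *: x) = 1.
  by rewrite /l2norm -/(vsq _) vsqZ k2 mulVf ?gt_eqF// sqrtr1.
have : l2norm (A *m (k *: x)) <= opnorm A.
  by apply: ub_le_sup; [exact: l2norm_opnorm_ubound|exists (k *: x)].
move=> h; have o0 : 0 <= opnorm A by apply: le_trans h; rewrite sqrtr_ge0.
have : vsq (A *m (k *: x)) <= opnorm A ^+ 2.
  by rewrite -l2norm_vsq lerXn2r ?nnegrE// sqrtr_ge0.
by rewrite -scalemxAr vsqZ k2 mulrC ler_pdivrMr.
Qed.

Lemma opnorm_ge0 n (A : 'M[C]_n) : (0 < n)%N -> 0 <= opnorm A.
Proof.
move=> n0; pose x : 'cV[C]_n := delta_mx (Ordinal n0) 0.
have x1 : l2norm x = 1.
  by rewrite /l2norm cdot_delta mxE !eqxx sqrtr1.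
have : l2norm (A *m x) <= opnorm A.
  by apply: ub_le_sup; [exact: l2norm_opnorm_ubound|exists x].
by apply: le_trans; rewrite sqrtr_ge0.
Qed.

(* Since |A* x|^2 = <A A* x, x>, an upper bound for A is one for its adjoint. *)
Lemma vsq_adj n (A : 'M[C]_n) (K : R) : 0 < K ->
  (forall x, vsq (A *m x) <= K ^+ 2 * vsq x) ->
  forall x, vsq (adjmx A *m x) <= K ^+ 2 * vsq x.
Proof.
move=> K0 hA x; set y := adjmx A *m x.
have E : complex.Re (cdot (A *m y) x) = vsq y by rewrite cdot_adj.
(* Expanding |K^(-1) A y - K x|^2 >= 0 gives 2 |y|^2 <= K^(-2) |A y|^2 + K^2 |x|^2, whose first term
   is at most |y|^2. *)
have := vsq_ge0 ((K^-1)%:C *: (A *m y) + (- K)%:C *: x).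
rewrite vsqD !vsqZ /= !expr0n/= !addr0 cdotZl cdotZr.
have -> : complex.Re ((K^-1)%:C * (conjc (- K)%:C * cdot (A *m y) x)) = - vsq y.
  rewrite -E; case: (cdot _ x) => u v /=.
  by field; rewrite gt_eqF.
have h : K^-1 ^+ 2 * vsq (A *m y) <= vsq y.
  by rewrite exprVn ler_pdivrMl ?exprn_gt0.
by rewrite sqrrN; move: h; lra.
Qed.

(** The squared Frobenius norm, additive over columns. *)
Definition fro n (X : 'M[C]_n) : R := complex.Re (\tr (adjmx X *m X)).

Lemma froE n (X : 'M[C]_n) : fro X = \sum_j vsq (col j X).
Proof.
rewrite /fro raddf_sum /=; apply: eq_bigr => j _.
rewrite mxE /vsq cdotE; congr complex.Re; apply: eq_bigr => i _.
by rewrite adjmxE !mxE.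
Qed.

Lemma fro_mul n (A X : 'M[C]_n) K : (forall x, vsq (A *m x) <= K * vsq x) ->
  fro (A *m X) <= K * fro X.
Proof.
move=> hA; rewrite !froE mulr_sumr; apply: ler_sum => j _.
by rewrite colE -mulmxA -colE.
Qed.

(** The Hermitian part of c A, whose quadratic form is Re(c <A x, x>). For c = al - i be this is al
    Re <A x, x> + be Im <A x, x>. *)
Definition herm n (c : C) (A : 'M[C]_n) : 'M[C]_n :=
  (2^-1 : R)%:C *: (c *: A + conjc c *: adjmx A).

Lemma adjmx_herm n c (A : 'M[C]_n) : adjmx (herm c A) = herm c A.
Proof.
rewrite /herm adjmxZ adjmxD !adjmxZ adjmxK conjcK addrC; congr (_ *: _).
by rewrite /= oppr0.
Qed.

Lemma vsq_herm n c (A : 'M[C]_n) (K : R) : 0 < K ->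
  (forall x, vsq (A *m x) <= K ^+ 2 * vsq x) ->
  forall x, vsq (herm c A *m x) <= (complex.Re c ^+ 2 + complex.Im c ^+ 2) * K ^+ 2 * vsq x.
Proof.
move=> K0 hA x.
have c0 : 0 <= complex.Re c ^+ 2 + complex.Im c ^+ 2 by rewrite addr_ge0 ?sqr_ge0.
have cc : complex.Re (conjc c) ^+ 2 + complex.Im (conjc c) ^+ 2 =
    complex.Re c ^+ 2 + complex.Im c ^+ 2.
  by case: c {c0} => p q /=; rewrite sqrrN.
rewrite /herm -scalemxAl vsqZ mulmxDl -!scalemxAl /= expr0n/= addr0.
have hu := ler_wpM2l c0 (hA x).
have hv := ler_wpM2l c0 (vsq_adj K0 hA x).
have := vsqD_le (c *: (A *m x)) (conjc c *: (adjmx A *m x)).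
rewrite !vsqZ cc; move: hu hv; rewrite !mulrA.
by rewrite exprVn; lra.
Qed.

Lemma tr_herm_sqr n c (A : 'M[C]_n) :
  complex.Re (\tr (herm c A *m herm c A)) =
  2^-1 * (complex.Re (c ^+ 2 * \tr (A *m A)) +
    (complex.Re c ^+ 2 + complex.Im c ^+ 2) * complex.Re (\tr (adjmx A *m A))).
Proof.
have E1 : \tr (adjmx A *m adjmx A) = conjc (\tr (A *m A)).
  by rewrite -adjmxM /mxtrace rmorph_sum; apply: eq_bigr => i _; rewrite adjmxE.
rewrite /herm mxtrace_lincomb_sqr E1.
have : complex.Im (\tr (adjmx A *m A)) = 0.
  rewrite /mxtrace raddf_sum big1// => i _.
  by apply: hermitian_diag; rewrite adjmxM adjmxK.
case: (\tr (A *m A)) (\tr (adjmx A *m A)) c => p q [s t] [u v] /= ->.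
by field.
Qed.

Lemma tr_herm n c (A : 'M[C]_n) : \tr A = 0 -> complex.Re (\tr (herm c A)) = 0.
Proof.
move=> trA; have E1 : \tr (adjmx A) = conjc (\tr A).
  by rewrite /mxtrace rmorph_sum; apply: eq_bigr => i _; rewrite adjmxE.
by rewrite /herm !(mxtraceZ, mxtraceD) E1 trA conjc0 !mulr0 addr0 mulr0.
Qed.

(** For H Hermitian, Tr H^4 is the squared Frobenius norm of H H, and the left factor H acts on each
    column with norm at most |c| K. *)
Lemma tr_herm_four n c (A : 'M[C]_n) (K : R) : 0 < K ->
  (forall x, vsq (A *m x) <= K ^+ 2 * vsq x) ->
  complex.Re (\tr (herm c A *m herm c A *m (herm c A *m herm c A))) <=
  (complex.Re c ^+ 2 + complex.Im c ^+ 2) * K ^+ 2 *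
  complex.Re (\tr (herm c A *m herm c A)).
Proof.
move=> K0 hA.
have := fro_mul (herm c A) (vsq_herm c K0 hA).
by rewrite /fro adjmxM adjmx_herm.
Qed.

Lemma numerical_fun_qform n (A : 'M[C]_n) t (al be : R) :
  al * (numerical_fun A t).1 + be * (numerical_fun A t).2 =
  qform (herm (al -i* be) A) t.
Proof.
rewrite /numerical_fun /= /qform /herm -scalemxAl cdotZl mulmxDl -!scalemxAl cdotDl !cdotZl.
rewrite [cdot (adjmx A *m _) _]cdot_adj adjmxK [cdot (cvec t) _]cdotC.
by case: (cdot _ _) => p q /=; field.
Qed.

End operator_norm.

(** * Convergence of the numerical measures *)

Section tuple_gauss_probability.
Context {R : realType} (n : nat).

Definition tuple_gauss : set (n.-tuple (plane R)) -> \bar R :=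
  @tuple_measure _ _ R (plane_gauss hs hs) n.

HB.instance Definition _ := Measure.on tuple_gauss.

HB.instance Definition _ :=
  Measure_isProbability.Build _ _ _ tuple_gauss (tuple_gauss_setT n).

End tuple_gauss_probability.

Section push.
Context {R : realType} (n : nat).
Local Notation Cn := (n.-tuple (plane R)).
Local Notation pg := (pgrowth (@sqnorm R n)).

Lemma bounded_pgrowth (h : Cn -> R) (M : R) : measurable_fun setT h ->
  (forall t, `|h t| <= M) -> pg h.
Proof.
move=> mh hM; split=> //; exists `|M|, 0%N; split=> // t.
by rewrite expr0 mulr1 (le_trans (hM t))// ler_norm.
Qed.

Lemma integral_distribution_numerical (A : 'M[R[i]]_n) (f : plane R -> R) :
  measurable_fun setT f -> pg (fun t => f (numerical_fun A t)) ->
  (\int[distribution (@tuple_gauss R n) (numerical_fun A)]_z (f z)%:E =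
   (gmean (fun t => f (numerical_fun A t)))%:E)%E.
Proof.
move=> mf pf; rewrite -EFin_gmean//.
apply: (@integral_distribution _ _ _ _ R (@tuple_gauss R n) (numerical_fun A) (EFin \o f)).
  exact/measurable_EFinP.
exact: (pgrowth_integrable pf).
Qed.

Lemma integral_numerical_measure (A : 'M[R[i]]_n) (f : plane R -> R) (M : R) : (0 < n)%N ->
  measurable_fun setT f -> (forall z, `|f z| <= M) ->
  (\int[numerical_measure A]_z (f z)%:E =
   (gmean (fun t => f (numerical_fun A (radial_proj t))))%:E)%E.
Proof.
move=> n0 mf fM.
have mfn : measurable_fun setT (fun t : Cn => f (numerical_fun A t)).
  by apply: measurableT_comp => //; exact: measurable_numerical_fun.
have mfp : measurable_fun setT (fun t : Cn => f (numerical_fun A (radial_proj t))).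
  by apply: (measurableT_comp mfn); exact: measurable_radial_proj.
have M0 : 0 <= M by exact: le_trans (fM (0, 0)).
have mfE : measurable_fun setT (EFin \o f) by exact/measurable_EFinP.
have int : (sphere_uniform n).-integrable setT ((EFin \o f) \o numerical_fun A).
  apply: (le_integrable measurableT (g := cst M%:E)).
  - by apply/measurable_EFinP; exact: mfn.
  - by move=> t _; rewrite /= lee_fin (ger0_norm M0).
  - exact: finite_measure_integrable_cst.
rewrite [LHS](@integral_distribution _ _ _ _ R (sphere_uniform n) (numerical_fun A) (EFin \o f) mfE int).
have [nu nuE] := pushforward_measureP (@tuple_gauss R n) (@measurable_radial_proj R n).
rewrite (eq_measure_integral nu); last first.
  move=> E mE _; apply: etrans (sphere_uniform_gauss n0 mE) _.
  exact: (congr1 (fun m => m E) nuE).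
rewrite -(congr1 (fun m => \int[m]_t ((EFin \o f) \o numerical_fun A) t)%E nuE).
have pf := bounded_pgrowth mfp (fun t => fM _).
rewrite (integral_pushforward (@measurable_radial_proj R n)).
- by rewrite preimage_setT -EFin_gmean.
- by apply/measurable_EFinP; exact: mfn.
- by rewrite preimage_setT; exact: (pgrowth_integrable pf).
- exact: measurableT.
Qed.

End push.

Section gaussian_measure_product.
Context {R : realType} (a b : R).
Hypothesis ab : 0 <= b < a.

Let amb : 0 < a - b. Proof. by move: ab => /andP[_]; rewrite subr_gt0. Qed.
Let apb : 0 < a + b. Proof. by move: ab => /andP[b0 ba]; rewrite ltr_wpDr// (le_lt_trans b0). Qed.

(** Standard deviations of the two coordinates of the limit: 2 sd1^2 = a + b and 2 sd2^2 = a - b. *)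
Definition sd1 : R := Num.sqrt ((a + b) / 2).
Definition sd2 : R := Num.sqrt ((a - b) / 2).

Lemma sd1_sqr : sd1 ^+ 2 = (a + b) / 2. Proof. by rewrite sqr_sqrtr// divr_ge0// ltW. Qed.
Lemma sd2_sqr : sd2 ^+ 2 = (a - b) / 2. Proof. by rewrite sqr_sqrtr// divr_ge0// ltW. Qed.
Lemma sd1_neq0 : sd1 != 0. Proof. by rewrite gt_eqF// sqrtr_gt0 divr_gt0. Qed.
Lemma sd2_neq0 : sd2 != 0. Proof. by rewrite gt_eqF// sqrtr_gt0 divr_gt0. Qed.

Lemma gaussian_density_plane_pdf z : gaussian_density a b z = plane_pdf sd1 sd2 z.
Proof.
rewrite /plane_pdf !normal_pdfE ?sd1_neq0 ?sd2_neq0//.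
rewrite /normal_peak /normal_fun !subr0 sd1_sqr sd2_sqr.
rewrite mulrACA -expRD -invfM /gaussian_density; congr (_ ^-1 * expR _); last first.
  by field; rewrite !gt_eqF.
rewrite -sqrtrM; last by rewrite mulrn_wge0// mulr_ge0 ?pi_ge0// divr_ge0// ltW.
have -> : ((a + b) / 2 * pi *+ 2) * ((a - b) / 2 * pi *+ 2) = pi ^+ 2 * (a ^+ 2 - b ^+ 2) :> R by field.
by rewrite sqrtrM ?sqr_ge0// sqrtr_sqr ger0_norm ?pi_ge0.
Qed.

Lemma gaussian_measure_plane_gauss E : measurable E ->
  gaussian_measure a b E = plane_gauss sd1 sd2 E.
Proof.
move=> mE; transitivity (\int[plane_gauss sd1 sd2]_z (\1_E z : R)%:E)%E; last first.
  by rewrite (@integral_indic _ _ _ (plane_gauss sd1 sd2) setT measurableT E mE) setIT.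
have m1 : measurable_fun setT (fun z : plane R => (\1_E z : R)%:E).
  by apply/measurable_EFinP; exact: measurable_indic.
rewrite ge0_integral_plane_gauss//.
rewrite /gaussian_measure integral_mkcond; apply: eq_integral => z _.
by rewrite epatch_indic gaussian_density_plane_pdf muleC.
Qed.

Lemma integral_gaussian_measure (f : plane R -> \bar R) :
  (\int[gaussian_measure a b]_z f z = \int[plane_gauss sd1 sd2]_z f z)%E.
Proof.
by apply: eq_measure_integral => E mE _; exact: gaussian_measure_plane_gauss.
Qed.

End gaussian_measure_product.

Section plane_gauss_moment.
Context {R : realType}.

Lemma normal_second_moment (s : R) : s != 0 ->
  (\int[normal_prob 0 s]_x (x ^+ 2)%:E < +oo)%E.
Proof.
move=> s0; have : (normal_prob 0 s).-integrable setT (EFin \o (fun x : R => x ^+ 2)).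
  apply: (normal_growth_integrable s0 (C := s ^+ 2 *+ 4)); first exact: measurable_funX.
  move=> x; rewrite ger0_norm ?sqr_ge0//.
  have s4 : 0 < s ^+ 2 *+ 4 by rewrite pmulrn_lgt0// exprn_even_gt0.
  rewrite mulrC -ler_pdivrMr//; apply: le_trans (expR_ge1Dx _).
  by rewrite lerDr.
by move=> /integrableP[_]; under eq_integral do rewrite /= ger0_norm ?sqr_ge0//.
Qed.

Lemma plane_gauss_second_moment (s1 s2 : R) : s1 != 0 -> s2 != 0 ->
  (\int[plane_gauss s1 s2]_z ((z.1 : R) ^+ 2 + (z.2 : R) ^+ 2)%:E < +oo)%E.
Proof.
move=> s10 s20.
have mf : measurable_fun setT (fun z : plane R => ((z.1 : R) ^+ 2 + (z.2 : R) ^+ 2)%:E).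
  apply/measurable_EFinP; apply: measurable_funD; apply: measurable_funX => //.
rewrite [X in (X < _)%E](fubini_tonelli1 _ mf); last first.
  by move=> z; rewrite lee_fin addr_ge0 ?sqr_ge0.
have k1 := normal_second_moment s10; have k2 := normal_second_moment s20.
set K1 := (X in (X < _)%E) in k1; set K2 := (X in (X < _)%E) in k2.
have msq : measurable_fun setT (fun x : measurableTypeR R => ((x : R) ^+ 2)%:E).
  by apply/measurable_EFinP; exact: measurable_funX.
have K20 : (0 <= K2)%E by apply: integral_ge0 => x _; rewrite lee_fin sqr_ge0.
have N1 s : normal_prob 0 s [set: measurableTypeR R] = 1%E.
  exact: (@probability_setT _ _ _ (normal_prob 0 s)).
have E x : fubini_F (normal_prob 0 s2) (fun z : plane R => ((z.1 : R) ^+ 2 + (z.2 : R) ^+ 2)%:E) x =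
    ((x ^+ 2)%:E + K2)%E.
  rewrite /fubini_F /=; under eq_integral do rewrite EFinD.
  rewrite ge0_integralD//; last 2 first.
  - by move=> y _; rewrite lee_fin sqr_ge0.
  - by move=> y _; rewrite lee_fin sqr_ge0.
  by rewrite integral_cst// [X in (_ * X)%E]N1 mule1.
under eq_integral do rewrite E.
rewrite ge0_integralD//; last first.
  by move=> y _; rewrite lee_fin sqr_ge0.
have cK : (\int[normal_prob 0 s1]_(x in setT) cst K2 x = K2)%E.
  by apply: etrans (integral_cst _ measurableT K2) _; rewrite [X in (_ * X)%E]N1 mule1.
apply: lte_add_pinfty; first exact: k1.
by apply: le_lt_trans k2; rewrite le_eqVlt; apply/orP; left; apply/eqP; exact: cK.
Qed.

End plane_gauss_moment.

(** For r < 1/2, (r - 1)^2 >= 1/4 and the trivial bound 2M suffices. For r >= 1/2, |x - x/r| <= 2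
    |x| |r - 1| <= h x^2 + (r - 1)^2/h, to be inserted in the modulus of continuity. *)
Lemma radial_perturbation (R : realType) (f : R * R -> R) (M e : R) : continuous f ->
  (forall z, `|f z| <= M) -> 0 < e ->
  exists2 K, 0 <= K & forall (w : R * R) (r : R), 0 <= r ->
    `|f w - f (r^-1 * w.1, r^-1 * w.2)| <=
    e * (1 + (w.1 ^+ 2 + w.2 ^+ 2)) + K * (r - 1) ^+ 2.
Proof.
move=> cf fM e0; have e20 : 0 < e / 2 by rewrite divr_gt0.
have M0 : 0 <= M by exact: le_trans (fM (0, 0)).
have [C C0 fC] := modulus_of_continuity cf fM e20.
have C10 : 0 < C + 1 by rewrite ltr_wpDl.
(* So that C h <= e/2; C + 1 is used as divisor because C may vanish. *)
pose h := e / 2 / (C + 1); have h0 : 0 < h by rewrite divr_gt0.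
have Ch : C * h <= e / 2 
  by rewrite /h mulrCA; apply: ler_piMr; [exact: ltW|rewrite ler_pdivrMr// mul1r lerDl].
have K0 : 0 <= 2 * C / h by apply: divr_ge0; [rewrite mulr_ge0|exact: ltW].
exists (8 * M + 2 * C / h) => [|w r r0]; first by rewrite addr_ge0// mulr_ge0.
have S0 : 0 <= w.1 ^+ 2 + w.2 ^+ 2 by rewrite addr_ge0 ?sqr_ge0.
have q0 : 0 <= (r - 1) ^+ 2 by rewrite sqr_ge0.
have [r2|r2] := ltP r 2^-1.
  have B : `|f w - f (r^-1 * w.1, r^-1 * w.2)| <= 2 * M.
    apply: le_trans (ler_normB _ _) _.
    by have := fM w; have := fM (r^-1 * w.1, r^-1 * w.2); lra.
  have q : 4^-1 <= (r - 1) ^+ 2 by nra.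
  apply: le_trans B _.
  have h1 : 0 <= e * (1 + (w.1 ^+ 2 + w.2 ^+ 2)) by apply: mulr_ge0; [exact: ltW|rewrite addr_ge0].
  have h2 : 2 * M <= 8 * M * (r - 1) ^+ 2 by nra.
  have h3 : 0 <= 2 * C / h * (r - 1) ^+ 2 by rewrite mulr_ge0.
  by rewrite mulrDl; lra.
have rp : 0 < r by rewrite (lt_le_trans _ r2)// invr_gt0.
have B (x : R) : `|x - r^-1 * x| <= h * x ^+ 2 + (r - 1) ^+ 2 / h.
  have -> : x - r^-1 * x = x * (r - 1) / r by field; rewrite gt_eqF.
  rewrite !normrM normfV (gtr0_norm rp).
  have A0 : 0 <= `|x| * `|r - 1| by rewrite mulr_ge0.
  apply: (@le_trans _ _ (2 * (`|x| * `|r - 1|))).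
    by rewrite mulrC; apply: ler_wpM2r => //; rewrite -[2]invrK lef_pV2 ?posrE ?invr_gt0.
  rewrite -[x ^+ 2]real_normK ?num_real// -[(r - 1) ^+ 2]real_normK ?num_real//.
  set p := `|x|; set q := `|r - 1|.
  have -> : h * p ^+ 2 + q ^+ 2 / h = (h * p - q) ^+ 2 / h + 2 * (p * q).
    by field; rewrite gt_eqF.
  by rewrite lerDr; apply: divr_ge0; [exact: sqr_ge0|exact: ltW].
apply: le_trans (fC _ _) _ => /=.
apply: (@le_trans _ _ (e / 2 * (1 + (w.1 ^+ 2 + w.2 ^+ 2)) +
   (C * h * (w.1 ^+ 2 + w.2 ^+ 2) + 2 * C / h * (r - 1) ^+ 2))).
  rewrite lerD2l; apply: (@le_trans _ _ (C * ((h * w.1 ^+ 2 + (r - 1) ^+ 2 / h) +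
      (h * w.2 ^+ 2 + (r - 1) ^+ 2 / h)))).
    by rewrite ler_wpM2l// lerD.
  by rewrite le_eqVlt; apply/orP; left; apply/eqP; ring.
have h1 : C * h * (w.1 ^+ 2 + w.2 ^+ 2) <= e / 2 * (w.1 ^+ 2 + w.2 ^+ 2) by rewrite ler_wpM2r.
have h2 : 0 <= 8 * M * (r - 1) ^+ 2 by rewrite mulr_ge0// mulr_ge0.
have h3 : e * (1 + (w.1 ^+ 2 + w.2 ^+ 2)) =
    e / 2 + e / 2 + e / 2 * (w.1 ^+ 2 + w.2 ^+ 2) + e / 2 * (w.1 ^+ 2 + w.2 ^+ 2) by field.
by rewrite h3 mulrDl; lra.
Qed.

Section radial_approximation.
Context {R : realType} (n : nat).
Hypothesis n0 : (0 < n)%N.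
Local Notation Cn := (n.-tuple (plane R)).
Local Notation pg := (pgrowth (@sqnorm R n)).

Let nR0 : n%:R != 0 :> R. Proof. by rewrite pnatr_eq0 -lt0n. Qed.

Lemma cvec_radial_proj (t : Cn) : cvec (radial_proj t) = ((Cn_norm t)^-1)%:C *: cvec t.
Proof.
apply/matrixP => i j; rewrite !mxE tnth_mktuple; apply/eqP.
by rewrite eq_complex /= !mul0r subr0 addr0 !eqxx.
Qed.

(** Homogeneity of degree 2 in t. It also holds at t = 0, where both inverses are 0 by
    convention. *)
Lemma numerical_fun_radial_proj (A : 'M[R[i]]_n) (t : Cn) :
  numerical_fun ((Num.sqrt n%:R)%:C *: A) (radial_proj t) =
  ((sqnorm t / n%:R)^-1 * (numerical_fun (((Num.sqrt n%:R)^-1)%:C *: A) t).1,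
   (sqnorm t / n%:R)^-1 * (numerical_fun (((Num.sqrt n%:R)^-1)%:C *: A) t).2).
Proof.
pose s : R := Num.sqrt n%:R; pose c := (Cn_norm t)^-1.
have s0 : s != 0 by rewrite sqrtr_eq0 -ltNge ltr0n.
have rE : (sqnorm t / n%:R)^-1 = s ^+ 2 * c ^+ 2.
  by rewrite invfM invrK sqr_sqrtr// exprVn mulrC Cn_norm_sqnorm sqr_sqrtr ?sqnorm_ge0.
rewrite /numerical_fun cvec_radial_proj -/s -/c -!scalemxAl -scalemxAr !cdotZl cdotZr rE.
case: (cdot _ _) => x y /=.
by congr pair; field.
Qed.

Lemma sqnorm_qform1 (t : Cn) : sqnorm t = qform 1%:M t.
Proof. by rewrite /qform mul1mx Re_cdotxx; apply: eq_bigr => i _; rewrite !mxE. Qed.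

Lemma adjmx1 : adjmx (1%:M : 'M[R[i]]_n) = 1%:M.
Proof.
apply/matrixP => i j; rewrite adjmxE !mxE eq_sym.
by case: (i == j); rewrite /= ?oppr0.
Qed.

Lemma pgrowth_sqnorm : pg (@sqnorm R n).
Proof. 
have := pgrowth_qform (1%:M : 'M[R[i]]_n).
by rewrite (_ : qform _ = @sqnorm R n)//; apply/funext => t; rewrite sqnorm_qform1. Qed.

(** |g|^2 is the quadratic form of the identity, so the general variance formula gives Tr 1 = n. *)
Lemma gmean_radius_var : gmean (fun t : Cn => (sqnorm t / n%:R - 1) ^+ 2) = n%:R^-1.
Proof.
have trE : complex.Re (\tr (1%:M : 'M[R[i]]_n)) = n%:R.
  by rewrite mxtrace1 -(rmorph_nat (real_complex R)).
have := gmean_var_qform adjmx1; rewrite mul1mx trE => H.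
rewrite (eq_gmean (g := fun t => n%:R^-1 ^+ 2 * (qform 1%:M t - n%:R) ^+ 2)).
  rewrite gmeanZ ?H; first by field.
  by apply: (pgrowthX 2); apply: pgrowthB; [exact: sqnorm_ge0|exact: pgrowth_qform|exact: pgrowth_cst].
by move=> t; rewrite sqnorm_qform1; field.
Qed.

Section numerical.
Variable D : 'M[R[i]]_n.
Hypothesis trD : \tr D = 0.
Local Notation W := (numerical_fun D).
Local Notation sqW t := ((W t).1 ^+ 2 + (W t).2 ^+ 2).

Lemma numerical_fun1 (t : Cn) : (W t).1 = qform (herm 1 D) t.
Proof. by have := numerical_fun_qform D t 1 0; rewrite oppr0 mul1r mul0r addr0. Qed.

Lemma numerical_fun2 (t : Cn) : (W t).2 = qform (herm (0 -i* 1) D) t.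
Proof. by have := numerical_fun_qform D t 0 1; rewrite mul1r mul0r add0r. Qed.

Lemma pgrowth_numerical_sqr : pg (fun t => sqW t).
Proof.
rewrite (_ : (fun _ => _) = fun t => qform (herm 1 D) t ^+ 2 + qform (herm (0 -i* 1) D) t ^+ 2).
  by apply: pgrowthD; [exact: sqnorm_ge0|apply: pgrowthX; exact: pgrowth_qform..].
by apply/funext => t; rewrite numerical_fun1 numerical_fun2.
Qed.

(** The real and imaginary parts correspond to c = 1 and c = -i: the terms Re(c^2 Tr D^2) cancel and
    each leaves half of Tr D* D. *)
Lemma gmean_numerical_sqr : gmean (fun t => sqW t) = complex.Re (\tr (adjmx D *m D)).
Proof.
rewrite (eq_gmean (g := fun t => qform (herm 1 D) t ^+ 2 + qform (herm (0 -i* 1) D) t ^+ 2)); last first.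
  by move=> t; rewrite numerical_fun1 numerical_fun2.
have E c := etrans (gmean_qform_sqr0 (adjmx_herm c D) (tr_herm c trD)) (tr_herm_sqr c D).
have p c : pg (fun t => qform (herm c D) t ^+ 2) by apply: pgrowthX; exact: pgrowth_qform.
have S c d := etrans (gmeanD (p c) (p d)) (congr2 +%R (E c) (E d)).
rewrite S.
by case: (\tr (D *m D)) => x y /=; field.
Qed.

End numerical.

Section approximation.
Variable A : 'M[R[i]]_n.
Local Notation D := (((Num.sqrt n%:R)^-1)%:C *: A).

Lemma radial_approximation (f : R * R -> R) (M K e : R) : \tr A = 0 ->
  measurable_fun setT (f : plane R -> R) -> (forall z, `|f z| <= M) ->
  (forall (w : R * R) (r : R), 0 <= r ->
    `|f w - f (r^-1 * w.1, r^-1 * w.2)| <=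
    e * (1 + (w.1 ^+ 2 + w.2 ^+ 2)) + K * (r - 1) ^+ 2) ->
  `|gmean (fun t => f (numerical_fun D t)) -
    gmean (fun t => f (numerical_fun ((Num.sqrt n%:R)%:C *: A) (radial_proj t)))| <=
  e * (1 + complex.Re (\tr (adjmx D *m D))) + K / n%:R.
Proof.
move=> trA mf fM fK.
have trD : \tr D = 0 by rewrite mxtraceZ trA mulr0.
have p1 : pg (fun t => f (numerical_fun D t)).
  apply: (bounded_pgrowth (M := M)) => [|t]; last exact: fM.
  exact: (measurableT_comp mf (measurable_numerical_fun D)).
have p2 : pg (fun t => f (numerical_fun ((Num.sqrt n%:R)%:C *: A) (radial_proj t))).
  apply: (bounded_pgrowth (M := M)) => [|t]; last exact: fM.
  apply: (measurableT_comp (measurableT_comp mf (measurable_numerical_fun _))).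
  exact: measurable_radial_proj.
have p12 := pgrowthB (@sqnorm_ge0 R n) p1 p2.
rewrite -(gmeanB p1 p2); apply: le_trans (gmean_norm p12) _.
have q1 := pgrowthD (@sqnorm_ge0 R n) (pgrowth_cst (@sqnorm R n) 1) (pgrowth_numerical_sqr D).
have q2 : pg (fun t => (sqnorm t / n%:R - 1) ^+ 2).
  apply: pgrowthX; apply: (pgrowthB (@sqnorm_ge0 R n)); last exact: pgrowth_cst.
  by apply: pgrowthM; [exact: pgrowth_sqnorm|exact: pgrowth_cst].
have q1e : pg (fun t => e * (1 + ((numerical_fun D t).1 ^+ 2 + (numerical_fun D t).2 ^+ 2))).
  by apply: pgrowthM => //; exact: pgrowth_cst.
have q2K : pg (fun t => K * (sqnorm t / n%:R - 1) ^+ 2).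
  by apply: pgrowthM => //; exact: pgrowth_cst.
have <- : gmean (fun t => e * (1 + ((numerical_fun D t).1 ^+ 2 + (numerical_fun D t).2 ^+ 2)) +
    K * (sqnorm t / n%:R - 1) ^+ 2) = e * (1 + complex.Re (\tr (adjmx D *m D))) + K / n%:R.
  rewrite (gmeanD q1e q2K) (gmeanZ _ q1) (gmeanZ _ q2) gmean_radius_var.
  rewrite (gmeanD (pgrowth_cst (@sqnorm R n) 1) (pgrowth_numerical_sqr D)) gmean_cst.
  by rewrite gmean_numerical_sqr.
apply: (gmean_le (pgrowth_norm p12)).
  exact: (pgrowthD (@sqnorm_ge0 R n) q1e q2K).
move=> t; rewrite numerical_fun_radial_proj; apply: fK.
by rewrite divr_ge0 ?sqnorm_ge0.
Qed.

End approximation.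

End radial_approximation.

Lemma cvg_Re (R : realType) (u : nat -> R[i]) (l : R) :
  u n @[n --> \oo] --> (l%:C : R[i]^o) -> complex.Re (u n) @[n --> \oo] --> l.
Proof.
move=> /(@cvgrPdist_lt _ (R[i]^o)) ul; apply/cvgrPdist_lt => e e0.
have ec : (0 : R[i]) < e%:C by rewrite ltcR.
near=> n; have : `|(l%:C : R[i]^o) - u n| < e%:C by near: n; exact: ul.
move=> /(le_lt_trans (normc_ge_Re _)); rewrite ltcR.
by case: (u n) => x y.
Unshelve. all: by end_near. Qed.

Lemma cvg_Im (R : realType) (u : nat -> R[i]) (l : R) :
  u n @[n --> \oo] --> (l%:C : R[i]^o) -> complex.Im (u n) @[n --> \oo] --> (0 : R).
Proof.
move=> /(@cvgrPdist_lt _ (R[i]^o)) ul; apply/cvgrPdist_lt => e e0.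
have ec : (0 : R[i]) < e%:C by rewrite ltcR.
near=> n; have : `|(l%:C : R[i]^o) - u n| < e%:C by near: n; exact: ul.
(* Multiplication by i preserves the modulus and moves the imaginary part to the real part, up to
   sign. *)
have -> : `|(l%:C : R[i]^o) - u n| = `|(l%:C - u n) * 'i| by rewrite normrM normCi mulr1.
move=> /(le_lt_trans (normc_ge_Re _)); rewrite ltcR.
by rewrite -complexiE; case: (u n) => x y /=; rewrite mulr0 mulr1 !sub0r opprK normrN.
Unshelve. all: by end_near. Qed.

Lemma cvg_sqrtrV_infty (R : realType) :
  (Num.sqrt (n%:R : R))^-1 @[n --> \oo] --> (0 : R).
Proof.
apply/cvgrPdist_le => e e0; near=> n.
have n0 : 0 < n%:R :> R by rewrite ltr0n; near: n; exact: nbhs_infty_gt.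
have s0 : 0 < Num.sqrt (n%:R : R) by rewrite sqrtr_gt0.
rewrite sub0r normrN ger0_norm; last by rewrite invr_ge0 ltW.
rewrite -[e]invrK lef_pV2 ?posrE ?invr_gt0//.
have -> : e^-1 = Num.sqrt (e^-1 ^+ 2) by rewrite sqrtr_sqr ger0_norm// invr_ge0 ltW.
rewrite ler_sqrt; last exact: ltW.
by near: n; exact: nbhs_infty_ger.
Unshelve. all: by end_near. Qed.

(** For n >= exp 1 the logarithm is at least 1, so 0 <= u n <= ln n * u n. *)
Lemma cvg_of_ln_mul (R : realType) (u : nat -> R) : (\forall n \near \oo, 0 <= u n) ->
  ln n%:R * u n @[n --> \oo] --> (0 : R) -> u n @[n --> \oo] --> (0 : R).
Proof.
move=> u0 cu; apply: squeeze_cvgr (cvg_cst _) cu; near=> n.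
have un : 0 <= u n by near: n.
rewrite un/=; apply: ler_peMl => //.
rewrite -[leLHS]expRK ler_ln ?posrE ?expR_gt0//.
  by near: n; exact: nbhs_infty_ger.
by rewrite ltr0n; near: n; exact: nbhs_infty_gt.
Unshelve. all: by end_near. Qed.

Section sequence.
Context {R : realType} (A : forall n : nat, 'M[R[i]]_n) (a b : R).
Hypothesis trA0 : forall n : nat, (0 < n)%N -> \tr (A n) = 0.
Hypothesis normA : opnorm (A n) / Num.sqrt n%:R @[n --> \oo] --> (0 : R).
Hypothesis trAstarA : n%:R^-1 * \tr (adjmx (A n) *m A n) @[n --> \oo] --> (a%:C : R[i]^o).
Hypothesis ab : 0 <= b < a.
Hypothesis trA2 : n%:R^-1 * \tr (A n *m A n) @[n --> \oo] --> (b%:C : R[i]^o).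

Let D n : 'M[R[i]]_n := ((Num.sqrt n%:R)^-1)%:C *: A n.

Let sqrtVC n : ((Num.sqrt (n%:R : R))^-1)%:C * ((Num.sqrt (n%:R : R))^-1)%:C = (n%:R : R[i])^-1.
Proof.
rewrite -rmorphM -invfM -expr2 sqr_sqrtr// fmorphV; congr (_^-1).
exact: (rmorph_nat (real_complex R)).
Qed.

Let trDD n : \tr (D n *m D n) = n%:R^-1 * \tr (A n *m A n).
Proof. by rewrite -scalemxAl -scalemxAr !mxtraceZ mulrA sqrtVC. Qed.

Let trDstarD n : \tr (adjmx (D n) *m D n) = n%:R^-1 * \tr (adjmx (A n) *m A n).
Proof.
rewrite adjmxZ -scalemxAl -scalemxAr !mxtraceZ mulrA -sqrtVC; congr (_ * _ * _).
by rewrite /= oppr0.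
Qed.

Let trD n : \tr (D n) = 0.
Proof.
(* At n = 0 the trace is an empty sum. *)
case: n => [|n]; first by rewrite /mxtrace big_ord0.
by rewrite mxtraceZ trA0// mulr0.
Qed.

(** With c = al - i be, Re(c^2) = al^2 - be^2 multiplies Re Tr D^2, which tends to b, while the
    cross term 2 al be multiplies Im Tr D^2, which tends to 0 because b is real. *)
Lemma cvg_tr_herm_sqr (al be : R) :
  complex.Re (\tr (herm (al -i* be) (D n) *m herm (al -i* be) (D n))) @[n --> \oo] -->
  al ^+ 2 * sd1 a b ^+ 2 + be ^+ 2 * sd2 a b ^+ 2.
Proof.
have x := cvg_Re trA2; have y := cvg_Im trA2; have z := cvg_Re trAstarA.
rewrite (_ : (fun n => _) = fun n => 2^-1 *
  ((al ^+ 2 - be ^+ 2) * complex.Re (n%:R^-1 * \tr (A n *m A n)) +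
   2 * al * be * complex.Im (n%:R^-1 * \tr (A n *m A n)) +
   (al ^+ 2 + be ^+ 2) * complex.Re (n%:R^-1 * \tr (adjmx (A n) *m A n)))); last first.
  apply/funext => n; rewrite tr_herm_sqr trDstarD trDD; congr (_ * (_ + _)); last first.
    by rewrite /= sqrrN.
  by case: (n%:R^-1 * \tr (A n *m A n)) => p q /=; ring.
rewrite sd1_sqr// sd2_sqr//.
have -> : al ^+ 2 * ((a + b) / 2) + be ^+ 2 * ((a - b) / 2) =
    2^-1 * ((al ^+ 2 - be ^+ 2) * b + 2 * al * be * 0 + (al ^+ 2 + be ^+ 2) * a) by field.
apply: cvgMr; apply: cvgD; first apply: cvgD; exact: cvgMr.
Qed.

(** The added 1 makes the constant positive even for A = 0, as the adjoint bound requires; it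
    contributes only n^(-1/2). *)
Lemma vsq_normalized n x : (0 < n)%N ->
  vsq (D n *m x) <= ((opnorm (A n) + 1) / Num.sqrt n%:R) ^+ 2 * vsq x.
Proof.
move=> n0; have o0 := opnorm_ge0 (A n) n0.
have s0 : 0 <= (Num.sqrt (n%:R : R))^-1 by rewrite invr_ge0.
rewrite -scalemxAl vsqZ /= expr0n addr0.
apply: le_trans (ler_wpM2l (sqr_ge0 _) (vsq_opnorm _ _)) _.
rewrite mulrA -exprMn; apply: ler_wpM2r; first exact: vsq_ge0.
rewrite mulrC ler_pXn2r ?nnegrE ?mulr_ge0 ?addr_ge0//.
by apply: ler_wpM2r => //; rewrite lerDl.
Qed.

Let cvg_normalized_norm : (opnorm (A n) + 1) / Num.sqrt n%:R @[n --> \oo] --> (0 : R).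
Proof.
rewrite -[X in _ --> X](addr0 0); under eq_fun do rewrite mulrDl mul1r.
by apply: cvgD => //; exact: cvg_sqrtrV_infty.
Qed.

Lemma cvg_gmean_cos (al be c : R) :
  gmean (fun t => cos (al * (numerical_fun (D n) t).1 + be * (numerical_fun (D n) t).2 + c)) @[n --> \oo] -->
  expR (- (al ^+ 2 * sd1 a b ^+ 2 + be ^+ 2 * sd2 a b ^+ 2) / 2) * cos c.
Proof.
set V := al ^+ 2 * _ + be ^+ 2 * _.
pose v n := complex.Re (\tr (herm (al -i* be) (D n) *m herm (al -i* be) (D n))).
have cv : v n @[n --> \oo] --> V by exact: cvg_tr_herm_sqr.
have cw : expR (- v n / 2) * cos c @[n --> \oo] --> expR (- V / 2) * cos c.
  have c1 : - v n / 2 @[n --> \oo] --> - V / 2 by apply: cvgMl; exact: cvgN.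
  by apply: cvgMl; exact: (cvg_comp _ _ c1 (@continuous_expR R (- V / 2))).
have cq : (al ^+ 2 + be ^+ 2) * ((opnorm (A n) + 1) / Num.sqrt n%:R) ^+ 2 * v n @[n --> \oo] --> (0 : R).
  rewrite -[X in _ --> X](mul0r V) -[X in X * V](mulr0 (al ^+ 2 + be ^+ 2)).
  apply: cvgM => //; apply: cvgMr.
  by rewrite -[X in _ --> X](mul0r 0); apply: cvgM; exact: cvg_normalized_norm.
apply/cvgrPdist_le => e e0.
have e2 : 0 < e / 2 by rewrite divr_gt0.
have e22 : 0 < (e / 2) ^+ 2 by rewrite exprn_gt0.
have /cvgrPdist_le/(_ _ e2) cw2 := cw.
have /cvgrPdist_le/(_ _ e22) cq2 := cq.
near=> n; have n0 : (0 < n)%N by near: n; exact: nbhs_infty_gt.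
have h1 : `|expR (- V / 2) * cos c - expR (- v n / 2) * cos c| <= e / 2 by near: n.
have h2 : `|0 - (al ^+ 2 + be ^+ 2) * ((opnorm (A n) + 1) / Num.sqrt n%:R) ^+ 2 * v n| <=
    (e / 2) ^+ 2 by near: n.
have K0 : 0 < (opnorm (A n) + 1) / Num.sqrt (n%:R : R).
  by rewrite divr_gt0 ?sqrtr_gt0 ?ltr0n// ltr_wpDl// opnorm_ge0.
have h3 := tr_herm_four (al -i* be) K0 (fun x => vsq_normalized x n0).
(* The free parameter is e/2: since Tr H^4 <= (e/2)^2 for large n, the error is at most (e/2 +
   e/2)/2. *)
have h4 := qform_charfun (adjmx_herm (al -i* be) (D n)) (tr_herm (al -i* be) (trD n)) c e2.
set T := complex.Re (\tr (_ *m (_ *m _))) in h3 h4.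
have hT : T <= (e / 2) ^+ 2.
  apply: le_trans h3 _; move: h2; rewrite sub0r normrN /= sqrrN; exact: (le_trans (ler_norm _)).
have hTe : T / (e / 2) <= e / 2 by rewrite ler_pdivrMr// -expr2.
rewrite (eq_gmean (g := fun t => cos (qform (herm (al -i* be) (D n)) t + c))); last first.
  by move=> t; rewrite numerical_fun_qform.
apply: le_trans (ler_distD (expR (- v n / 2) * cos c) _ _) _.
have -> : e = e / 2 + e / 2 by field.
apply: lerD => //; rewrite distrC; apply: le_trans h4 _.
by rewrite ler_pdivrMr// mulr_natr mulr2n lerD2l.
Unshelve. all: by end_near. Qed.

Let nu n : probability (plane R) R := distribution (@tuple_gauss R n) (numerical_fun (D n)).

Let nu0 : probability (plane R) R := plane_gauss (sd1 a b) (sd2 a b).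

Let sq (z : plane R) : R := (z.1 : R) ^+ 2 + (z.2 : R) ^+ 2.

Lemma integral_nu_bounded n (f : plane R -> R) (M : R) : measurable_fun setT f ->
  (forall z, `|f z| <= M) -> (\int[nu n]_z f z)%R = gmean (fun t => f (numerical_fun (D n) t)).
Proof.
move=> mf fM; rewrite /Rintegral integral_distribution_numerical//.
apply: (bounded_pgrowth (M := M)) => [|t]; last exact: fM.
exact: (measurableT_comp mf (measurable_numerical_fun (D n))).
Qed.

Let cvg_cos_nu (al be c : R) :
  \int[nu n]_z cos (al * z.1 + be * z.2 + c) @[n --> \oo] -->
  \int[nu0]_z cos (al * z.1 + be * z.2 + c).
Proof.
rewrite [X in _ --> X]/Rintegral (plane_charfun (sd1_neq0 ab) (sd2_neq0 ab)) /=.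
have mc : measurable_fun setT (fun z : plane R => cos (al * z.1 + be * z.2 + c)).
  by apply: measurable_trigpoly; constructor.
rewrite (_ : (fun n => _) = fun n => gmean (fun t => cos (al * (numerical_fun (D n) t).1 +
    be * (numerical_fun (D n) t).2 + c))).
  exact: cvg_gmean_cos.
by apply/funext => n; rewrite (integral_nu_bounded n mc (fun z => cos_max _)).
Qed.

Let moment : exists m, (\forall n \near \oo, (\int[nu n]_z (sq z)%:E <= m%:E)%E) /\
  (\int[nu0]_z (sq z)%:E <= m%:E)%E.
Proof.
have z := cvg_Re trAstarA.
have S0 : (0 <= \int[nu0]_z (sq z)%:E)%E.
  by apply: integral_ge0 => w _; rewrite lee_fin addr_ge0 ?sqr_ge0.
have Sfin : (\int[nu0]_z (sq z)%:E)%E \is a fin_num.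
  by rewrite ge0_fin_numE//; exact: plane_gauss_second_moment (sd1_neq0 ab) (sd2_neq0 ab).
(* The second moment of n^(-1/2) <A g, g> is Tr D* D, which tends to a and is eventually at most a +
   1. *)
exists (Num.max (a + 1) (fine (\int[nu0]_z (sq z)%:E)%E)); split; last first.
  by rewrite -[leLHS]fineK// lee_fin le_max lexx orbT.
have msq : measurable_fun setT sq.
  by apply: measurable_funD; apply: measurable_funX.
have /cvgrPdist_le/(_ _ ltr01) z1 := z.
near=> n.
rewrite (integral_distribution_numerical msq (pgrowth_numerical_sqr (D n))).
rewrite (gmean_numerical_sqr (trD n)) trDstarD lee_fin le_max.
have : `|a - complex.Re (n%:R^-1 * \tr (adjmx (A n) *m A n))| <= 1 by near: n.
by rewrite ler_norml => /andP[h _]; apply/orP; left; lra.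
Unshelve. all: by end_near. Qed.

Lemma weak_cvg_normalized : weak_cvg
    (fun n => numerical_measure ((Num.sqrt n%:R)%:C *: A n)) (gaussian_measure a b).
Proof.
move=> f cf [M fM].
have [m [mn m0]] := moment.
have L := levy_continuity cvg_cos_nu mn m0 cf fM.
have mf : measurable_fun setT (f : plane R -> R) := continuous_bounded_measurable cf fM.
have z := cvg_Re trAstarA.
pose g n := gmean (fun t => f (numerical_fun ((Num.sqrt n%:R)%:C *: A n) (radial_proj t))).
have gE : \forall n \near \oo,
    (g n)%:E = (\int[numerical_measure ((Num.sqrt n%:R)%:C *: A n)]_z (f z)%:E)%E.
  near=> n; rewrite (integral_numerical_measure _ _ mf fM)//.
  by near: n; exact: nbhs_infty_gt.
rewrite (integral_gaussian_measure ab) -[X in _ --> X]fineK; last first.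
  exact: (integrable_fin_num measurableT (bounded_integrable nu0 mf fM)).
apply: cvg_trans (near_eq_cvg gE) _.
apply: cvg_EFin; first by apply: nearW.
apply/cvgrPdist_le => e e0.
have e3 : 0 < e / 3 by rewrite divr_gt0.
have a2 : 0 < a + 2 by have /andP[? ?] := ab; lra.
(* Eventually 1 + Tr D* D <= a + 2, so the weighted part of the radial error is at most e/3. The
   other thirds pay for K/n and for the Gaussian quadratic form. *)
have d0 : 0 < e / 3 / (a + 2) by rewrite divr_gt0.
have [K K0 fK] := radial_perturbation cf fM d0.
have /cvgrPdist_le/(_ _ e3) L3 := L.
have /cvgrPdist_le/(_ _ ltr01) z1 := z.
near=> n; have n0 : (0 < n)%N by near: n; exact: nbhs_infty_gt.
have nR : 0 < n%:R :> R by rewrite ltr0n.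
have h1 : `|(\int[nu0]_z f z)%R - (\int[nu n]_z f z)%R| <= e / 3 by near: n.
have h2 := radial_approximation n0 (trA0 n0) mf fM fK.
have h3 : e / 3 / (a + 2) * (1 + complex.Re (\tr (adjmx (D n) *m D n))) <= e / 3.
  rewrite -mulrA; apply: ler_piMr; first exact: ltW.
  rewrite mulrC ler_pdivrMr// mul1r trDstarD.
  have : `|a - complex.Re (n%:R^-1 * \tr (adjmx (A n) *m A n))| <= 1 by near: n.
  by rewrite ler_norml => /andP[h _]; lra.
have h4 : K / n%:R <= e / 3.
  rewrite ler_pdivrMr// mulrC -ler_pdivrMr//.
  by near: n; exact: nbhs_infty_ger.
rewrite (integral_nu_bounded n mf fM) in h1.
apply: le_trans (ler_distD (gmean (fun t => f (numerical_fun (D n) t))) _ _) _.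
have -> : e = e / 3 + (e / 3 + e / 3) by field.
apply: lerD; first exact: h1.
by apply: le_trans h2 _; exact: lerD.
Unshelve. all: by end_near. Qed.

End sequence.

Theorem theorem8p5 (R : realType) (A : forall n : nat, 'M[R[i]]_n) (a b : R)
    (trA0 : forall n : nat, (0 < n)%N -> \tr (A n) = 0)
    (normA : ln n%:R * opnorm (A n) / Num.sqrt n%:R @[n --> \oo] --> (0 : R))
    (a_gt0 : 0 < a)
    (trAstarA : n%:R^-1 * \tr (adjmx (A n) *m A n) @[n --> \oo]
                  --> (a%:C : R[i]^o))
    (b_ge0_lt : 0 <= b < a)
    (trA2 : n%:R^-1 * \tr (A n *m A n) @[n --> \oo] --> (b%:C : R[i]^o)) :
  weak_cvg
    (fun n => numerical_measure ((Num.sqrt n%:R)%:C *: A n))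
    (gaussian_measure a b).
Proof.
apply: weak_cvg_normalized => //.
apply: cvg_of_ln_mul; last by under eq_fun do rewrite mulrA.
near=> n; rewrite divr_ge0//; apply: opnorm_ge0.
by near: n; exact: nbhs_infty_gt.
Unshelve. all: by end_near. Qed.
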